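(* Let $\beta$ be arbitrary (complex). For $s_1,s_2\in\{+1,-1\}$ let $M_{-,-}=KKer_{\mathcal F_{((1,0);\beta)}}$, $M_{+,-}=CKer_{\mathcal F_{((1,0);\beta)}}$, $M_{-,+}=KCoker_{\mathcal F_{((1,0);\beta)}}$, $M_{+,+}=CCoker_{\mathcal F_{((1,0);\beta)}}$ (the indices being the signs of $s_1,s_2$). Their characters and supercharacters are $$Ch_{M_{s_1,s_2}}(q,x_1,x_2,x_3,x_4)=\frac{q^{\frac12(2\beta+1)}}{\prod_{n=1}^\infty(1-q^n)^6}\sum_{l_1,l_2=1}^\infty(-1)^{l_1+l_2}q^{\frac12(l_1^2+l_2^2+s_1l_1+s_2l_2)}\sum_{i,j,k\in\mathbb Z}q^{\frac12(i^2+j^2+k^2-2kj+(1+2s_1l_1)i-(1+2s_1l_1)j+(3+2s_2l_2)k)}x_1^{j}x_2^{i-k}x_3^{1-j}x_4^{4\beta+3+2i-2j+2k},$$ $$Sch_{M_{s_1,s_2}}(q,x_1,x_2,x_3,x_4)=\frac{q^{\frac12(2\beta+1)}}{\prod_{n=1}^\infty(1-q^n)^6}\sum_{l_1,l_2=1}^\infty(-1)^{l_1+l_2}q^{\frac12(l_1^2+l_2^2+s_1l_1+s_2l_2)}\sum_{i,j,k\in\mathbb Z}(-1)^{1+i-j+k}q^{\frac12(i^2+j^2+k^2-2kj+(1+2s_1l_1)i-(1+2s_1l_1)j+(3+2s_2l_2)k)}x_1^{j}x_2^{i-k}x_3^{1-j}x_4^{4\beta+3+2i-2j+2k}.$$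
   Context: $0<|q|<1$ with a fixed branch of $\log q$, $q^x=e^{x\log q}$, $[x]_q=(q^x-q^{-x})/(q-q^{-1})$. Oscillators: $a^j_n,Q_{a^j}$ ($1\le j\le4$), $c^l_n,Q_{c^l}$ ($l=1,2$), $n\in\mathbb Z$, with $[a^j_n,a^{j'}_m]=(-1)^{j+1}\delta_{jj'}\delta_{m+n,0}\frac{[n]_q^2}n$ and $[c^l_n,c^{l'}_m]=\delta_{ll'}\delta_{m+n,0}\frac{[n]_q^2}n$ for $n\ne0$, $[a^j_0,Q_{a^{j'}}]=\delta_{jj'}$, $[c^l_0,Q_{c^{l'}}]=\delta_{ll'}$, all other commutators zero. The vacuum satisfies $a^j_m|0\rangle=c^l_m|0\rangle=0$ for $m\ge0$; $F_{\lambda_1,\lambda_2,\lambda_3,\lambda_4;\lambda_5,\lambda_6}$ is the Fock space generated freely by the $a^j_{-m},c^l_{-m}$ ($m>0$) over $e^{\sum_{i=1}^4\lambda_iQ_{a^i}+\lambda_5Q_{c^1}+\lambda_6Q_{c^2}}|0\rangle$. Define $$\mathcal F_{((1,0);\beta)}=\bigoplus_{i,j,k\in\mathbb Z}F_{\beta+1+i,\,-\beta-1-i+j,\,\beta+1-j+k,\,-\beta-k;\,i-j,\,k}.$$ It is a level-one $U_q[\widehat{gl(2|2)}]$-module under the free boson realization, in which $h_j$ acts as $A^j_0$ ($1\le j\le4$) and the derivation $d$ as below. For $i=1,2$: $c^i(z)=Q_{c^i}+c^i_0\ln z-\sum_{n\ne0}\frac{c^i_n}{[n]_q}z^{-n}$,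 $\eta^i(z)=\sum_n\eta^i_nz^{-n-1}=:e^{c^i(z)}:$, $\xi^i(z)=\sum_n\xi^i_nz^{-n}=:e^{-c^i(z)}:$ (normal ordering puts negative modes and $Q$'s to the left). For $\mathcal F=\mathcal F_{((1,0);\beta)}$, the following submodules are defined: $KKer_{\mathcal F}=\eta^1_0\xi^1_0\eta^2_0\xi^2_0\mathcal F$, $KCoker_{\mathcal F}=\eta^1_0\xi^1_0\xi^2_0\eta^2_0\mathcal F$, $CKer_{\mathcal F}=\xi^1_0\eta^1_0\eta^2_0\xi^2_0\mathcal F$, $CCoker_{\mathcal F}=\xi^1_0\eta^1_0\xi^2_0\eta^2_0\mathcal F$ (images of commuting projectors on $\mathcal F$). $A^i_n=(-1)^{i+1}(a^i_n+a^{i+1}_n)$ ($i=1,2,3$), $A^4_n=\frac{q^n+q^{-n}}2\sum_{l=1}^4(-1)^{l+1}a^l_n$. Let $(a_{ij})_{1\le i,j\le4}$ be the symmetric invertible matrix with zero diagonal, $a_{12}=1$, $a_{23}=-1$, $a_{13}=0$, $a_{14}=2$, $a_{24}=-2$, $a_{34}=2$. Put $A^{*i}_n=\sum_{l=1}^3a^{-1}_{il}A^l_n+\frac2{q^n+q^{-n}}a^{-1}_{i4}A^4_n$ ($i=1,2,3$), $A^{*4}_n=4\sum_{l=1}^4a^{-1}_{4l}A^l_n$ ($n\ne0$), $A^{*j}_0=\sum_{l=1}^4a^{-1}_{jl}A^l_0$. Then $$d=-\sum_{m>0}\frac{m^2}{[m]_q^2}\Big\{\sum_{i=1}^3A^i_{-m}A^{*i}_m+\frac1{2(q^m+q^{-m})}A^4_{-m}A^{*4}_m+c^1_{-m}c^1_m+c^2_{-m}c^2_m\Big\}-\frac12\Big\{\sum_{i=1}^4A^i_0A^{*i}_0+c^1_0(c^1_0+1)+c^2_0(c^2_0+1)\Big\}.$$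 $Ch_M=\mathrm{tr}_M(q^{-d}x_1^{h_1}x_2^{h_2}x_3^{h_3}x_4^{h_4})$ and $Sch_M=\mathrm{tr}_M((-1)^{N_f}q^{-d}x_1^{h_1}x_2^{h_2}x_3^{h_3}x_4^{h_4})$, where $N_f=a^2_0+a^4_0$ and $(-1)^{N_f}$ is normalized by omitting the overall constant phase $(-1)^{-2\beta}$, i.e. it acts as $e^{\sqrt{-1}\pi(a^2_0+a^4_0+2\beta)}$. Both are formal generating series in complex powers of $x_1,\dots,x_4$; the coefficient of each monomial is a convergent function of $q$. *)

(* Defs.v *)
From HB Require Import structures.
From mathcomp Require Import all_boot all_order all_algebra.
From mathcomp Require Import finmap multiset complex.
From mathcomp Require Import all_classical all_reals all_analysis.
From mathcomp.analysis.showcase Require Import summability.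
From mathcomp Require monalg.
Import -(notations) monalg.

Set Implicit Arguments.
Unset Strict Implicit.
Unset Printing Implicit Defensive.

Import Order.TTheory GRing.Theory Num.Theory.
Import numFieldNormedType.Exports.

Local Open Scope classical_set_scope.
Local Open Scope ring_scope.

Section Fock.
(* C is the field of complex numbers, abstracted from its construction, and
   qpow is x |-> q^x. *)
Variables (C : numClosedFieldType) (qpow : C -> C).

Definition qint (x : C) : C :=
  (qpow x - qpow (- x)) / (qpow 1 - qpow (-1)).

(* All the indices are shifted by one: inl j, j = 0..3, is the oscillator
   a^(j+1) and inr l, l = 0, 1, is c^(l+1). *)
Definition species := ('I_4 + 'I_2)%type.

(* A state is a monomial in the creation operators applied to the vacuum
   e^(sum_i lambda_i Q_(a^i) + lambda_5 Q_(c^1) + lambda_6 Q_(c^2)) |0>, where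
   mom = (lambda_1, ..., lambda_4) and cmom = (lambda_5, lambda_6); the latter
   are integers, so that z^(c^l_0) is single-valued. The element (s, m) of occ
   stands for a factor s_(-(m+1)). *)
Record state := State {
  mom : {ffun 'I_4 -> C};
  cmom : {ffun 'I_2 -> int};
  occ : {mset (species * nat)%type}%mset }.

HB.instance Definition _ := gen_eqMixin state.
HB.instance Definition _ := gen_choiceMixin state.

(* The direct sum of the Fock spaces F_lambda over all momenta lambda. *)
Definition fock : lmodType C := monalg.malg state C.

Definition ket (b : state) : fock := monalg.mkmalgU b 1.

Definition lin (f : state -> fock) (v : fock) : fock :=
  \sum_(b <- monalg.msupp v) monalg.mcoeff b v *: f b.

Definition zero_mode (s : species) (b : state) : C :=
  match s with inl j => mom b j | inr l => (cmom b l)%:~R end.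

(* The scalar [s_n, s_{-n}], n > 0. *)
Definition osc_norm (s : species) (n : nat) : C :=
  (match s with inl j => (-1) ^+ j | inr _ => 1 end)
    * qint n%:R ^+ 2 / n%:R.

(* The mode n of s. Positive modes act as osc_norm s n times the derivative in
   the creation operator of mode -n; Negz m is -(m+1). *)
Definition osc (s : species) (n : int) : fock -> fock :=
  match n with
  | Posz 0 => lin (fun b => zero_mode s b *: ket b)
  | Posz m.+1 => lin (fun b =>
      ((occ b (s, m))%:R * osc_norm s m.+1)
        *: ket (State (mom b) (cmom b) (occ b `\ (s, m))%mset))
  | Negz m => lin (fun b =>
      ket (State (mom b) (cmom b) ((s, m) +` occ b)%mset))
  end.

Definition a_ (j : 'I_4) : int -> fock -> fock := osc (inl j).
Definition c_ (l : 'I_2) : int -> fock -> fock := osc (inr l).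

Definition qsym (n : int) : C := qpow n%:~R + qpow (- n%:~R).

Definition A_ (i : 'I_4) (n : int) (v : fock) : fock :=
  if (i < 3)%N then (-1) ^+ i *: (a_ i n v + a_ (inord i.+1) n v)
  else (qsym n / 2) *: \sum_(l < 4) (-1) ^+ l *: a_ l n v.

Definition amat : 'M[C]_4 :=
  \matrix_(i, j) nth 0 (nth [::]
    [:: [:: 0;  1;  0;  2];
        [:: 1;  0; -1; -2];
        [:: 0; -1;  0;  2];
        [:: 2; -2;  2;  0]] i) j.

Definition Astar (i : 'I_4) (n : int) (v : fock) : fock :=
  if n == 0 then \sum_(l < 4) invmx amat i l *: A_ l 0 v
  else if (i < 3)%N then
    \sum_(l < 4 | (l < 3)%N) invmx amat i l *: A_ l n v
      + (2 / qsym n * invmx amat i ord_max) *: A_ ord_max n v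
  else 4 *: \sum_(l < 4) invmx amat ord_max l *: A_ l n v.

(* The sum over m is locally finite. *)
Definition d_op (v : fock) : fock :=
  - (\sum_(m \in [set m : nat | (0 < m)%N])
       (m%:R ^+ 2 / qint m%:R ^+ 2) *:
       (\sum_(i < 4 | (i < 3)%N) A_ i (- m%:Z) (Astar i m%:Z v)
        + (2 * qsym m%:Z)^-1 *: A_ ord_max (- m%:Z) (Astar ord_max m%:Z v)
        + \sum_(l < 2) c_ l (- m%:Z) (c_ l m%:Z v)))
  - 2^-1 *: (\sum_(i < 4) A_ i 0 (Astar i 0 v)
             + \sum_(l < 2) c_ l 0 (c_ l 0 v + v)).

Definition h_ (j : 'I_4) : fock -> fock := A_ j 0.

(* Formal power series in one variable with (commuting) operator
   coefficients. *)
Definition opseries := nat -> fock -> fock.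

Definition opmul (X Y : opseries) : opseries :=
  fun r v => \sum_(i < r.+1) X i (Y (r - i)%N v).

Definition opone : opseries := fun r v => if r == 0%N then v else 0.

(* exp X for X with zero constant term: X^k then has no term of degree < k. *)
Definition opexp (X : opseries) : opseries :=
  fun r v => \sum_(k < r.+1) (k`!%:R)^-1 *: iter k (opmul X) opone r v.

(* The coefficient of z^(-n) in c^l(z), for n != 0. *)
Definition c_coef (l : 'I_2) (n : int) (v : fock) : fock :=
  - ((qint n%:~R)^-1 *: c_ l n v).

(* The two oscillator factors of :exp(eps c^l(z)): -- negative modes, a series
   in z, and positive modes, a series in z^(-1). *)
Definition vneg (eps : int) (l : 'I_2) : opseries :=
  opexp (fun m v => if m == 0%N then 0 else eps%:~R *: c_coef l (- m%:Z) v).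
Definition vpos (eps : int) (l : 'I_2) : opseries :=
  opexp (fun m v => if m == 0%N then 0 else eps%:~R *: c_coef l m%:Z v).

(* exp(eps Q_{c^l}) *)
Definition expQ (eps : int) (l : 'I_2) : fock -> fock :=
  lin (fun b => ket (State (mom b)
    [ffun l' => cmom b l' + (if l' == l then eps else 0)] (occ b))).

(* The projection on the eigenspace c^l_0 = n. *)
Definition c0_proj (l : 'I_2) (n : int) : fock -> fock :=
  lin (fun b => if cmom b l == n then ket b else 0).

(* The coefficient of z^N in :exp(eps c^l(z)):, where z^(eps c^l_0)
   contributes z^(eps n) on the eigenspace c^l_0 = n. On each vector only
   finitely many (r, s, n) contribute. *)
Definition vertex (eps : int) (l : 'I_2) (N : int) (v : fock) : fock :=
  \sum_(t \in [set t : nat * nat * int |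
                t.1.1%:Z - t.1.2%:Z + eps * t.2 = N])
     vneg eps l t.1.1 (expQ eps l (c0_proj l t.2 (vpos eps l t.1.2 v))).

Definition eta_ (l : 'I_2) (n : int) : fock -> fock := vertex 1 l (- n - 1).
Definition xi_ (l : 'I_2) (n : int) : fock -> fock := vertex (-1) l (- n).

Definition mom_of (beta : C) (i j k : int) : {ffun 'I_4 -> C} :=
  [ffun l : 'I_4 => nth 0 [:: beta + 1 + i%:~R;
                              - beta - 1 - i%:~R + j%:~R;
                              beta + 1 - j%:~R + k%:~R;
                              - beta - k%:~R] l].

Definition cmom_of (i j k : int) : {ffun 'I_2 -> int} :=
  [ffun l : 'I_2 => nth 0 [:: i - j; k] l].

Definition calF (beta : C) : set fock :=
  [set v | forall b, b \in monalg.msupp v -> exists i j k : int,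
             mom b = mom_of beta i j k /\ cmom b = cmom_of i j k].

Local Notation eta1 := (eta_ 0 0).
Local Notation xi1 := (xi_ 0 0).
Local Notation eta2 := (eta_ 1 0).
Local Notation xi2 := (xi_ 1 0).

(* eta^l_0 and xi^l_0 do not preserve calF, but each pair below does. *)
Definition KKer (beta : C) : set fock :=
  [set eta1 (xi1 (eta2 (xi2 v))) | v in calF beta].
Definition KCoker (beta : C) : set fock :=
  [set eta1 (xi1 (xi2 (eta2 v))) | v in calF beta].
Definition CKer (beta : C) : set fock :=
  [set xi1 (eta1 (eta2 (xi2 v))) | v in calF beta].
Definition CCoker (beta : C) : set fock :=
  [set xi1 (eta1 (xi2 (eta2 v))) | v in calF beta].

(* The sign s is encoded as a boolean, true for +1. *)
Definition sgn (s : bool) : int := if s then 1 else -1.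

Definition submod (beta : C) (s1 s2 : bool) : set fock :=
  match s1, s2 with
  | false, false => KKer beta
  | true, false => CKer beta
  | false, true => KCoker beta
  | true, true => CCoker beta
  end.

Definition is_basis (W : set fock) (n : nat) (e : 'I_n -> fock) : Prop :=
  (forall i, W (e i)) /\
  (forall v, W v -> exists! x : 'rV[C]_n, v = \sum_i x 0 i *: e i).

(* W has finite dimension, T preserves W, and T has trace t on W. *)
Definition fd_trace (W : set fock) (T : fock -> fock) (t : C) : Prop :=
  exists n (e : 'I_n -> fock) (X : 'M[C]_n),
    [/\ is_basis W e,
        forall i, T (e i) = \sum_j X j i *: e j
      & t = \tr X].

Definition weight_space (M : set fock) (delta : C) (mu : 'rV[C]_4) :
    set fock :=
  [set v | [/\ M v, d_op v = delta *: v
             & forall j, h_ j v = mu 0 j *: v]].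

(* tr_M (T q^(-d) x_1^(h_1) ... x_4^(h_4)) is the formal series whose
   coefficient at x^mu is chi mu: M is the direct sum of finite-dimensional
   simultaneous eigenspaces of d and the h_j, which T preserves, and the
   traces on those of weight mu add up (unconditionally) to chi mu. *)
Definition is_character (M : set fock) (T : fock -> fock)
    (chi : 'rV[C]_4 -> C) : Prop :=
  (forall v, M v -> exists s : seq fock, v = \sum_(w <- s) w /\
     forall w, w \in s -> exists delta mu, weight_space M delta mu w) /\
  exists t : C -> 'rV[C]_4 -> C,
    (forall delta mu, fd_trace (weight_space M delta mu) T (t delta mu)) /\
    forall mu, partial_sum (fun delta => qpow (- delta) * t delta mu)
                 @ totally --> chi mu.

(* The exponents of x_1, ..., x_4 in the term (i, j, k). *)
Definition xweight (beta : C) (i j k : int) : 'rV[C]_4 :=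
  \row_l nth 0 [:: j%:~R; (i - k)%:~R; (1 - j)%:~R;
                   4 * beta + (3 + 2 * i - 2 * j + 2 * k)%:~R] l.

(* The coefficient of x^mu in
     q^((2 beta + 1)/2) / prod_n (1 - q^n)^6
       * sum_(l1, l2 >= 1) ... sum_(i, j, k) u(i, j, k) q^(...) x^(xweight).
   At most one (i, j, k) has xweight mu. *)
Definition formula (beta : C) (s1 s2 : bool) (u : int -> int -> int -> C)
    (mu : 'rV[C]_4) : C :=
  qpow (2^-1 * (2 * beta + 1))
  / lim (\prod_(1 <= n < N.+1) (1 - qpow n%:R) ^+ 6 @[N --> \oo])
  * summability.sum (fun l : nat * nat =>
      let l1 : int := l.1.+1%:Z in let l2 : int := l.2.+1%:Z in
      (-1) ^ (l1 + l2)
      * qpow (2^-1 * (l1 ^+ 2 + l2 ^+ 2 + sgn s1 * l1 + sgn s2 * l2)%:~R)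
      * \sum_(t \in [set t : int * int * int |
                      xweight beta t.1.1 t.1.2 t.2 = mu])
          let i := t.1.1 in let j := t.1.2 in let k := t.2 in
          u i j k
          * qpow (2^-1 * (i ^+ 2 + j ^+ 2 + k ^+ 2 - 2 * k * j
                             + (1 + 2 * sgn s1 * l1) * i
                             - (1 + 2 * sgn s1 * l1) * j
                             + (3 + 2 * sgn s2 * l2) * k)%:~R)).

End Fock.

Section Complex.
Variable R : realType.

(* Seen as a numClosedFieldType, R[i] receives its norm topology. *)
Definition Cplx : numClosedFieldType := R[i].

Definition cexp (z : Cplx) : Cplx :=
  let: Complex x y := (z : R[i]) in
  Complex (expR x * trigo.cos y) (expR x * trigo.sin y).

(* x |-> q^x, for the choice lq of log q. *)
Definition qexp (lq x : Cplx) : Cplx := cexp (x * lq).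

(* (-1)^(N_f), normalized: exp(i pi (a^2_0 + a^4_0 + 2 beta)). *)
Definition fermion_sign (beta : Cplx) : fock Cplx -> fock Cplx :=
  lin (fun b => cexp ((Complex 0 pi : Cplx) *
     (zero_mode (inl (inord 1)) b + zero_mode (inl (inord 3)) b + 2 * beta))
     *: ket b).

End Complex.

(* Main.v *)
Require Import Defs.
From HB Require Import structures.
From mathcomp Require Import all_boot all_order all_algebra.
From mathcomp Require Import finmap multiset complex.
From mathcomp Require Import all_classical all_reals all_analysis.
From mathcomp.analysis.showcase Require Import summability.
From mathcomp Require monalg.
From mathcomp Require Import zify ring lra.
Import -(notations) monalg.

(** In the basis of states the derivation d and the h_j are diagonal
    ([d_opE], [h_opE]): the change of basis from the a^j to the A^i turns the
    form given by the inverse of the matrix (a_ij) into the signature form of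
    the a^j, so d is minus the total energy of the excited modes minus a
    quadratic function of the momentum. A charge n of
    c^l contributes the energy n (n + 1) / 2. For given i, j, k and a given
    energy there are finitely many states, one for each multiset of excited
    modes of the right weight; the span of these states is called a sector.

    The modules are images of projectors made of the zero modes of eta^l and
    xi^l. The modes of these fields satisfy the Clifford relations
    ([clifford]). They are proved mode by mode: the commutator of c^l_m with
    the defect of the relation is a combination of defects with shifted
    indices, so the defect vanishes on every state once it vanishes on the
    states without excitations of c^l. There it is a homogeneous vector which,
    by induction on its degree, is killed by all the annihilation operators;
    it remains to treat degree 0, where only a scalar is left, a sum of two
    Taylor coefficients of (1 - x)^(-1) or of 1 - x. Hence the zero modes eta,
    xi for a given l have square zero and eta xi + xi eta = 1, so eta xi and
    xi eta are idempotents ([zproj_idem]), and those for l = 1 commute with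
    those for l = 2.

    A zero mode changes the charge by one and preserves the energy. By
    cyclicity of the trace, the traces of a projector on the sectors of charge
    n and n + s add up to the dimension of the sector of charge n + s. At a
    given energy the sectors of large charge are zero, so this recursion
    telescopes to the alternating sum over l >= 1 of (-1)^(l-1) times the
    dimension of the sector of charge n + s l ([trace_zproj2]); this is where
    the sums over l_1 and l_2 come from. The trace of an idempotent is the
    dimension of its image, with an explicit basis ([idem_basis]), which gives
    the multiplicities of the weight spaces; the operators 1 and (-1)^(N_f)
    are scalar on each sector.

    It remains to sum over the energies. For a given weight of the h_j, that
    is for given i, j, k, the family indexed by l_1, l_2 and a multiset A of
    modes with terms (-1)^(l_1 + l_2) q^energy is absolutely summable. Grouped
    by energy its sum is the character; as a product it is the sum over l_1
    and l_2 times the sum of q^(weight of A), which is the inverse of the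
    Euler product to the sixth power, one factor for each of the six kinds of
    oscillators ([euler]). Completing the squares in the exponent gives the
    formula ([ghost_exponent], [character_of_scalar]). *)

Set Implicit Arguments.
Unset Strict Implicit.
Unset Printing Implicit Defensive.

Import Order.TTheory GRing.Theory Num.Theory.
Import numFieldNormedType.Exports.

Local Open Scope classical_set_scope.
Local Open Scope ring_scope.

(** * Linear operators on the Fock space *)

Section Linop.
Variable C : numClosedFieldType.
Local Notation fock := (fock C).
Local Notation ket := (@ket C).
Implicit Types (T : fock -> fock) (u v : fock) (b : state C).

(** A bare predicate, since the operators of the Fock space come as plain
    functions. *)
Definition linop T := forall a u v, T (a *: u + v) = a *: T u + T v.

Lemma linopD T u v : linop T -> T (u + v) = T u + T v.
Proof. by move=> hT; rewrite -{1}[u]scale1r hT scale1r. Qed.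

Lemma linop0 T : linop T -> T 0 = 0.
Proof. by move=> hT; apply: (addrI (T 0)); rewrite -linopD // !addr0. Qed.

Lemma linopZ T a u : linop T -> T (a *: u) = a *: T u.
Proof. by move=> hT; rewrite -[a *: u]addr0 hT linop0 // addr0. Qed.

Lemma linopDZ T u v c : linop T -> T (u + c *: v) = T u + c *: T v.
Proof. by move=> hT; rewrite linopD // linopZ. Qed.

Lemma linop_sum T (I : Type) (r : seq I) (P : pred I) (F : I -> fock) :
  linop T -> T (\sum_(i <- r | P i) F i) = \sum_(i <- r | P i) T (F i).
Proof.
move=> hT; elim/big_rec2: _ => [|i y x _ <-]; first exact: linop0.
by rewrite linopD.
Qed.

Lemma eq_addZ (V : lmodType C) (u u' v v' : V) (c c' : C) :
  u = u' -> c = c' -> v = v' -> u + c *: v = u' + c' *: v'.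
Proof. by move=> -> -> ->. Qed.

Lemma eq_addZ0 (V : lmodType C) (u v : V) (c : C) : 0 = c -> u = u + c *: v.
Proof. by move=> <-; rewrite scale0r addr0. Qed.

Lemma eq_add2 (V : lmodType C) (u u' v v' : V) : u = u' -> v = v' -> u + v = u' + v'.
Proof. by move=> -> ->. Qed.

Lemma eq_addZr (V : lmodType C) (u v v' : V) (c : C) :
  v = v' -> u + c *: v = c *: v' + u.
Proof. by move=> ->; rewrite addrC. Qed.

Lemma linop_id : linop id. Proof. by []. Qed.

Lemma linop_zero : linop (fun=> 0).
Proof. by move=> a u v; rewrite scaler0 addr0. Qed.

Lemma linop_comp T1 T2 : linop T1 -> linop T2 -> linop (fun v => T1 (T2 v)).
Proof. by move=> h1 h2 a u v; rewrite h2 h1. Qed.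

Lemma linop_add T1 T2 : linop T1 -> linop T2 -> linop (fun v => T1 v + T2 v).
Proof. by move=> h1 h2 a u v; rewrite h2 h1 scalerDr addrACA. Qed.

Lemma linop_scale c T : linop T -> linop (fun v => c *: T v).
Proof. by move=> h a u v; rewrite h scalerDr !scalerA mulrC. Qed.

Lemma linop_opp T : linop T -> linop (fun v => - T v).
Proof. by move=> h a u v; rewrite h opprD scalerN. Qed.

Lemma linop_bigsum (I : Type) (r : seq I) (P : pred I) (T : I -> fock -> fock) :
  (forall i, P i -> linop (T i)) -> linop (fun v => \sum_(i <- r | P i) T i v).
Proof.
move=> h a u v; rewrite scaler_sumr -big_split; apply: eq_bigr => i Pi.
exact: h.
Qed.

Lemma linop_if (c : bool) T1 T2 :
  linop T1 -> linop T2 -> linop (fun v => if c then T1 v else T2 v).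
Proof. by case: c. Qed.

Lemma mcoeff_ket b b' : mcoeff b' (ket b) = (b == b')%:R.
Proof. by rewrite mcoeffU. Qed.

Lemma msupp_ket b : msupp (ket b) = [fset b]%fset.
Proof. by rewrite msuppU oner_eq0. Qed.

Lemma ket_sum (v : fock) : v = \sum_(b <- msupp v) mcoeff b v *: ket b.
Proof.
rewrite {1}(monalgE v); apply: eq_bigr => b _.
by apply/malgP => k; rewrite mcoeffZ !mcoeffU mulr_natr.
Qed.

Lemma linE f v (D : {fset (state C)}) : (msupp v `<=` D)%fset ->
  lin f v = \sum_(b <- D) mcoeff b v *: f b.
Proof.
move=> sD; rewrite /lin; apply: big_fset_incl => //= b bD.
by move=> /mcoeff_outdom ->; rewrite scale0r.
Qed.

Lemma lin_linop f : linop (lin f).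
Proof.
move=> a u v.
pose D := (msupp (a *: u + v) `|` msupp u `|` msupp v)%fset.
rewrite !(@linE f _ D); last first.
- exact: (fsubset_trans (fsubsetUl _ _) (fsubsetUl _ _)).
- exact: (fsubset_trans (fsubsetUr _ _) (fsubsetUl _ _)).
- exact: fsubsetUr.
rewrite scaler_sumr -big_split; apply: eq_bigr => b _.
by rewrite mcoeffD mcoeffZ scalerDl scalerA.
Qed.

Lemma lin_ket f b : lin f (ket b) = f b.
Proof. by rewrite /lin msupp_ket big_seq_fset1 mcoeff_ket eqxx scale1r. Qed.

Lemma linop_lin T : linop T -> T =1 lin (fun b => T (ket b)).
Proof.
move=> hT v; rewrite {1}(ket_sum v) linop_sum //.
by apply: eq_bigr => b _; rewrite linopZ.
Qed.

(** A record, so that [supp P v] stays folded when lemmas are applied to it. *)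
Record supp (P : state C -> Prop) v : Prop :=
  Supp { suppP : forall b, b \in msupp v -> P b }.

Lemma supp_ket P b : P b -> supp P (ket b).
Proof. by move=> Pb; split=> b'; rewrite msupp_ket inE => /eqP ->. Qed.

Lemma supp0 P : supp P 0.
Proof. by split=> b; rewrite msupp0. Qed.

Lemma suppD P u v : supp P u -> supp P v -> supp P (u + v).
Proof.
move=> hu hv; split=> b /(fsubsetP (msuppD_le _ _)); rewrite inE => /orP[].
  exact: suppP.
exact: suppP.
Qed.

Lemma suppZ P a v : supp P v -> supp P (a *: v).
Proof. by move=> hv; split=> b /(fsubsetP (msuppZ_le _ _)); exact: suppP. Qed.

Lemma supp_sum P (I : eqType) (r : seq I) (Q : pred I) (F : I -> fock) :
  (forall i, i \in r -> Q i -> supp P (F i)) -> supp P (\sum_(i <- r | Q i) F i).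
Proof.
move=> h; rewrite big_seq_cond; elim/big_ind: _ => [|u v|i /andP[]]; first exact: supp0.
- exact: suppD.
- exact: h.
Qed.

Lemma suppW (P Q : state C -> Prop) v :
  (forall b, P b -> Q b) -> supp P v -> supp Q v.
Proof. by move=> PQ Pv; split=> b /(suppP Pv) /PQ. Qed.

Lemma supp_linop (P Q : state C -> Prop) T v : linop T ->
  (forall b, P b -> supp Q (T (ket b))) -> supp P v -> supp Q (T v).
Proof.
move=> hT PQ Pv; rewrite linop_lin //; apply: supp_sum => b bv _.
by apply: suppZ; apply: PQ; apply: suppP bv.
Qed.

(** Computations are done on states: a linear operator is determined by its
    values on the states that occur in a vector. *)
Lemma eq_linop_supp (P : state C -> Prop) T1 T2 v : linop T1 -> linop T2 ->
  (forall b, P b -> T1 (ket b) = T2 (ket b)) -> supp P v -> T1 v = T2 v.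
Proof.
move=> h1 h2 e Pv; rewrite linop_lin // [RHS]linop_lin // /lin.
by apply: eq_big_seq => b bv; rewrite e //; apply: suppP bv.
Qed.

Lemma eq_linop T1 T2 : linop T1 -> linop T2 ->
  (forall b, T1 (ket b) = T2 (ket b)) -> T1 =1 T2.
Proof. by move=> h1 h2 e v; apply: (@eq_linop_supp (fun=> True)) => //; split. Qed.

Lemma supp_nil (P : state C -> Prop) v : (forall b, ~ P b) -> supp P v -> v = 0.
Proof.
move=> nP Pv; apply/malgP => b; rewrite mcoeff0.
by apply: mcoeff_outdom; apply/negP => /(suppP Pv) /nP.
Qed.

End Linop.

Notation insupp S := (supp (fun b => b \in S)).

(** * Oscillators *)

Section Oscillators.
Variables (C : numClosedFieldType) (qpow : C -> C).
Local Notation fock := (fock C).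
Local Notation ket := (@ket C).
Local Notation osc := (@osc C qpow).
Local Notation osc_norm := (@osc_norm C qpow).
Implicit Types (u v : fock) (b : state C) (s : species).

Definition addocc (x : species * nat) b := State (mom b) (cmom b) (x +` occ b)%mset.
Definition delocc (x : species * nat) b := State (mom b) (cmom b) (occ b `\ x)%mset.

Lemma osc_neg_ket s m b : osc s (Negz m) (ket b) = ket (addocc (s, m) b).
Proof. exact: lin_ket. Qed.

Lemma osc_pos_ket s m b : osc s m.+1%:Z (ket b) =
  ((occ b (s, m))%:R * osc_norm s m.+1) *: ket (delocc (s, m) b).
Proof. exact: lin_ket. Qed.

Lemma osc_zero_ket s b : osc s 0 (ket b) = zero_mode s b *: ket b.
Proof. exact: lin_ket. Qed.

Lemma linop_osc s n : linop (osc s n).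
Proof. by case: n => [[|m]|m]; exact: lin_linop. Qed.

Lemma deloccK x b : (0 < occ b x)%N -> addocc x (delocc x b) = b.
Proof.
by move=> h; case: b h => p n A /= h; congr State; apply: msetB1K; rewrite in_mset.
Qed.

Lemma addoccK x b : delocc x (addocc x b) = b.
Proof. by case: b => p n A; congr State; exact: msetD1K. Qed.

Lemma addoccC x y b : addocc x (addocc y b) = addocc y (addocc x b).
Proof. by rewrite /addocc /= msetDCA. Qed.

Lemma deloccC x y b : delocc x (delocc y b) = delocc y (delocc x b).
Proof. by congr State; apply/msetP => z; rewrite !msetB1E subnAC. Qed.

Lemma del_addocc x y b : x != y -> delocc x (addocc y b) = addocc y (delocc x b).
Proof.
move=> xy; congr State; apply/msetP => z; rewrite !(mset1DE, msetB1E).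
by case: (z =P x) => [->|]; rewrite ?(negbTE xy) ?add0n // !subn0.
Qed.

(** Removing and adding a mode commute up to the occupation number, which
    differs by one when the two modes coincide. *)
Lemma osc_pos_neg s s' m m' v :
  osc s m.+1%:Z (osc s' (Negz m') v) = osc s' (Negz m') (osc s m.+1%:Z v)
    + (if (s, m) == (s', m') then osc_norm s m.+1 else 0) *: v.
Proof.
move: v; apply: eq_linop.
- by apply: linop_comp; exact: linop_osc.
- apply: linop_add; first by apply: linop_comp; exact: linop_osc.
  exact/linop_scale/linop_id.
move=> b; rewrite osc_neg_ket !osc_pos_ket (linopZ _ _ (linop_osc s' (Negz m'))).
rewrite osc_neg_ket /= mset1DE natrD; case: eqVneq => [<-|ne].
  rewrite addoccK; move: (osc_norm s m.+1) => n1.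
  have -> : (true%:R + (occ b (s, m))%:R) * n1 = (occ b (s, m))%:R * n1 + n1.
    by rewrite mulrDl mul1r addrC.
  have [->|k0] := posnP (occ b (s, m)); last by rewrite deloccK // scalerDl.
  by rewrite !mul0r !add0r !scale0r add0r.
by rewrite add0r scale0r addr0 del_addocc.
Qed.

Lemma osc_neg_neg s s' m m' v :
  osc s (Negz m) (osc s' (Negz m') v) = osc s' (Negz m') (osc s (Negz m) v).
Proof.
move: v; apply: eq_linop; try by apply: linop_comp; exact: linop_osc.
by move=> b; rewrite !osc_neg_ket addoccC.
Qed.

Lemma osc_pos_pos s s' m m' v :
  osc s m.+1%:Z (osc s' m'.+1%:Z v) = osc s' m'.+1%:Z (osc s m.+1%:Z v).
Proof.
move: v; apply: eq_linop; try by apply: linop_comp; exact: linop_osc.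
move=> b; rewrite !osc_pos_ket !(linopZ _ _ (linop_osc _ _)) !osc_pos_ket /=.
rewrite deloccC !msetB1E.
case: (eqVneq (s, m) (s', m')) => [[-> ->]|ne]; first exact: erefl.
rewrite !subn0.
move: (osc_norm _ _) (osc_norm _ _) => n1 n2.
by rewrite !scalerA; congr (_ *: _); exact: mulrC.
Qed.

End Oscillators.

(** * Exponentials of operator series *)

Section OpExp.
Variable C : numClosedFieldType.
Local Notation fock := (fock C).
Implicit Types (u v : fock) (b : state C).
Variable X : opseries C.
Hypothesis X_lin : forall i, linop (X i).
Hypothesis X0 : forall v, X 0 v = 0.

Definition oppow k := iter k (opmul X) (@opone C).

Arguments oppow : simpl never.

Lemma oppowS k r v : oppow k.+1 r v = \sum_(i < r.+1) X i (oppow k (r - i)%N v).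
Proof. by []. Qed.

Lemma linop_oppow k r : linop (oppow k r).
Proof.
elim: k r => [|k IH] r; first by apply: linop_if; [exact: linop_id|exact: linop_zero].
by apply: linop_bigsum => i _; apply: linop_comp.
Qed.

Lemma linop_opexp r : linop (opexp X r).
Proof. by apply: linop_bigsum => i _; apply: linop_scale; exact: linop_oppow. Qed.

Lemma oppow_small k r v : (r < k)%N -> oppow k r v = 0.
Proof.
elim: k r => [//|k IH] r rk; rewrite oppowS big1 // => -[[|i] ir] _ /=.
  exact: X0.
by rewrite IH ?linop0 //; lia.
Qed.

Lemma opexpE K r v : (r < K)%N ->
  opexp X r v = \sum_(k < K) (k`!%:R)^-1 *: oppow k r v.
Proof.
move=> rK; rewrite /opexp (big_ord_widen K (fun k => k`!%:R^-1 *: oppow k r v)) //.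
rewrite big_mkcond; apply: eq_bigr => k _; case: ifPn => //.
by rewrite -leqNgt => h; rewrite oppow_small ?scaler0.
Qed.

Lemma opexp0 v : opexp X 0 v = v.
Proof. by rewrite /opexp big_ord_recr big_ord0 /= add0r fact0 invr1 scale1r. Qed.

(** Coefficients of negative degree are zero, so that shifts of the degree
    need no case distinction. *)
Definition opexpz (r : int) : fock -> fock :=
  match r with Posz n => opexp X n | Negz _ => fun=> 0 end.

Lemma linop_opexpz r : linop (opexpz r).
Proof. by case: r => n; [exact: linop_opexp|exact: linop_zero]. Qed.

Section Commutator.
Variables (T : fock -> fock) (m : nat) (c : C).
Hypothesis T_lin : linop T.
Hypothesis m0 : (0 < m)%N.
Hypothesis TX : forall i v, T (X i v) = X i (T v) + (if i == m then c else 0) *: v.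

(** The commutator with T is a derivation, and its value c z^m on X(z) is
    central. *)
Lemma comm_oppow k r v : T (oppow k r v) = oppow k r (T v) +
  (if (m <= r)%N then (k%:R * c) *: oppow k.-1 (r - m)%N v else 0).
Proof.
elim: k r => [|k IH] r.
  rewrite mul0r scale0r if_same addr0 /oppow /= /opone.
  by case: eqP => // _; rewrite linop0.
rewrite !oppowS linop_sum //.
under eq_bigr do rewrite TX IH (linopD _ _ (X_lin _)) -addrA.
rewrite big_split; congr (_ + _) => /=.
rewrite big_split /= addrC.
have -> : \sum_(i < r.+1) (if i == m :> nat then c else 0) *: oppow k (r - i)%N v
   = if (m <= r)%N then c *: oppow k (r - m)%N v else 0.
  case: leqP => mr.
    rewrite (bigD1 (Ordinal (mr : (m < r.+1)%N))) //= eqxx big1 ?addr0 // => i.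
    by rewrite -val_eqE /= => /negbTE ->; rewrite scale0r.
  rewrite big1 // => i _; case: eqP => [im|_]; last by rewrite scale0r.
  by have := ltn_ord i; rewrite im; lia.
have -> : \sum_(i < r.+1) X i (if (m <= r - i)%N then (k%:R * c) *: oppow k.-1 (r - i - m)%N v else 0)
   = if (m <= r)%N then (k%:R * c) *: oppow k (r - m)%N v else 0.
  case: k {IH} => [|k].
    rewrite mul0r scale0r if_same big1 // => i _.
    by rewrite scale0r if_same linop0.
  case: leqP => mr; last first.
    by rewrite big1 // => i _; case: ifP => [h|_]; [lia|exact: linop0].
  rewrite oppowS scaler_sumr (big_ord_widen r.+1 (fun i => (k.+1%:R * c) *: X i (oppow k (r - m - i)%N v)));
    last lia.
  rewrite [RHS]big_mkcond; apply: eq_bigr => i _.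
  have -> : (m <= r - i)%N = (i < (r - m).+1)%N by have := ltn_ord i; lia.
  case: ifP => h; last by rewrite linop0.
  by rewrite linopZ //= subnAC.
case: leqP => mr; last by rewrite addr0.
by rewrite -scalerDl -natr1 mulrDl mul1r [c + _]addrC.
Qed.

(** If [T, X(z)] = c z^m, then [T, exp X(z)] = c z^m exp X(z). *)
Lemma comm_opexpz r v : T (opexpz r v) = opexpz r (T v) + c *: opexpz (r - m%:Z) v.
Proof.
case: r => r; last first.
  by rewrite /= linop0 // add0r (_ : Negz r - m%:Z = Negz (r + m)) /= ?scaler0 //; lia.
rewrite /= /opexp linop_sum //.
under eq_bigr do rewrite linopZ // comm_oppow scalerDr.
rewrite big_split; congr (_ + _) => /=.
case: leqP => mr; last first.
  rewrite big1 => [|i _]; last by rewrite scaler0.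
  by rewrite (_ : r%:Z - m%:Z = Negz (m - r).-1) /= ?scaler0 //; lia.
rewrite (_ : r%:Z - m%:Z = (r - m)%N); last lia.
rewrite /= (@opexpE r) ?scaler_sumr; last lia.
rewrite big_ord_recl /= mul0r scale0r scaler0 add0r; apply: eq_bigr => k _.
rewrite !scalerA; congr (_ *: _); rewrite /= factS natrM.
have : k.+1%:R != 0 :> C by rewrite pnatr_eq0.
have : k`!%:R != 0 :> C by rewrite pnatr_eq0 -lt0n fact_gt0.
by move: (k.+1%:R : C) (k`!%:R : C) => x y x0 y0; field; rewrite x0 y0.
Qed.

End Commutator.

Lemma comm0_opexpz T r v : linop T -> (forall i v, T (X i v) = X i (T v)) ->
  T (opexpz r v) = opexpz r (T v).
Proof.
move=> hT TX; rewrite (@comm_opexpz T 1 0) ?scale0r ?addr0 // => i w.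
by rewrite TX if_same scale0r addr0.
Qed.

Section Derivative.
Hypothesis XX : forall i j v, X i (X j v) = X j (X i v).

Lemma comm_oppow0 i k r v : X i (oppow k r v) = oppow k r (X i v).
Proof.
rewrite (@comm_oppow (X i) 1 0) // => [|j w]; first by rewrite mulr0 scale0r if_same addr0.
by rewrite XX if_same scale0r addr0.
Qed.

(** The coefficient of z^r in z d/dz X(z)^(k+1) = (k+1) z X'(z) X(z)^k. *)
Lemma deriv_oppow k r v : r%:R *: oppow k.+1 r v =
  k.+1%:R *: \sum_(i < r.+1) i%:R *: X i (oppow k (r - i)%N v).
Proof.
elim: k r => [|k IH] r.
  rewrite scale1r oppowS scaler_sumr; apply: eq_bigr => i _.
  rewrite /oppow /= /opone; case: (eqVneq (r - i)%N 0%N) => ri; last by rewrite linop0 // !scaler0.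
  by congr (_%:R *: _); have := ltn_ord i; lia.
rewrite oppowS scaler_sumr.
have E i : (i < r.+1)%N -> r%:R *: X i (oppow k.+1 (r - i)%N v) =
   i%:R *: X i (oppow k.+1 (r - i)%N v) + k.+1%:R *: \sum_(j < (r - i).+1)
     j%:R *: X j (X i (oppow k (r - i - j)%N v)).
  move=> ir; have {1}-> : r = (i + (r - i))%N by lia.
  rewrite natrD scalerDl; congr (_ + _).
  rewrite -linopZ // IH linopZ // linop_sum //; congr (_ *: _); apply: eq_bigr => j _.
  by rewrite linopZ // XX.
under eq_bigr => i _ do rewrite E //.
rewrite big_split /= -scaler_sumr -[k.+2%:R]natr1 scalerDl scale1r; apply: eq_addZr.
(* Both sides are sums over the pairs (i, j) with i + j <= r. *)
transitivity (\sum_(i < r.+1) \sum_(j < r.+1) if (i + j <= r)%N then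
   j%:R *: X j (X i (oppow k (r - i - j)%N v)) else 0).
  apply: eq_bigr => i _; rewrite (big_ord_widen r.+1 (fun j => j%:R *: X j (X i (oppow k (r - i - j)%N v))));
    last lia.
  rewrite big_mkcond; apply: eq_bigr => j _.
  by rewrite (_ : (j < (r - i).+1)%N = (i + j <= r)%N) //; have := ltn_ord i; lia.
rewrite exchange_big; apply: eq_bigr => j _ /=.
rewrite oppowS linop_sum // scaler_sumr.
rewrite (big_ord_widen r.+1 (fun i => j%:R *: X j (X i (oppow k (r - j - i)%N v)))); last lia.
rewrite [RHS]big_mkcond; apply: eq_bigr => i _; rewrite [(r - i - j)%N]subnAC.
by rewrite (_ : (i < (r - j).+1)%N = (i + j <= r)%N) //; have := ltn_ord j; lia.
Qed.

(** The coefficient of z^r in z d/dz exp X(z) = exp X(z) z X'(z); it gives the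
    coefficients of exp X(z) recursively. *)
Lemma deriv_opexp r v : r%:R *: opexp X r v =
  \sum_(i < r) i.+1%:R *: opexp X (r - i.+1)%N (X i.+1 v).
Proof.
have -> : opexp X r v = oppow 0 r v + \sum_(k < r) (k.+1`!%:R)^-1 *: oppow k.+1 r v.
  by rewrite /opexp big_ord_recl /= fact0 invr1 scale1r.
rewrite scalerDr.
have -> : r%:R *: oppow 0 r v = 0.
  by rewrite /oppow /= /opone; case: eqP => [->|_]; rewrite ?scale0r ?scaler0.
rewrite add0r scaler_sumr.
transitivity (\sum_(k < r) \sum_(i < r) i.+1%:R *: ((k`!%:R)^-1 *: oppow k (r - i.+1)%N (X i.+1 v))).
  apply: eq_bigr => k _; rewrite scalerA mulrC -scalerA deriv_oppow.
  rewrite scalerA /= factS natrM invfM mulrAC mulVf ?pnatr_eq0 // mul1r.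
  rewrite big_ord_recl /= scale0r add0r scaler_sumr; apply: eq_bigr => i _.
  by rewrite comm_oppow0 scalerA mulrC -scalerA.
rewrite exchange_big; apply: eq_bigr => i _ /=.
by rewrite -scaler_sumr -opexpE //; have := ltn_ord i; lia.
Qed.

End Derivative.

(** If the coefficient of z^i in X(z) is homogeneous of degree e i, so is that
    of exp X(z). *)
Lemma supp_opexp (P : int -> state C -> Prop) (e : int) :
  (forall i d v, supp (P d) v -> supp (P (d + e * i%:Z)) (X i v)) ->
  forall r d v, supp (P d) v -> supp (P (d + e * r%:Z)) (opexp X r v).
Proof.
move=> hX r d v Pv.
have H k : forall r d v, supp (P d) v -> supp (P (d + e * r%:Z)) (oppow k r v).
  elim: k => [|k IH] {}r {}d {}v {}Pv.
    rewrite /oppow /= /opone; case: eqP => [->|_]; last exact: supp0.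
    by rewrite mulr0 addr0.
  rewrite oppowS; apply: supp_sum => i _ _.
  rewrite (_ : d + e * r%:Z = d + e * (r - i)%N%:Z + e * i%:Z); first by apply: hX; apply: IH.
  by have := ltn_ord i; rewrite -addrA -mulrDr => h; congr (_ + _ * _); lia.
by rewrite /opexp; apply: supp_sum => k _ _; apply/suppZ/H.
Qed.

End OpExp.

(** * Locally finite sums and degrees *)

Lemma fsbig_list (V : zmodType) (I : choiceType) (A : set I) (r : seq I) (F : I -> V) :
  uniq r -> (forall t, t \in r -> A t) -> (forall t, A t -> t \notin r -> F t = 0) ->
  \sum_(t \in A) F t = \sum_(t <- r) F t.
Proof.
move=> ur rA h; rewrite (fsbigE r) // [RHS]big_seq [LHS]big_seq_cond.
by apply: eq_bigl => t; case: (boolP (t \in r)) => // /rA At; exact/idP/mem_set.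
Qed.

Section Fsum.
Variables (C : numClosedFieldType) (I : choiceType) (A : set I).
Variable f : I -> fock C -> fock C.
Local Notation ket := (@ket C).
Hypothesis f_lin : forall t, linop (f t).
Hypothesis f_fin : forall b, exists r : seq I,
  forall t, A t -> t \notin r -> f t (ket b) = 0.

(** A vector involves finitely many states, so a family of operators that is
    finite on each state is finite on each vector. *)
Lemma locfin (v : fock C) : exists r : seq I,
  forall t, A t -> t \notin r -> f t v = 0.
Proof.
have H (s : seq (state C)) : exists r : seq I, forall b, b \in s ->
    forall t, A t -> t \notin r -> f t (ket b) = 0.
  elim: s => [|b s [r hr]]; first by exists [::].
  have [r' hr'] := f_fin b; exists (r' ++ r) => b'; rewrite inE => /orP[/eqP ->|b's] t At.
    by rewrite mem_cat negb_or => /andP[tr' _]; exact: hr'.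
  by rewrite mem_cat negb_or => /andP[_ tr]; exact: hr.
have [r hr] := H (msupp v).
exists r => t At tr; rewrite linop_lin // /lin big_seq big1 // => b bv.
by rewrite (hr b) // scaler0.
Qed.

Lemma fsumE (r : seq I) v : (forall t, A t -> t \notin r -> f t v = 0) ->
  \sum_(t \in A) f t v = \sum_(t <- undup [seq t <- r | t \in A]) f t v.
Proof.
move=> hr; apply: fsbig_list; first exact: undup_uniq.
  by move=> t; rewrite mem_undup mem_filter => /andP[/set_mem].
move=> t At; rewrite mem_undup mem_filter => /nandP[|]; last exact: hr.
by case/negP; exact: mem_set.
Qed.

Lemma linop_fsum : linop (fun v => \sum_(t \in A) f t v).
Proof.
move=> a u v; have [r1 h1] := locfin u; have [r2 h2] := locfin v.
have hu t : A t -> t \notin r1 ++ r2 -> f t u = 0.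
  by move=> At; rewrite mem_cat negb_or => /andP[t1 _]; exact: h1.
have hv t : A t -> t \notin r1 ++ r2 -> f t v = 0.
  by move=> At; rewrite mem_cat negb_or => /andP[_ t2]; exact: h2.
have huv t : A t -> t \notin r1 ++ r2 -> f t (a *: u + v) = 0.
  by move=> At tr; rewrite f_lin hu // hv // scaler0 addr0.
rewrite (fsumE hu) (fsumE hv) (fsumE huv).
by rewrite scaler_sumr -big_split; apply: eq_bigr => t _; exact: f_lin.
Qed.

Lemma comm_fsum T v : linop T -> (forall t v, T (f t v) = f t (T v)) ->
  T (\sum_(t \in A) f t v) = \sum_(t \in A) f t (T v).
Proof.
move=> hT Tf; have [r hr] := locfin v.
have hr' t : A t -> t \notin r -> f t (T v) = 0.
  by move=> At tr; rewrite -Tf hr // linop0.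
rewrite (fsumE hr) (fsumE hr').
by rewrite linop_sum //; apply: eq_bigr.
Qed.

End Fsum.

Section Degree.
Variable C : numClosedFieldType.
Implicit Types (b : state C) (P : pred species) (A : {mset (species * nat)}%mset).

(** The excitation energy in the species P; [x.2.+1] undoes the shift in the
    encoding of the modes. *)
Definition wdeg P A : nat := \sum_(x <- A | P x.1) x.2.+1.

Lemma wdeg_add P x A : wdeg P (x +` A)%mset = (P x.1 * x.2.+1 + wdeg P A)%N.
Proof.
rewrite /wdeg (perm_big (x :: A : seq _)).
  by rewrite big_cons; case: (P x.1); rewrite ?mul1n.
by apply/allP => y _ /=; rewrite !count_mem_mset mset1DE (eq_sym y).
Qed.

Lemma wdeg_del P x A : (0 < A x)%N ->
  wdeg P A = (P x.1 * x.2.+1 + wdeg P (A `\ x)%mset)%N.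
Proof. by move=> h; rewrite -wdeg_add msetB1K // in_mset. Qed.

Lemma wdeg_eq0 P A x : wdeg P A = 0%N -> P x.1 -> A x = 0%N.
Proof.
move=> h Px; have [//|/(wdeg_del P)] := posnP (A x).
by rewrite h Px mul1n.
Qed.

Lemma wdeg_gt0 P A : (0 < wdeg P A)%N -> exists2 x, P x.1 & (0 < A x)%N.
Proof.
rewrite /wdeg; case: (boolP (has (fun x => P x.1) A)) => [/hasP[x xA Px] _|nh].
  by exists x => //; rewrite -in_mset.
by rewrite big_hasC.
Qed.

Lemma wdeg_predC P A : wdeg predT A = (wdeg (predC P) A + wdeg P A)%N.
Proof. by rewrite addnC /wdeg [LHS](bigID (fun x => P x.1)). Qed.

Definition ldeg (l : 'I_2) b := wdeg (pred1 (inr l)) (occ b).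
Definition odeg (l : 'I_2) b := wdeg (predC (pred1 (inr l))) (occ b).
Definition tdeg b := wdeg predT (occ b).

Lemma tdegE l b : tdeg b = (odeg l b + ldeg l b)%N.
Proof. exact: wdeg_predC. Qed.

End Degree.

(** * Vertex operators *)

Arguments Defs.osc : simpl never.

Section Vertex.
Variables (C : numClosedFieldType) (qpow : C -> C).
Local Notation fock := (fock C).
Local Notation ket := (@ket C).
Local Notation qint := (qint qpow).
Local Notation osc := (@osc C qpow).
Local Notation vertex := (@vertex C qpow).
Hypothesis qint_neq0 : forall m : nat, qint m.+1%:R != 0.
Implicit Types (u v : fock) (b : state C) (l : 'I_2) (nu : {ffun 'I_2 -> int}).
Implicit Types (d N e : int) (mu : {ffun 'I_4 -> C}).

Lemma qintN x : qint (- x) = - qint x.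
Proof. by rewrite /Defs.qint opprK -mulNr opprB. Qed.

(** The two halves of eps c^l(z), creation operators as a series in z and
    annihilation operators as a series in z^(-1). *)
Definition cminus e l : opseries C :=
  fun m v => if m == 0%N then 0 else e%:~R *: c_coef qpow l (- m%:Z) v.
Definition cplus e l : opseries C :=
  fun m v => if m == 0%N then 0 else e%:~R *: c_coef qpow l m%:Z v.

Lemma cminusS e l m v : cminus e l m.+1 v = (e%:~R / qint m.+1%:R) *: osc (inr l) (Negz m) v.
Proof.
rewrite /cminus /= /c_coef /c_ (_ : - m.+1%:Z = Negz m) //.
by rewrite NegzE mulrNz qintN invrN scaleNr opprK scalerA.
Qed.

Lemma cplusS e l m v : cplus e l m.+1 v = (- e%:~R / qint m.+1%:R) *: osc (inr l) m.+1%:Z v.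
Proof. by rewrite /cplus /= /c_coef /c_ scalerN scalerA mulNr scaleNr. Qed.

Lemma cminus0 e l v : cminus e l 0 v = 0. Proof. by []. Qed.
Lemma cplus0 e l v : cplus e l 0 v = 0. Proof. by []. Qed.

Lemma linop_cminus e l i : linop (cminus e l i).
Proof.
case: i => [|i] a u v; first by rewrite !cminus0 scaler0 addr0.
rewrite !cminusS; exact: (linop_scale _ (linop_osc _ _ _)).
Qed.

Lemma linop_cplus e l i : linop (cplus e l i).
Proof.
case: i => [|i] a u v; first by rewrite !cplus0 scaler0 addr0.
rewrite !cplusS; exact: (linop_scale _ (linop_osc _ _ _)).
Qed.

(** The commutator of c_m with c(z) is z^m times this scalar, for |m|. *)
Definition kappa (m : nat) : C := qint m%:R / m%:R.

Lemma kappaE m : kappa m = qint m%:R / m%:R.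
Proof. by []. Qed.

Lemma osc_pos_cminus e l m i v :
  osc (inr l) m.+1%:Z (cminus e l i v) = cminus e l i (osc (inr l) m.+1%:Z v)
  + (if i == m.+1 then e%:~R * kappa m.+1 else 0) *: v.
Proof.
case: i => [|i]; first by rewrite !cminus0 (linop0 (linop_osc _ _ _)) scale0r addr0.
rewrite !cminusS (linopZ _ _ (linop_osc _ _ _)) osc_pos_neg scalerDr scalerA.
apply: eq_addZ; [exact: erefl| |exact: erefl].
rewrite xpair_eqE eqxx /= eqSS eq_sym; case: eqP => [->|_]; last by rewrite mulr0.
have h : m.+1%:R != 0 :> C by rewrite pnatr_eq0.
rewrite /Defs.osc_norm /kappa mul1r expr2.
move: (qint_neq0 m) h; move: (m.+1%:R : C) (e%:~R : C) (qint _) => y z x x0 y0.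
by field; rewrite x0 y0.
Qed.

Lemma osc_neg_cplus e l m i v :
  osc (inr l) (Negz m) (cplus e l i v) = cplus e l i (osc (inr l) (Negz m) v)
  + (if i == m.+1 then e%:~R * kappa m.+1 else 0) *: v.
Proof.
case: i => [|i]; first by rewrite !cplus0 (linop0 (linop_osc _ _ _)) scale0r addr0.
rewrite !cplusS (linopZ _ _ (linop_osc _ _ _)) osc_pos_neg scalerDr scalerA -addrA -scalerDl.
apply: eq_addZ0.
rewrite xpair_eqE eqxx /= eqSS; case: eqP => [->|_]; last by rewrite mulr0 addr0.
have h : m.+1%:R != 0 :> C by rewrite pnatr_eq0.
rewrite /Defs.osc_norm /kappa mul1r expr2.
move: (qint_neq0 m) h; move: (m.+1%:R : C) (e%:~R : C) (qint _) => y z x x0 y0.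
by field; rewrite x0 y0.
Qed.

Lemma osc_neg_cminus s e l m i v :
  osc s (Negz m) (cminus e l i v) = cminus e l i (osc s (Negz m) v).
Proof.
case: i => [|i]; first by rewrite !cminus0 (linop0 (linop_osc _ _ _)).
by rewrite !cminusS (linopZ _ _ (linop_osc _ _ _)) osc_neg_neg.
Qed.

Lemma osc_pos_cplus s e l m i v :
  osc s m.+1%:Z (cplus e l i v) = cplus e l i (osc s m.+1%:Z v).
Proof.
case: i => [|i]; first by rewrite !cplus0 (linop0 (linop_osc _ _ _)).
by rewrite !cplusS (linopZ _ _ (linop_osc _ _ _)) osc_pos_pos.
Qed.

Lemma cplus_cplus e l i j v : cplus e l i (cplus e l j v) = cplus e l j (cplus e l i v).
Proof.
case: j => [|j]; first by rewrite !cplus0 (linop0 (linop_cplus _ _ _)).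
by rewrite !cplusS (linopZ _ _ (linop_cplus _ _ _)) osc_pos_cplus.
Qed.

Definition shiftc l e nu : {ffun 'I_2 -> int} :=
  [ffun l' => nu l' + (if l' == l then e else 0)].

Lemma expQ_ket e l b :
  expQ e l (ket b) = ket (State (mom b) (shiftc l e (cmom b)) (occ b)).
Proof. exact: lin_ket. Qed.

Lemma linop_expQ e l : linop (@expQ C e l). Proof. exact: lin_linop. Qed.

Lemma linop_c0_proj l n : linop (@c0_proj C l n). Proof. exact: lin_linop. Qed.

Lemma expQ_osc e l s (m : int) v : m != 0 -> expQ e l (osc s m v) = osc s m (expQ e l v).
Proof.
case: m => [[|m]|m] // _; move: v; apply: eq_linop.
- by apply: linop_comp; [exact: linop_expQ|exact: linop_osc].
- by apply: linop_comp; [exact: linop_osc|exact: linop_expQ].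
- move=> b; rewrite osc_pos_ket (linopZ _ _ (linop_expQ _ _)) !expQ_ket.
  by rewrite osc_pos_ket.
- by apply: linop_comp; [exact: linop_expQ|exact: linop_osc].
- by apply: linop_comp; [exact: linop_osc|exact: linop_expQ].
- by move=> b; rewrite osc_neg_ket !expQ_ket osc_neg_ket.
Qed.

Lemma expQ_cminus e e' l l' i v : expQ e l (cminus e' l' i v) = cminus e' l' i (expQ e l v).
Proof.
case: i => [|i]; first by rewrite !cminus0 (linop0 (linop_expQ _ _)).
by rewrite !cminusS (linopZ _ _ (linop_expQ _ _)) expQ_osc.
Qed.

Lemma expQ_cplus e e' l l' i v : expQ e l (cplus e' l' i v) = cplus e' l' i (expQ e l v).
Proof.
case: i => [|i]; first by rewrite !cplus0 (linop0 (linop_expQ _ _)).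
by rewrite !cplusS (linopZ _ _ (linop_expQ _ _)) expQ_osc.
Qed.

(** Besides the degree in c^l, the data that a vertex operator of c^l changes
    in a known way or not at all. On homogeneous vectors the infinite sum in
    [vertex] becomes a finite one. *)
Definition homog l mu nu (o : nat) d b : Prop :=
  [/\ mom b = mu, cmom b = nu, odeg l b = o & (ldeg l b)%:Z = d].

Lemma hom_self l b : homog l (mom b) (cmom b) (odeg l b) (ldeg l b)%:Z b.
Proof. by []. Qed.

Lemma hom_neg l mu nu o d v : d < 0 -> supp (homog l mu nu o d) v -> v = 0.
Proof. by move=> d0; apply: supp_nil => b [_ _ _]; lia. Qed.

Lemma ldeg_add l m b : ldeg l (addocc (inr l, m) b) = (m.+1 + ldeg l b)%N.
Proof. by rewrite /ldeg wdeg_add /= eqxx mul1n. Qed.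

Lemma odeg_add l m b : odeg l (addocc (inr l, m) b) = odeg l b.
Proof. by rewrite /odeg wdeg_add /= eqxx. Qed.

Lemma hom_osc_neg l mu nu o d m v : supp (homog l mu nu o d) v ->
  supp (homog l mu nu o (d + m.+1%:Z)) (osc (inr l) (Negz m) v).
Proof.
apply: supp_linop; first exact: linop_osc.
move=> b [h1 h2 h3 h4]; rewrite osc_neg_ket; apply: supp_ket; split=> //.
  by rewrite odeg_add.
by rewrite ldeg_add -h4 addnC.
Qed.

Lemma hom_osc_pos l mu nu o d m v : supp (homog l mu nu o d) v ->
  supp (homog l mu nu o (d - m.+1%:Z)) (osc (inr l) m.+1%:Z v).
Proof.
apply: supp_linop; first exact: linop_osc.
move=> b [h1 h2 h3 h4]; rewrite osc_pos_ket.
have [->|k0] := posnP (occ b (inr l, m)); first by rewrite mul0r scale0r; exact: supp0.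
apply/suppZ/supp_ket; move: h3 h4; rewrite -{1 2}(deloccK k0) odeg_add ldeg_add.
by move=> h3 h4; split=> //; rewrite -h4 PoszD addrC addKr.
Qed.

Lemma hom_cminus l mu nu o e i d v : supp (homog l mu nu o d) v ->
  supp (homog l mu nu o (d + 1 * i%:Z)) (cminus e l i v).
Proof.
case: i => [|i] hv; first exact: supp0.
by rewrite cminusS mul1r; apply/suppZ/hom_osc_neg.
Qed.

Lemma hom_cplus l mu nu o e i d v : supp (homog l mu nu o d) v ->
  supp (homog l mu nu o (d + (-1) * i%:Z)) (cplus e l i v).
Proof.
case: i => [|i] hv; first exact: supp0.
by rewrite cplusS mulN1r; apply/suppZ/hom_osc_pos.
Qed.

Lemma hom_opexpz_n l mu nu o e r d v : supp (homog l mu nu o d) v ->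
  supp (homog l mu nu o (d + r)) (opexpz (cminus e l) r v).
Proof.
case: r => r hv; last exact: supp0.
have := @supp_opexp _ (cminus e l) (fun d => homog l mu nu o d) 1 _ r d v hv.
by rewrite mul1r; apply=> *; exact: hom_cminus.
Qed.

Lemma hom_opexp_p l mu nu o e (r : nat) d v : supp (homog l mu nu o d) v ->
  supp (homog l mu nu o (d - r%:Z)) (opexp (cplus e l) r v).
Proof.
move=> hv; have := @supp_opexp _ (cplus e l) (fun d => homog l mu nu o d) (-1) _ r d v hv.
by rewrite mulN1r; apply=> *; exact: hom_cplus.
Qed.

Lemma hom_expQ l mu nu o e d v : supp (homog l mu nu o d) v ->
  supp (homog l mu (shiftc l e nu) o d) (expQ e l v).
Proof.
apply: supp_linop; first exact: linop_expQ.
by move=> b [h1 <- h3 h4]; rewrite expQ_ket; apply: supp_ket; split.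
Qed.

Lemma c0_proj_hom l mu nu o d n v : supp (homog l mu nu o d) v ->
  c0_proj l n v = if nu l == n then v else 0.
Proof.
apply: (@eq_linop_supp _ _ (c0_proj l n) (fun v => if nu l == n then v else 0)).
- exact: linop_c0_proj.
- by apply: linop_if; [exact: linop_id|exact: linop_zero].
- by move=> b [_ <- _ _]; rewrite /c0_proj lin_ket.
Qed.

Definition vterm e l (t : nat * nat * int) : fock -> fock :=
  fun v => vneg qpow e l t.1.1 (expQ e l (c0_proj l t.2 (vpos qpow e l t.1.2 v))).

Lemma linop_vterm e l t : linop (vterm e l t).
Proof.
apply: linop_comp; first by apply: linop_opexp; exact: linop_cminus.
apply: linop_comp; first exact: linop_expQ.
apply: linop_comp; first exact: linop_c0_proj.
by apply: linop_opexp; exact: linop_cplus.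
Qed.

Definition vset e N : set (nat * nat * int) :=
  [set t | t.1.1%:Z - t.1.2%:Z + e * t.2 = N].

(** On vectors of charge n, the creation degree is determined by the
    annihilation degree s, and s is bounded by the degree of the vector. *)
Definition vlist e N (n : int) (S : nat) : seq (nat * nat * int) :=
  [seq (absz (N + s%:Z - e * n)%R, s, n) | s <- iota 0 S & 0 <= N + s%:Z - e * n].

Lemma vterm_hom l mu nu o d e N (S : nat) v t : supp (homog l mu nu o d) v -> d < S%:Z ->
  vset e N t ->
  t \notin vlist e N (nu l) S ->
  vterm e l t v = 0.
Proof.
move=> hv dS; case: t => [[r s] n]; rewrite /vset /vterm /= => tN tr.
rewrite (c0_proj_hom _ (hom_opexp_p e s hv)); case: eqP => [nE|_]; last first.
  rewrite (linop0 (linop_expQ _ _)) linop0 //; apply: linop_opexp; exact: linop_cminus.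
have [sS|Ss] := ltnP s S.
  case/mapP: tr; exists s; last by rewrite nE; congr (_, _, _); lia.
  by rewrite mem_filter mem_iota /= add0n sS nE andbT; lia.
have -> : opexp (cplus e l) s v = 0.
  by apply: (hom_neg _ (hom_opexp_p e s hv)); lia.
rewrite (linop0 (linop_expQ _ _)) linop0 //; apply: linop_opexp; exact: linop_cminus.
Qed.

Lemma vterm_fin e l N b : exists r : seq (nat * nat * int),
  forall t, vset e N t -> t \notin r -> vterm e l t (ket b) = 0.
Proof.
exists (vlist e N (cmom b l) (ldeg l b).+1) => t.
by apply: (vterm_hom (supp_ket (hom_self l b))); lia.
Qed.

Lemma linop_vertex e l N : linop (vertex e l N).
Proof.
apply: (@linop_fsum _ _ _ (vterm e l)); [exact: linop_vterm|exact: vterm_fin].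
Qed.

(** The projection on the charge leaves one value of n, and annihilation by
    more than the degree of v gives zero. *)
Lemma vertex_hom l mu nu o d e N (S : nat) v : supp (homog l mu nu o d) v -> d < S%:Z ->
  vertex e l N v = \sum_(s < S)
    opexpz (cminus e l) (N + s%:Z - e * nu l) (expQ e l (opexp (cplus e l) s v)).
Proof.
move=> hv dS; rewrite /Defs.vertex.
rewrite (@fsbig_list _ _ _ (vlist e N (nu l) S)).
- rewrite /vlist big_map big_filter.
  have -> : iota 0 S = index_iota 0 S by rewrite /index_iota subn0.
  rewrite big_mkord big_mkcond; apply: eq_bigr => s _ /=.
  case: ifPn => h.
    rewrite (c0_proj_hom _ (hom_opexp_p e s hv)) eqxx.
    by case: (N + _ - _) h.
  by case: (N + _ - _) h.
- rewrite map_inj_uniq; first by rewrite filter_uniq ?iota_uniq.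
  by move=> s s' [].
- move=> t /mapP[s]; rewrite mem_filter => /andP[h _] -> /=; lia.
- by move=> t tN tr; exact: (vterm_hom hv dS tN tr).
Qed.

Lemma hom_vertex l mu nu o d e N v : supp (homog l mu nu o d) v ->
  supp (homog l mu (shiftc l e nu) o (d + N - e * nu l)) (vertex e l N v).
Proof.
move=> hv; rewrite (@vertex_hom _ _ _ _ _ _ _ `|d|.+1 _ hv); last lia.
apply: supp_sum => s _ _.
rewrite (_ : d + N - e * nu l = d - s%:Z + (N + s%:Z - e * nu l)); last lia.
by apply: hom_opexpz_n; apply: hom_expQ; apply: hom_opexp_p.
Qed.

(** For m > 0 only the creation half, for m < 0 only the annihilation half of
    c^l(z) fails to commute with c_m. *)
Lemma osc_vertex e l (m : int) N v : m != 0 ->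
  osc (inr l) m (vertex e l N v) = vertex e l N (osc (inr l) m v)
   + (e%:~R * kappa `|m|) *: vertex e l (N - m) v.
Proof.
move=> m0; move: v; apply: eq_linop.
- by apply: linop_comp; [exact: linop_osc|exact: linop_vertex].
- apply: linop_add; last by apply: linop_scale; exact: linop_vertex.
  by apply: linop_comp; [exact: linop_vertex|exact: linop_osc].
move=> b; have hb := supp_ket (hom_self l b).
case: m m0 => [[|m]|m] // _.
  rewrite !(@vertex_hom l _ _ _ _ _ _ (ldeg l b).+1 _ hb)
    ?(@vertex_hom l _ _ _ _ _ _ (ldeg l b).+1 _ (hom_osc_pos m hb)); try lia.
  rewrite (linop_sum _ _ _ (linop_osc _ _ _)) scaler_sumr -big_split; apply: eq_bigr => s _ /=.
  have cminusC i w := osc_pos_cminus e l m i w.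
  rewrite (comm_opexpz (linop_cminus e l) (cminus0 e l) (linop_osc _ _ _) (ltn0Sn m) cminusC).
  apply: eq_addZ; [|exact: erefl|].
    rewrite -expQ_osc //; congr (opexpz _ _ (expQ _ _ _)).
    by apply: (comm0_opexpz (linop_cplus e l) (cplus0 e l) s%:Z) => *;
      [exact: linop_osc|exact: osc_pos_cplus].
  congr (opexpz _ _ _); lia.
(* For a creation operator the number of terms must allow for the degree of
   c_m b, which exceeds that of b. *)
pose S := (ldeg l b + m.+1).+1.
rewrite (@vertex_hom l _ _ _ _ e (N - Negz m) (ldeg l b).+1 _ hb); last lia.
rewrite (@vertex_hom l _ _ _ _ e N S _ hb)
  ?(@vertex_hom l _ _ _ _ _ _ S _ (hom_osc_neg m hb)); try (rewrite /S; lia).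
rewrite (linop_sum _ _ _ (linop_osc _ _ _)).
have E (s : nat) : 
    osc (inr l) (Negz m) (opexpz (cminus e l) (N + s%:Z - e * cmom b l)
      (expQ e l (opexp (cplus e l) s (ket b))))
  = opexpz (cminus e l) (N + s%:Z - e * cmom b l)
      (expQ e l (opexp (cplus e l) s (osc (inr l) (Negz m) (ket b))))
   + (e%:~R * kappa m.+1) *: opexpz (cminus e l) (N + s%:Z - e * cmom b l)
      (expQ e l (opexpz (cplus e l) (s%:Z - m.+1%:Z) (ket b))).
  rewrite comm0_opexpz //; last first.
  - by move=> *; exact: osc_neg_cminus.
  - exact: linop_osc.
  - exact: linop_cminus.
  rewrite -expQ_osc // -[opexp _ _]/(opexpz (cplus e l) s).
  rewrite (@comm_opexpz _ _ (linop_cplus e l) (cplus0 e l) _ m.+1 (e%:~R * kappa m.+1)) //; last first.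
  - by move=> *; exact: osc_neg_cplus.
  - exact: linop_osc.
  have G_lin := linop_comp (linop_opexpz (linop_cminus e l) (N + s%:Z - e * cmom b l)) (linop_expQ e l).
  exact: (linopDZ _ _ _ G_lin).
under eq_bigr do rewrite E.
rewrite big_split -scaler_sumr; congr (_ + _ *: _) => /=.
(* The commutator shifts the annihilation degree s by m.+1; the terms with
   s < m.+1 vanish. *)
rewrite (_ : S = (m.+1 + (ldeg l b).+1)%N); last by rewrite /S; lia.
rewrite big_split_ord /= big1 ?add0r => [|s _]; last first.
  rewrite (_ : s%:Z - m.+1%:Z = Negz (m - s)) /=; last by have := ltn_ord s; lia.
  by rewrite (linop0 (linop_expQ _ _)) (linop0 (linop_opexpz (linop_cminus e l) _)).
apply: eq_bigr => s _; rewrite (_ : (m.+1 + s)%N%:Z - m.+1%:Z = s); last lia.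
by congr (opexpz _ _ _); lia.
Qed.

End Vertex.

(** * The Clifford relations *)

Section Anticommutator.
Variables (C : numClosedFieldType) (F : lmodType C) (V : int -> int -> F -> F).
Implicit Types (v : F) (e N M : int).

Definition anticomm e e' N M v : F :=
  V e N (V e' M v) + V e' M (V e N v)
   - (if (e + e' == 0) && (N + M == -1) then v else 0).

Variables (m : int) (O : F -> F) (k : C).
Hypothesis O_lin : forall a u v, O (a *: u + v) = a *: O u + O v.
Hypothesis V_lin : forall e N a u v, V e N (a *: u + v) = a *: V e N u + V e N v.
Hypothesis O_V : forall e N v, O (V e N v) = V e N (O v) + (e%:~R * k) *: V e (N - m) v.

(** The Kronecker delta also obeys this rule: the two shifted deltas coincide,
    and their coefficients add up to (e + e') k, which vanishes on the support
    of the delta. *)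
Lemma comm_anticomm e e' N M v : O (anticomm e e' N M v) = anticomm e e' N M (O v)
   + ((e%:~R * k) *: anticomm e e' (N - m) M v + (e'%:~R * k) *: anticomm e e' N (M - m) v).
Proof.
have OD u w : O (u + w) = O u + O w by rewrite -{1}[u]scale1r O_lin scale1r.
have O0 : O 0 = 0 by apply: (addrI (O 0)); rewrite -OD !addr0.
have OB u w : O (u - w) = O u - O w by rewrite addrC -scaleN1r O_lin scaleN1r addrC.
have OVV e1 e2 N1 N2 : O (V e1 N1 (V e2 N2 v)) = V e1 N1 (V e2 N2 (O v)) +
   ((e1%:~R * k) *: V e1 (N1 - m) (V e2 N2 v) + (e2%:~R * k) *: V e1 N1 (V e2 (N2 - m) v)).
  by rewrite O_V O_V addrC [V e2 _ _ + _]addrC V_lin [RHS]addrC -addrA.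
rewrite /anticomm OB OD !OVV.
have -> : N - m + M = N + M - m by rewrite addrAC.
have -> : N + (M - m) = N + M - m by rewrite addrA.
have -> : O (if (e + e' == 0) && (N + M == -1) then v else 0) =
   if (e + e' == 0) && (N + M == -1) then O v else 0.
  by case: ifP.
have h : (e%:~R * k) *: (if (e + e' == 0) && (N + M - m == -1) then v else 0)
    + (e'%:~R * k) *: (if (e + e' == 0) && (N + M - m == -1) then v else 0) = 0.
  case: eqP => [ee|_]; last by rewrite !scaler0 addr0.
  by rewrite -scalerDl -mulrDl -intrD ee mul0r scale0r.
rewrite !scalerBr [X in _ = _ + X]addrACA -opprD h subr0 !scalerDr.
rewrite [X in X - _ = _]addrACA [LHS]addrAC; congr (_ + _).
by rewrite [X in _ + X = _]addrC addrACA.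
Qed.

End Anticommutator.

Section Clifford.
Variables (C : numClosedFieldType) (qpow : C -> C).
Local Notation fock := (fock C).
Local Notation ket := (@ket C).
Local Notation qint := (qint qpow).
Local Notation osc := (@osc C qpow).
Local Notation osc_norm := (@osc_norm C qpow).
Local Notation vertex := (@vertex C qpow).
Local Notation cminus := (cminus qpow).
Local Notation cplus := (cplus qpow).
Local Notation kappa := (kappa qpow).
Hypothesis qint_neq0 : forall m : nat, qint m.+1%:R != 0.
Implicit Types (u v : fock) (b : state C) (l : 'I_2) (nu : {ffun 'I_2 -> int}).
Implicit Types (d N M e : int) (mu : {ffun 'I_4 -> C}).

Lemma osc_norm_neq0 l m : osc_norm (inr l) m.+1 != 0.
Proof. by rewrite /Defs.osc_norm mul1r mulf_neq0 ?invr_eq0 ?expf_neq0 // pnatr_eq0. Qed.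

(** If a state b with a c^l-excitation occurs in v, annihilating this excitation
    gives a nonzero multiple of a state that arises from no other state. *)
Lemma osc_pos_eq0 l v : supp (fun b => (0 < ldeg l b)%N) v ->
  (forall m, osc (inr l) m.+1%:Z v = 0) -> v = 0.
Proof.
move=> hv h; apply/malgP => b; rewrite mcoeff0.
have [bv|/mcoeff_outdom //] := boolP (b \in msupp v).
have /wdeg_gt0 [[s m] /= /eqP -> k0] := suppP hv bv.
have := congr1 (mcoeff (delocc (inr l, m) b)) (h m).
rewrite linop_lin; last exact: linop_osc.
rewrite /lin raddf_sum mcoeff0 /= (big_fsetD1 b) //= osc_pos_ket !mcoeffZ mcoeff_ket eqxx mulr1.
rewrite big1_fset ?addr0 => [/eqP|b' + _]; last first.
  rewrite !inE => /andP[bb' _]; rewrite osc_pos_ket !mcoeffZ mcoeff_ket.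
  have [->|k0'] := posnP (occ b' (inr l, m)); first by rewrite !mul0r mulr0.
  case: eqP => [|_]; last by rewrite !mulr0.
  by move/(congr1 (addocc (inr l, m))); rewrite !deloccK // => E; rewrite E eqxx in bb'.
rewrite mulf_eq0 => /orP[/eqP //|].
by rewrite mulf_eq0 (negbTE (osc_norm_neq0 _ _)) orbF pnatr_eq0 eqn0Ngt k0.
Qed.

Lemma osc_pos_vac l m b : ldeg l b = 0%N -> osc (inr l) m.+1%:Z (ket b) = 0.
Proof.
move=> b0; rewrite osc_pos_ket (wdeg_eq0 b0) ?mul0r ?scale0r //=.
Qed.

(** Taylor coefficients of (1 - x)^(e e') for signs e and e', where s tells
    whether e e' = 1; this is the scalar factor that comes from exchanging the
    annihilation half of one vertex operator with the creation half of the
    other. *)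
Definition wcoef (s : bool) (d : nat) : C :=
  if s then (if d is 0 then 1 else if d is 1 then -1 else 0) else 1.

(** The differential equation f' = - e e' f / (1 - x) of f = (1 - x)^(e e'),
    coefficientwise. *)
Lemma wcoef_rec (s : bool) (d : nat) : d.+1%:R * wcoef s d.+1 =
  (-1) ^+ s * \sum_(i < d.+1) wcoef s (d - i)%N.
Proof.
rewrite /wcoef; case: s => /=; last first.
  by rewrite mulr1 mul1r sumr_const card_ord.
rewrite (reindex_inj rev_ord_inj) /= big_ord_recl /= subSS subn0 subnn.
case: d => [|d]; first by rewrite big_ord0 addr0 mul1r expr1 mulr1.
rewrite big_ord_recl big1 /= => [|i _]; last first.
  by rewrite (_ : d.+1 - (d.+2 - _) = i.+2)%N //; have := ltn_ord i; rewrite /= /bump /=; lia.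
rewrite (_ : d.+1 - (d.+2 - _) = 1)%N /=; last by rewrite /bump /=; lia.
by rewrite addr0 subrr !mulr0.
Qed.

(** Both sides satisfy the same recursion in d: expand the left-hand side with
    the derivative of the exponential, and let each annihilation operator act on
    the creation half; on a state without c^l-excitations only the commutator
    survives. *)
Lemma vpos_vneg_vac e e' (s : bool) l b (d : nat) : e * e' = (-1) ^+ (~~ s) -> ldeg l b = 0%N ->
  opexp (cplus e l) d (opexp (cminus e' l) d (ket b)) = wcoef s d *: ket b.
Proof.
move=> ee b0; elim/ltn_ind: d => -[_|d IH].
  by rewrite !opexp0 /wcoef; case: s {ee}; rewrite scale1r.
have d0 : d.+1%:R != 0 :> C by rewrite pnatr_eq0.
apply: (scalerI d0); rewrite scalerA wcoef_rec mulr_sumr scaler_suml.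
rewrite (deriv_opexp (linop_cplus qpow e l) (cplus0 qpow e l)); last by move=> *; exact: cplus_cplus.
apply: eq_bigr => i _; rewrite cplusS -[opexp (cminus e' l) d.+1]/(opexpz (cminus e' l) d.+1).
rewrite (@comm_opexpz _ _ (linop_cminus qpow e' l) (cminus0 qpow e' l) _ i.+1
  (e'%:~R * kappa i.+1)) //; last first.
- by move=> *; exact: osc_pos_cminus.
- exact: linop_osc.
rewrite osc_pos_vac // (linop0 (linop_opexpz (linop_cminus qpow _ _) _)) add0r.
rewrite (_ : d.+1%:Z - i.+1%:Z = (d - i)%N); last by have := ltn_ord i; lia.
rewrite subSS scalerA (linopZ _ _ (linop_opexp (linop_cplus qpow e l) _)) /= IH;
  last by have := ltn_ord i; lia.
rewrite !scalerA; congr (_ *: _); rewrite mulrA; congr (_ * _).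
have -> : (-1) ^+ s = - (e%:~R * e'%:~R) :> C.
  by rewrite -intrM ee; case: (s); rewrite ?expr0 ?expr1 ?opprK // mulrN1z.
have h : i.+1%:R != 0 :> C by rewrite pnatr_eq0.
rewrite kappaE; move: (qint_neq0 i) h.
move: (i.+1%:R : C) (e%:~R : C) (e'%:~R : C) (qint _) => x y z t x0 y0.
by field; rewrite x0 y0.
Qed.

Lemma vertex_vac e l N b : ldeg l b = 0%N ->
  vertex e l N (ket b) = opexpz (cminus e l) (N - e * cmom b l) (expQ e l (ket b)).
Proof.
move=> b0; rewrite (vertex_hom qpow _ _ (S := 1) (supp_ket (hom_self l b))); last by rewrite b0.
by rewrite big_ord1 /= opexp0 addr0.
Qed.

Definition wcoefz (s : bool) (d : int) : C := if d is Posz d' then wcoef s d' else 0.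

(** For s = false, (1 - x)^(-1) expanded at 0 and at infinity differ by the
    formal delta function; for s = true, the two coefficients of the polynomial
    1 - x cancel. *)
Lemma wcoefz_sum s d d' : d + d' = (-1) ^+ (~~ s) -> wcoefz s d + wcoefz s d' = (~~ s)%:R.
Proof.
case: s => /= dd.
  rewrite expr0 in dd; have -> : d' = 1 - d by lia.
  case: d {dd} => [[|[|d]]|d].
  - by rewrite (_ : 1 - 0%:Z = 1%N) // /wcoefz /= subrr.
  - by rewrite (_ : 1 - 1%:Z = 0%N) // /wcoefz /= addNr.
  - by rewrite (_ : 1 - d.+2%:Z = Negz d) /wcoefz /= ?addr0 //; lia.
  - by rewrite (_ : 1 - Negz d = d.+2%:Z) /wcoefz /= ?addr0 //; lia.
rewrite expr1 in dd; have -> : d' = -1 - d by lia.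
case: d {dd} => d.
  by rewrite (_ : -1 - d%:Z = Negz d) /wcoefz /= ?addr0 //; lia.
by rewrite (_ : -1 - Negz d = d%:Z) /wcoefz /= ?add0r //; lia.
Qed.

(** In total degree 0 the annihilation half of the left operator must undo the
    creation half of the right one. *)
Lemma vertex2_vac e e' (s : bool) l N M b : e * e' = (-1) ^+ (~~ s) -> ldeg l b = 0%N ->
  M - e' * cmom b l + N - e * (cmom b l + e') = 0 ->
  vertex e l N (vertex e' l M (ket b)) =
    wcoefz s (M - e' * cmom b l) *: expQ e l (expQ e' l (ket b)).
Proof.
move=> ee b0 D0; rewrite vertex_vac // expQ_ket -/(shiftc _ _ _).
set b' := State _ _ _; have b'0 : ldeg l b' = 0%N by [].
have nu' : cmom b' l = cmom b l + e' by rewrite /b' /= ffunE eqxx.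
case E : (M - e' * cmom b l) => [d|d]; last by rewrite scale0r (linop0 (linop_vertex _ _ _ _)).
rewrite (vertex_hom qpow _ _ (S := d.+1) (hom_opexpz_n qpow e' d%:Z (supp_ket (hom_self l b'))));
  last by rewrite b'0; lia.
have D1 : N - e * (cmom b l + e') = - d%:Z by apply/eqP; rewrite -addr_eq0 addrC addrA -E D0.
rewrite big_ord_recr /= -/b' nu' big1 ?add0r => [|t _].
  rewrite addrAC D1 addNr.
  by rewrite /= opexp0 (vpos_vneg_vac _ ee) // (linopZ _ _ (linop_expQ _ _)).
rewrite addrAC D1 (_ : _ + t%:Z = Negz (d - t).-1) //; have := ltn_ord t; lia.
Qed.

Lemma expQC e e' l l' v : expQ e l (expQ e' l' v) = expQ e' l' (expQ e l v).
Proof.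
move: v; apply: eq_linop; try by apply: linop_comp; exact: linop_expQ.
move=> b; rewrite !expQ_ket /=; congr (ket (State _ _ _)).
by apply/ffunP => i; rewrite !ffunE addrAC.
Qed.

Lemma shiftcC e e' l l' nu : shiftc l e (shiftc l' e' nu) = shiftc l' e' (shiftc l e nu).
Proof. by apply/ffunP => i; rewrite !ffunE addrAC. Qed.

Lemma shiftcN e e' l nu : e + e' = 0 -> shiftc l e (shiftc l e' nu) = nu.
Proof.
move=> ee; apply/ffunP => i; rewrite !ffunE -addrA; case: ifP => _; rewrite ?addr0 //.
by rewrite [e' + e]addrC ee addr0.
Qed.

Definition clifford_defect e e' l N M : fock -> fock := anticomm (vertex^~ l) e e' N M.

Lemma linop_clifford_defect e e' l N M : linop (clifford_defect e e' l N M).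
Proof.
have h e1 e2 N1 N2 : linop (fun v => vertex e1 l N1 (vertex e2 l N2 v)).
  by apply: linop_comp; exact: linop_vertex.
apply: linop_add; first exact: linop_add.
by apply: linop_opp; apply: linop_if; [exact: linop_id|exact: linop_zero].
Qed.

Lemma osc_clifford_defect e e' l (m : int) N M v : m != 0 ->
  osc (inr l) m (clifford_defect e e' l N M v) = clifford_defect e e' l N M (osc (inr l) m v)
   + ((e%:~R * kappa `|m|) *: clifford_defect e e' l (N - m) M v
    + (e'%:~R * kappa `|m|) *: clifford_defect e e' l N (M - m) v).
Proof.
move=> m0; apply: comm_anticomm; [exact: linop_osc|by move=> *; exact: linop_vertex|].
by move=> *; exact: osc_vertex.
Qed.

(** Both orders of the product shift the degree by the same amount, which is 0
    where the delta is 1. *)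
Lemma clifford_defect_hom e e' l mu nu o d N M v : e * e' = 1 \/ e * e' = -1 ->
  supp (homog l mu nu o d) v ->
  supp (homog l mu (shiftc l e (shiftc l e' nu)) o
    (d + (M - e' * nu l + N - e * (nu l + e')))) (clifford_defect e e' l N M v).
Proof.
move=> ee hv; have h1 := hom_vertex qpow e N (hom_vertex qpow e' M hv).
have h2 := hom_vertex qpow e' M (hom_vertex qpow e N hv).
rewrite !ffunE !eqxx in h1 h2; rewrite shiftcC in h2.
set D := d + _.
have E1 : d + M - e' * nu l + N - e * (nu l + e') = D by rewrite /D; ring.
have E2 : d + N - e * nu l + M - e' * (nu l + e) = D by rewrite /D; ring.
rewrite E1 in h1; rewrite E2 in h2.
apply: suppD; first exact: suppD h1 h2.
rewrite -scaleN1r; apply: suppZ; case: ifPn => [/andP[/eqP e0 /eqP NM]|_]; last exact: supp0.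
rewrite shiftcN //; suff -> : D = d by [].
have e'E : e' = - e by apply/eqP; rewrite -addr_eq0 addrC e0.
have NE : N = -1 - M by rewrite -NM addrK.
rewrite /D e'E NE; case: ee; rewrite e'E mulrN; last first.
  by move/oppr_inj => ee; rewrite -[RHS]addr0; congr (_ + _); rewrite -(subrr (e * e)) {2}ee; ring.
by move=> ee; nia.
Qed.

Lemma sign_sum e e' (s : bool) : `|e|%N = 1%N -> e * e' = (-1) ^+ (~~ s) ->
  (e + e' == 0) = ~~ s.
Proof.
move=> e1 ee; have [eE|eE] : e = 1 \/ e = -1 by lia.
  by move: ee; rewrite eE mul1r => ->; case: s.
move: ee; rewrite eE mulN1r => ee; rewrite -(opprK e') ee; by case: s {ee}.
Qed.

Lemma clifford_defect_vac0 e e' (s : bool) l N M b :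
  `|e|%N = 1%N -> e * e' = (-1) ^+ (~~ s) -> ldeg l b = 0%N ->
  M - e' * cmom b l + N - e * (cmom b l + e') = 0 -> clifford_defect e e' l N M (ket b) = 0.
Proof.
move=> e1 ee b0 D0; rewrite /clifford_defect /anticomm (vertex2_vac ee) //.
rewrite (@vertex2_vac e' e s) //; first last.
- by rewrite -D0; ring.
- by rewrite mulrC.
rewrite expQC -scalerDl (sign_sum e1 ee) wcoefz_sum; last first.
  by rewrite -ee -[LHS]subr0 -D0; ring.
case: s ee => ee; first by rewrite scale0r subr0.
have e0 := sign_sum e1 ee; move/eqP in e0.
have -> : N + M = -1.
  have e'E : e' = - e by apply/eqP; rewrite -addr_eq0 addrC e0.
  move: D0 ee; rewrite e'E mulrN expr1 => D0 /oppr_inj ee.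
  by rewrite -[RHS]addr0 -D0 -ee; ring.
rewrite eqxx /= scale1r !expQ_ket shiftcN //; last by rewrite addrC.
by rewrite (_ : State _ _ _ = b) ?subrr //; case: (b).
Qed.

Lemma sign_mul e e' : `|e|%N = 1%N -> `|e'|%N = 1%N ->
  exists s : bool, e * e' = (-1) ^+ (~~ s).
Proof.
move=> h h'; have H (x : int) : `|x|%N = 1%N -> x = 1 \/ x = -1 by lia.
have [->|->] := H _ h; have [->|->] := H _ h'.
- by exists true.
- by exists false.
- by exists false.
- by exists true.
Qed.

(** Induction on the degree D of the defect. A vector of negative degree is
    zero. In positive degree the defect is killed by each c^l_m, m > 0, since
    the commutator gives defects of degree D - m; so it is zero. *)
Lemma clifford_defect_vac e e' l N M b : `|e|%N = 1%N -> `|e'|%N = 1%N ->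
  ldeg l b = 0%N -> clifford_defect e e' l N M (ket b) = 0.
Proof.
move=> e1 e1' b0; have [s ee] := sign_mul e1 e1'.
have ee' : e * e' = 1 \/ e * e' = -1 by rewrite ee; case: (s); [left|right].
pose D N M := M - e' * cmom b l + N - e * (cmom b l + e').
have [n Dn] : exists n : nat, D N M < n%:Z by exists `|D N M|%N.+1; lia.
elim: n N M Dn => [|n IH] N M Dn.
  have := clifford_defect_hom N M ee' (supp_ket (hom_self l b)).
  by apply: hom_neg; rewrite b0 add0r.
have := clifford_defect_hom N M ee' (supp_ket (hom_self l b)); rewrite -/(D N M) b0 add0r => hK.
have [Dlt|Dgt|D0] := ltrgtP (D N M) 0; last exact: clifford_defect_vac0 ee b0 D0.
  exact: hom_neg hK.
apply: (@osc_pos_eq0 l).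
  by apply: suppW hK => b' [_ _ _ h]; lia.
move=> m; rewrite osc_clifford_defect // osc_pos_vac // (linop0 (linop_clifford_defect _ _ _ _ _)) add0r.
have hD N' M' : D N' M' = D N M - m.+1%:Z -> D N' M' < n%:Z by move=> ->; lia.
rewrite !IH ?scaler0 ?addr0 //; apply: hD; rewrite /D; ring.
Qed.

(** The boson-fermion correspondence. Every state is obtained from one
    without c^l-excitations by creation operators, whose commutator with the
    defect consists of defects. *)
Lemma clifford e e' l N M v : `|e|%N = 1%N -> `|e'|%N = 1%N ->
  vertex e l N (vertex e' l M v) + vertex e' l M (vertex e l N v) =
   (if (e + e' == 0) && (N + M == -1) then v else 0).
Proof.
move=> e1 e1'; apply/eqP; rewrite -subr_eq0; apply/eqP; rewrite -/(clifford_defect _ _ _ _ _ _).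
move: v; apply: eq_linop; [exact: linop_clifford_defect|exact: linop_zero|].
move=> b; have [n] : exists n, (ldeg l b < n)%N by exists (ldeg l b).+1.
elim: n N M b => // n IH N M b bn.
have [b0|/wdeg_gt0[[s m] /= /eqP -> k0]] := posnP (ldeg l b); first exact: clifford_defect_vac.
rewrite -(deloccK k0) -(osc_neg_ket qpow).
have bn' : (ldeg l (delocc (inr l, m) b) < n)%N.
  move: bn (ldeg_add l m (delocc (inr l, m) b)); rewrite (deloccK k0).
  move: (ldeg l b) (ldeg l _) => x y; lia.
have K0 N' M' : clifford_defect e e' l N' M' (ket (delocc (inr l, m) b)) = 0 by apply: IH.
have H (V : zmodType) (w x y z : V) : w = x + (y + z) -> w = 0 -> y = 0 -> z = 0 -> x = 0.
  by move=> -> + y0 z0; rewrite y0 z0 !addr0.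
apply: (H _ _ _ _ _ (@osc_clifford_defect e e' l (Negz m) N M (ket (delocc (inr l, m) b)) isT)).
- by rewrite K0 (linop0 (linop_osc _ _ _)).
- by rewrite K0 scaler0.
- by rewrite K0 scaler0.
Qed.

End Clifford.

(** * Zero modes and their projectors *)

(** eta^l_0 for s = true, the coefficient of z^(-1), and xi^l_0 for s = false,
    the coefficient of z^0. Locked, so that comparing two zero modes never
    unfolds a vertex operator. *)
HB.lock Definition zmode (C : numClosedFieldType) (qpow : C -> C) (s : bool)
  (l : 'I_2) : fock C -> fock C := vertex qpow (sgn s) l (if s then -1 else 0).

Section ZeroModes.
Variables (C : numClosedFieldType) (qpow : C -> C).
Local Notation fock := (fock C).
Local Notation ket := (@ket C).
Local Notation qint := (qint qpow).
Local Notation osc := (@osc C qpow).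
Local Notation vertex := (@vertex C qpow).
Local Notation cminus := (cminus qpow).
Local Notation cplus := (cplus qpow).
Local Notation zmode := (@zmode C qpow).
Hypothesis qint_neq0 : forall m : nat, qint m.+1%:R != 0.
Implicit Types (u v : fock) (b : state C) (l : 'I_2) (nu : {ffun 'I_2 -> int}).
Implicit Types (d N M e : int) (mu : {ffun 'I_4 -> C}) (T : fock -> fock).

(** An operator commuting with all the factors of the normally ordered
    exponential commutes with its coefficients. *)
Lemma comm_vertex T e l N v : linop T ->
  (forall i v, T (cminus e l i v) = cminus e l i (T v)) ->
  (forall i v, T (cplus e l i v) = cplus e l i (T v)) ->
  (forall v, T (expQ e l v) = expQ e l (T v)) ->
  (forall n v, T (c0_proj l n v) = c0_proj l n (T v)) ->
  T (vertex e l N v) = vertex e l N (T v).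
Proof.
move=> hT h1 h2 h3 h4.
apply: (@comm_fsum _ _ _ (vterm qpow e l) _ (vterm_fin qpow e l N)) => //.
  exact: linop_vterm.
move=> [[r s] n] w; rewrite /vterm /=.
rewrite -[vneg _ _ _ r]/(opexpz (cminus e l) r) -[vpos _ _ _ s]/(opexpz (cplus e l) s).
rewrite (comm0_opexpz (linop_cminus _ _ _) (cminus0 _ _ _)) // h3 h4.
by rewrite (comm0_opexpz (linop_cplus _ _ _) (cplus0 _ _ _)).
Qed.

Lemma osc_cminus_neq l l' e (k : int) i v : l != l' -> k != 0 ->
  osc (inr l) k (cminus e l' i v) = cminus e l' i (osc (inr l) k v).
Proof.
move=> ll; case: k => [[|m]|m] // _; last exact: osc_neg_cminus.
case: i => [|i]; first by rewrite !cminus0 (linop0 (linop_osc _ _ _)).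
rewrite !cminusS (linopZ _ _ (linop_osc _ _ _)) osc_pos_neg.
have -> : ((inr l, m) == (inr l', i) :> species * nat) = false.
  by apply/negP => /eqP[/eqP]; rewrite (negbTE ll).
by rewrite scale0r addr0.
Qed.

Lemma osc_cplus_neq l l' e (k : int) i v : l != l' -> k != 0 ->
  osc (inr l) k (cplus e l' i v) = cplus e l' i (osc (inr l) k v).
Proof.
move=> ll; case: k => [[|m]|m] // _; first exact: osc_pos_cplus.
case: i => [|i]; first by rewrite !cplus0 (linop0 (linop_osc _ _ _)).
rewrite !cplusS (linopZ _ _ (linop_osc _ _ _)) osc_pos_neg.
have -> : ((inr l', i) == (inr l, m) :> species * nat) = false.
  by apply/negP => /eqP[/eqP]; rewrite eq_sym (negbTE ll).
by rewrite scale0r addr0.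
Qed.

Lemma c0_proj_ket l n b : c0_proj l n (ket b) = if cmom b l == n then ket b else 0.
Proof. exact: lin_ket. Qed.

Lemma c0_proj_osc l n s (k : int) v : k != 0 ->
  c0_proj l n (osc s k v) = osc s k (c0_proj l n v).
Proof.
move=> k0; move: v; apply: eq_linop.
- by apply: linop_comp; [exact: linop_c0_proj|exact: linop_osc].
- by apply: linop_comp; [exact: linop_osc|exact: linop_c0_proj].
move=> b; rewrite c0_proj_ket; case: k k0 => [[|m]|m] // _.
  rewrite osc_pos_ket (linopZ _ _ (linop_c0_proj _ _)) c0_proj_ket /=.
  by case: eqP => _; rewrite ?osc_pos_ket // (linop0 (linop_osc _ _ _)) scaler0.
rewrite osc_neg_ket c0_proj_ket /=.
by case: eqP => _; rewrite ?osc_neg_ket // (linop0 (linop_osc _ _ _)).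
Qed.

Lemma c0_proj_cminus l n e l' i v : c0_proj l n (cminus e l' i v) = cminus e l' i (c0_proj l n v).
Proof.
case: i => [|i]; first by rewrite !cminus0 (linop0 (linop_c0_proj _ _)).
by rewrite !cminusS (linopZ _ _ (linop_c0_proj _ _)) c0_proj_osc.
Qed.

Lemma c0_proj_cplus l n e l' i v : c0_proj l n (cplus e l' i v) = cplus e l' i (c0_proj l n v).
Proof.
case: i => [|i]; first by rewrite !cplus0 (linop0 (linop_c0_proj _ _)).
by rewrite !cplusS (linopZ _ _ (linop_c0_proj _ _)) c0_proj_osc.
Qed.

Lemma expQ_c0_proj e l l' n v : l != l' ->
  expQ e l (c0_proj l' n v) = c0_proj l' n (expQ e l v).
Proof.
move=> ll; move: v; apply: eq_linop.
- by apply: linop_comp; [exact: linop_expQ|exact: linop_c0_proj].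
- by apply: linop_comp; [exact: linop_c0_proj|exact: linop_expQ].
move=> b; rewrite expQ_ket !c0_proj_ket /= ffunE [l' == l]eq_sym (negbTE ll) addr0.
by case: eqP => _; rewrite ?expQ_ket // (linop0 (linop_expQ _ _)).
Qed.

Lemma c0_projC l l' n n' v : c0_proj l n (c0_proj l' n' v) = c0_proj l' n' (c0_proj l n v).
Proof.
move: v; apply: eq_linop; try by apply: linop_comp; exact: linop_c0_proj.
move=> b; rewrite !c0_proj_ket; case E: (cmom b l' == n'); case E': (cmom b l == n);
  by rewrite ?(linop0 (linop_c0_proj _ _)) ?c0_proj_ket ?E ?E'.
Qed.

Lemma vertex_osc_neq l l' e N (k : int) v : l != l' -> k != 0 ->
  osc (inr l) k (vertex e l' N v) = vertex e l' N (osc (inr l) k v).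
Proof.
move=> ll k0; apply: comm_vertex; first exact: linop_osc.
- by move=> *; exact: osc_cminus_neq.
- by move=> *; exact: osc_cplus_neq.
- by move=> *; rewrite expQ_osc.
- by move=> *; rewrite c0_proj_osc.
Qed.

Lemma vertexC l l' e e' N M v : l != l' ->
  vertex e l N (vertex e' l' M v) = vertex e' l' M (vertex e l N v).
Proof.
move=> ll; have ll' : l' != l by rewrite eq_sym.
apply: comm_vertex; first exact: linop_vertex.
- case=> [|i] w; first by rewrite !cminus0 (linop0 (linop_vertex _ _ _ _)).
  by rewrite !cminusS (linopZ _ _ (linop_vertex _ _ _ _)) vertex_osc_neq.
- case=> [|i] w; first by rewrite !cplus0 (linop0 (linop_vertex _ _ _ _)).
  by rewrite !cplusS (linopZ _ _ (linop_vertex _ _ _ _)) vertex_osc_neq.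
- move=> w; apply/esym/comm_vertex; first exact: linop_expQ.
  + by move=> *; exact: expQ_cminus.
  + by move=> *; exact: expQ_cplus.
  + by move=> *; exact: expQC.
  + by move=> *; exact: expQ_c0_proj.
- move=> n w; apply/esym/comm_vertex; first exact: linop_c0_proj.
  + by move=> *; exact: c0_proj_cminus.
  + by move=> *; exact: c0_proj_cplus.
  + by move=> *; rewrite expQ_c0_proj.
  + by move=> *; exact: c0_projC.
Qed.

Lemma linop_zmode s l : linop (zmode s l).
Proof. by rewrite zmode.unlock; exact: linop_vertex. Qed.

Lemma zmodeC s s' l l' v : l != l' -> zmode s l (zmode s' l' v) = zmode s' l' (zmode s l v).
Proof. by rewrite zmode.unlock; exact: vertexC. Qed.

(** The Clifford relation of a zero mode with itself says that twice the square
    is zero. *)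
Lemma zmode_sq s l v : zmode s l (zmode s l v) = 0.
Proof.
set w := zmode _ _ _; have h : w + w = 0.
  by rewrite /w zmode.unlock (clifford qint_neq0); case: (s).
have n0 : 2%:R != 0 :> C by rewrite pnatr_eq0.
by apply: (scalerI n0); rewrite scaler0 scaler_nat mulr2n.
Qed.

Lemma zmode_anti s l v : zmode s l (zmode (~~ s) l v) + zmode (~~ s) l (zmode s l v) = v.
Proof. by rewrite zmode.unlock (clifford qint_neq0); case: s. Qed.

(** xi eta for s = true and eta xi for s = false. *)
Definition zproj s l v : fock := zmode (~~ s) l (zmode s l v).

Lemma zprojE s l v : zproj s l v = zmode (~~ s) l (zmode s l v).
Proof. by []. Qed.

Lemma linop_zproj s l : linop (zproj s l).
Proof. by apply: linop_comp; exact: linop_zmode. Qed.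

(** Multiply xi eta + eta xi = 1 by a zero mode, whose square is zero. *)
Lemma zproj_idem s l v : zproj s l (zproj s l v) = zproj s l v.
Proof.
rewrite /zproj -[in RHS](zmode_anti s l (zmode s l v)) zmode_sq.
by rewrite (linopD _ _ (linop_zmode _ _)) !(linop0 (linop_zmode _ _)) addr0.
Qed.

Lemma zprojC s s' l l' v : l != l' -> zproj s l (zproj s' l' v) = zproj s' l' (zproj s l v).
Proof.
by move=> ll; rewrite /zproj !(zmodeC _ _ _ ll).
Qed.

(** The energy n (n + 1) / 2 of a charge n. *)
Definition tri (n : int) : nat := (absz (n * (n + 1))%R)./2.

Lemma triE n : 2 * (tri n)%:Z = n * (n + 1).
Proof.
have h0 : 0 <= n * (n + 1) by nia.
have ev : odd (absz (n * (n + 1))%R) = false.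
  by rewrite abszM oddM; case: n {h0} => n; lia.
have := odd_double_half (absz (n * (n + 1))%R).
by rewrite ev add0n -/(tri n) => h; lia.
Qed.

Lemma tri_shift n (s : bool) :
  (tri (n + sgn s))%:Z = (tri n)%:Z + (if s then n + 1 else - n).
Proof.
have := triE n; have := triE (n + sgn s); move: (tri _) (tri _) => x y.
by case: s => /=; nia.
Qed.

(** States of fixed momentum, charges and energy d, where each charge
    contributes its own energy. *)
Definition sector mu nu d b : Prop :=
  [/\ mom b = mu, cmom b = nu & (tdeg b)%:Z + (tri (nu 0))%:Z + (tri (nu 1))%:Z = d].

(** The energy of the charge changes by the opposite of what the zero mode does
    to the degree: eta has conformal weight 1 and xi conformal weight 0. *)
Lemma sector_zmode s l mu nu d v : supp (sector mu nu d) v ->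
  supp (sector mu (shiftc l (sgn s) nu) d) (zmode s l v).
Proof.
apply: supp_linop; first exact: linop_zmode.
move=> b [h1 h2 h3]; rewrite zmode.unlock; apply: suppW (hom_vertex _ _ _ (supp_ket (hom_self l b))).
move=> b' [k1 k2 k3 k4]; split; rewrite -?h1 -?h2 //.
rewrite -{}h3 (tdegE l) (tdegE l b) k3 !PoszD k4 -h2 !ffunE.
have [->|->] : l = 0 \/ l = 1.
  by case: l {k2 k3 k4} => [[|[|l]] hl] //; [left|right]; apply: val_inj.
- by rewrite eqxx /= addr0 tri_shift; case: (s); rewrite ?mul1r ?mulN1r; ring.
- by rewrite eqxx /= addr0 tri_shift; case: (s); rewrite ?mul1r ?mulN1r; ring.
Qed.

End ZeroModes.

(** * Traces of idempotents *)

Section Trace.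
Variable C : numClosedFieldType.
Local Notation fock := (fock C).
Local Notation ket := (@ket C).
Implicit Types (S : {fset (state C)}) (v : fock) (b : state C) (T : fock -> fock).

Definition trace S T : C := \sum_(b <- S) mcoeff b (T (ket b)).

Lemma insupp_sum S v : insupp S v -> v = \sum_(b <- S) mcoeff b v *: ket b.
Proof.
move=> hv; rewrite {1}(ket_sum v); apply: big_fset_incl => /=.
  by apply/fsubsetP => b; move=> bv; exact: (suppP hv).
by move=> b _ /mcoeff_outdom ->; rewrite scale0r.
Qed.

Lemma insupp_ket S b : b \in S -> insupp S (ket b).
Proof. exact: supp_ket. Qed.

Lemma insupp_linop S S' T v : linop T -> (forall b, b \in S -> insupp S' (T (ket b))) ->
  insupp S v -> insupp S' (T v).
Proof. exact: supp_linop. Qed.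

Lemma mcoeff_linop S T v b : linop T -> insupp S v ->
  mcoeff b (T v) = \sum_(b' <- S) mcoeff b' v * mcoeff b (T (ket b')).
Proof.
move=> hT hv; rewrite {1}(insupp_sum hv) linop_sum // raddf_sum /=.
by apply: eq_bigr => b' _; rewrite linopZ // mcoeffZ.
Qed.

(** S and S' may differ: this is the trace of products of rectangular matrices. *)
Lemma traceC S S' T1 T2 : linop T1 -> linop T2 ->
  (forall b, b \in S -> insupp S' (T1 (ket b))) ->
  (forall b, b \in S' -> insupp S (T2 (ket b))) ->
  trace S (T2 \o T1) = trace S' (T1 \o T2).
Proof.
move=> h1 h2 S1 S2; rewrite /trace /=.
transitivity (\sum_(b <- S) \sum_(b' <- S') mcoeff b' (T1 (ket b)) * mcoeff b (T2 (ket b'))).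
  by rewrite big_seq [RHS]big_seq; apply: eq_bigr => b bS; apply: mcoeff_linop => //; exact: S1.
rewrite exchange_big big_seq [RHS]big_seq; apply: eq_bigr => b bS /=.
rewrite (mcoeff_linop _ h1 (S2 _ bS)).
by apply: eq_bigr => b' _; rewrite mulrC.
Qed.

Lemma eq_trace S T1 T2 : (forall b, b \in S -> T1 (ket b) = T2 (ket b)) ->
  trace S T1 = trace S T2.
Proof.
by move=> h; rewrite /trace big_seq [RHS]big_seq; apply: eq_bigr => b /h ->.
Qed.

Lemma traceD S T1 T2 : trace S (fun v => T1 v + T2 v) = trace S T1 + trace S T2.
Proof. by rewrite /trace -big_split; apply: eq_bigr => b _; rewrite mcoeffD. Qed.

Lemma trace_id S : trace S id = #|` S|%:R.
Proof.
rewrite /trace (eq_bigr (fun=> 1)) => [|b _]; last by rewrite mcoeff_ket eqxx.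
by rewrite big_const_seq count_predT iter_addr_0.
Qed.

Lemma trace0 T : trace fset0 T = 0.
Proof. by rewrite /trace big_seq_fset0. Qed.

Section Idempotent.
Variables (S : {fset (state C)}) (P : fock -> fock).
Hypothesis P_lin : linop P.
Hypothesis P_S : forall b, b \in S -> insupp S (P (ket b)).
Hypothesis P_idem : forall v, P (P v) = P v.

Let n := #|{: S}|.
Let st (i : 'I_n) : state C := val (enum_val i).
Let M : 'M[C]_n := \matrix_(i, j) mcoeff (st j) (P (ket (st i))).
Let vec (x : 'rV[C]_n) : fock := \sum_i x 0 i *: ket (st i).

Lemma big_st (V : zmodType) (F : state C -> V) : \sum_(b <- S) F b = \sum_(i < n) F (st i).
Proof.
rewrite big_seq_fsetE /= -(big_enum_val (A := {: S}) (fun x => F (val x))).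
exact: eq_bigl.
Qed.

Lemma st_inj : injective st.
Proof. by move=> i j /val_inj /enum_val_inj. Qed.

Lemma st_S i : st i \in S.
Proof. exact: valP. Qed.

Lemma mcoeff_vec x j : mcoeff (st j) (vec x) = x 0 j.
Proof.
rewrite /vec raddf_sum (bigD1 j) //= mcoeffZ mcoeff_ket eqxx mulr1 big1 ?addr0 // => i ij.
by rewrite mcoeffZ mcoeff_ket (inj_eq st_inj) (negbTE ij) mulr0.
Qed.

Lemma vec_coords v : insupp S v -> v = vec (\row_i mcoeff (st i) v).
Proof.
move=> hv; rewrite {1}(insupp_sum hv) (big_st (fun b => mcoeff b v *: ket b)).
by apply: eq_bigr => i _; rewrite mxE.
Qed.

Lemma vec_inj x y : vec x = vec y -> x = y.
Proof. by move=> e; apply/rowP => i; rewrite -!mcoeff_vec e. Qed.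

Lemma insupp_vec x : insupp S (vec x).
Proof. by apply: supp_sum => i _ _; apply: suppZ; apply: supp_ket; exact: st_S. Qed.

Lemma P_vec x : P (vec x) = vec (x *m M).
Proof.
have hP : insupp S (P (vec x)) by apply: insupp_linop (insupp_vec x).
rewrite {1}(vec_coords hP); congr vec; apply/rowP => j; rewrite !mxE.
rewrite /vec linop_sum // raddf_sum; apply: eq_bigr => i _ /=.
by rewrite linopZ // mcoeffZ mxE.
Qed.

Lemma M_idem : M *m M = M.
Proof.
apply/row_matrixP => i; rewrite row_mul; apply: vec_inj.
by rewrite -P_vec rowE -!P_vec P_idem.
Qed.

Lemma sum_vec m (y : 'rV[C]_m) (R : 'M[C]_(m, n)) :
  \sum_i y 0 i *: vec (row i R) = vec (y *m R).
Proof.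
rewrite /vec; under eq_bigr do rewrite scaler_sumr.
rewrite exchange_big; apply: eq_bigr => j _ /=; rewrite mxE scaler_suml.
by apply: eq_bigr => i _; rewrite scalerA mxE.
Qed.

(** In a rank factorization M = A B of an idempotent, B A = 1, so the traces of
    A B and of B A are the rank. *)
Lemma mxtrace_idem : \tr M = (\rank M)%:R.
Proof.
set A := col_base M; set B := row_base M.
have AB : A *m B = M := mulmx_base M.
have BA : B *m A = 1%:M.
  have fA : row_full A by exact: col_base_full.
  have fB : row_free B by exact: row_base_free.
  apply: (row_free_inj fB); apply: (row_full_inj fA).
  by rewrite mul1mx -(mulmxA B A B) (mulmxA A B (A *m B)) AB M_idem.
by rewrite -AB mxtrace_mulC BA mxtrace1 AB.
Qed.

(** The image of an idempotent is the row space of its matrix M, as x M = x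
    exactly when x is in it. The set W is characterized by its elements only, so
    that the lemma applies to weight spaces. *)
Lemma idem_basis : exists (m : nat) (e : 'I_m -> fock),
  (forall W : set fock, (forall v, W v <-> insupp S v /\ P v = v) -> is_basis W e) /\
  trace S P = m%:R.
Proof.
exists (\rank M), (fun i => vec (row i (row_base M))); split; last first.
  rewrite -mxtrace_idem /trace (big_st (fun b => mcoeff b (P (ket b)))).
  by apply: eq_bigr => i _; rewrite mxE.
have BM : row_base M *m M = row_base M.
  have /submxP[D ->] : (row_base M <= M)%MS by rewrite eq_row_base.
  by rewrite -mulmxA M_idem.
move=> W hW; split=> [i|v /hW[vS Pv]].
  by apply/hW; split; [exact: insupp_vec|rewrite P_vec -row_mul BM].
set x := \row_i mcoeff (st i) v; have vx : v = vec x by exact: vec_coords.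
have xM : x *m M = x by apply: vec_inj; rewrite -P_vec -vx.
have /submxP[y xy] : (x <= row_base M)%MS by rewrite eq_row_base -xM submxMl.
exists y; split; first by rewrite sum_vec -xy.
move=> y'; rewrite sum_vec vx xy => /vec_inj.
exact: (row_free_inj (row_base_free M)).
Qed.

End Idempotent.
End Trace.

(** * Traces of the projectors on finite sectors *)

Section FiniteMsets.
Implicit Types (A : {mset (species * nat)}%mset).

(** A nonempty multiset of weight at most n is obtained by adding a mode of
    weight at most n to a multiset of smaller weight. *)
Lemma finite_wdeg n : finite_set [set A | (wdeg predT A < n)%N].
Proof.
elim: n => [|n IH]; first by rewrite (_ : [set A | _] = set0) // -subset0.
apply: (@sub_finite_set _ _ ([set mset0] `|`
   [set (x +` B)%mset | x in [set: species] `*` `I_n & B in [set B | (wdeg predT B < n)%N]])).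
  move=> A /= An; have [A0|/wdeg_gt0[x _ xA]] := posnP (wdeg predT A).
    by left; apply/msetP => x; rewrite mset0E; exact: wdeg_eq0 A0 _.
  have [k [E1 E2]] : exists k, wdeg predT (A `\ x)%mset = k /\
      wdeg predT A = (x.2.+1 + k)%N.
    by exists (wdeg predT (A `\ x)%mset); rewrite (wdeg_del predT xA) mul1n.
  rewrite {}E2 in An; right; exists x.
    by split => //=; rewrite -ltnS; apply: leq_trans An; rewrite ltnS leq_addr.
  by exists (A `\ x)%mset => /=; [by rewrite E1 -ltnS; apply: leq_ltn_trans An; rewrite addSn ltnS leq_addl|
    rewrite msetB1K // in_mset].
rewrite finite_setU; split; first exact: finite_set1.
by apply: finite_image2 => //; apply: finite_setX => //; exact: finite_finset.
Qed.

Definition msets (d : int) : {fset {mset (species * nat)}%mset} :=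
  fset_set [set A | (wdeg predT A)%:Z = d].

Lemma in_msets d A : (A \in msets d) = ((wdeg predT A)%:Z == d).
Proof.
rewrite in_fset_set; last first.
  by apply: sub_finite_set (finite_wdeg (absz d).+1) => B /=; lia.
by apply/idP/eqP; rewrite inE.
Qed.

End FiniteMsets.

Section Sectors.
Variables (C : numClosedFieldType).
Implicit Types (l : 'I_2) (nu : {ffun 'I_2 -> int}).
Implicit Types (d e : int) (mu : {ffun 'I_4 -> C}).

(** The sector as a finite set, on which traces are taken. *)
Definition sector_states mu nu d : {fset (state C)} :=
  [fset State mu nu A | A in msets (d - (tri (nu 0))%:Z - (tri (nu 1))%:Z)]%fset.

Lemma in_states mu nu d b : (b \in sector_states mu nu d) <-> sector mu nu d b.
Proof.
split=> [/imfsetP[A /=]|[h1 h2 h3]].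
  by rewrite in_msets => /eqP AE ->; split => //; rewrite /tdeg /= AE; ring.
apply/imfsetP; exists (occ b); last by rewrite -h1 -h2; case: (b).
by rewrite /= in_msets; apply/eqP; rewrite -h3 -/(tdeg b); ring.
Qed.

Lemma card_states mu nu d :
  #|` sector_states mu nu d| = #|` msets (d - (tri (nu 0))%:Z - (tri (nu 1))%:Z)|.
Proof. by rewrite card_imfset // => A B []. Qed.

(** The energy of a charge grows at least linearly, which bounds the charges of
    a given energy and dominates the sums over l_1 and l_2 by geometric series. *)
Lemma tri_ge n : `|n| <= (tri n)%:Z + 1.
Proof. by have := triE n; nia. Qed.

Lemma states0 mu nu d l : d + 1 < `|nu l| -> sector_states mu nu d = fset0.
Proof.
move=> h; apply/eqP; rewrite -fsubset0; apply/fsubsetP => b /in_states[h1 h2 h3].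
have hl : (tri (nu l))%:Z <= d.
  have [->|->] : l = 0 \/ l = 1.
  - by case: l {h} => [[|[|l]] hl] //; [left|right]; apply: val_inj.
  - by rewrite -h3 addrAC lerDr.
  - by rewrite -h3 lerDr.
by have := tri_ge (nu l); lia.
Qed.

End Sectors.

Section Dimension.
Variables (C : numClosedFieldType) (qpow : C -> C).
Local Notation fock := (fock C).
Local Notation qint := (qint qpow).
Local Notation zmode := (@zmode C qpow).
Local Notation zproj := (@zproj C qpow).
Hypothesis qint_neq0 : forall m : nat, qint m.+1%:R != 0.
Implicit Types (v : fock) (b : state C) (l : 'I_2) (nu : {ffun 'I_2 -> int}).
Implicit Types (d e : int) (mu : {ffun 'I_4 -> C}) (T : fock -> fock).

Lemma susubmod_proj_states mu nu d v : insupp (sector_states mu nu d) v <-> supp (sector mu nu d) v.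
Proof. by split; apply: suppW => b /in_states. Qed.

Lemma zmode_states s l mu nu d v : insupp (sector_states mu nu d) v ->
  insupp (sector_states mu (shiftc l (sgn s) nu) d) (zmode s l v).
Proof. by move=> /susubmod_proj_states h; apply/susubmod_proj_states; exact: sector_zmode. Qed.

Lemma shiftcK s l nu : shiftc l (sgn (~~ s)) (shiftc l (sgn s) nu) = nu.
Proof. by apply: shiftcN; case: s. Qed.

Lemma zproj_states s l mu nu d v : insupp (sector_states mu nu d) v ->
  insupp (sector_states mu nu d) (zproj s l v).
Proof. by move=> h; rewrite -(shiftcK s l nu); do 2! apply: zmode_states. Qed.

(** For s = true: move a zero mode around the trace to turn xi eta on the first
    sector into eta xi on the second one, and use xi eta + eta xi = 1. The
    operator T stands for the other projector. *)
Lemma trace_zproj T s l mu nu d : linop T ->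
  (forall s v, T (zmode s l v) = zmode s l (T v)) ->
  (forall nu v, insupp (sector_states mu nu d) v -> insupp (sector_states mu nu d) (T v)) ->
  trace (sector_states mu nu d) (fun v => zproj s l (T v)) +
  trace (sector_states mu (shiftc l (sgn s) nu) d) (fun v => zproj s l (T v)) =
  trace (sector_states mu (shiftc l (sgn s) nu) d) T.
Proof.
move=> T_lin TZ TS; set S := sector_states mu nu d; set S' := sector_states _ (shiftc _ _ _) _.
have -> : trace S (fun v => zproj s l (T v)) =
    trace S' (fun v => zmode s l (zmode (~~ s) l (T v))).
  rewrite -[LHS]/(trace S (zmode (~~ s) l \o (fun v => zmode s l (T v)))).
  rewrite (@traceC _ S S'); first by apply: eq_trace => b _; rewrite /= TZ.
  - exact: linop_comp (linop_zmode _ _ _) T_lin.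
  - exact: linop_zmode.
  - by move=> b bS; apply: zmode_states; apply: TS; exact: supp_ket.
  - move=> b bS; rewrite /S -(shiftcK s l nu); apply: zmode_states; exact: supp_ket.
by rewrite -traceD; apply: eq_trace => b _; exact: zmode_anti.
Qed.

(** Solving h k + h (k+1) = N (k+1) downwards from h L = 0. *)
Lemma alternating_sum (h N : nat -> C) (L : nat) : (forall k, h k + h k.+1 = N k.+1) ->
  h L = 0 -> h 0%N = \sum_(k < L) (-1) ^+ k * N k.+1.
Proof.
move=> hN hL; suff E n : h 0%N = \sum_(k < n) (-1) ^+ k * N k.+1 + (-1) ^+ n * h n.
  by rewrite (E L) hL mulr0 addr0.
elim: n => [|n IH]; first by rewrite big_ord0 add0r mul1r.
by rewrite big_ord_recr /= -hN mulrDr IH exprS mulN1r mulNr addrA addrK.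
Qed.

(** The sector whose charge is shifted by L is empty, so the recursion of
    [trace_zproj] stops there. *)
Lemma trace_zproj_sum T s l mu nu d (L : nat) : linop T ->
  (forall s v, T (zmode s l v) = zmode s l (T v)) ->
  (forall nu v, insupp (sector_states mu nu d) v -> insupp (sector_states mu nu d) (T v)) ->
  d + 1 + `|nu l| < L%:Z ->
  trace (sector_states mu nu d) (fun v => zproj s l (T v)) =
  \sum_(k < L) (-1) ^+ k * trace (sector_states mu (shiftc l (sgn s * k.+1%:Z) nu) d) T.
Proof.
move=> T_lin TZ TS hL.
pose nuk (k : nat) := shiftc l (sgn s * k%:Z) nu.
have nu0 : nuk 0%N = nu by apply/ffunP => i; rewrite ffunE mulr0 if_same addr0.
have nuS k : nuk k.+1 = shiftc l (sgn s) (nuk k).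
  apply/ffunP => i; rewrite !ffunE -addrA; congr (_ + _); case: ifP => _ //.
  by rewrite intS mulrDr mulr1 addrC.
rewrite -{1}nu0; apply: (@alternating_sum
  (fun k => trace (sector_states mu (nuk k) d) (fun v => zproj s l (T v)))
  (fun k => trace (sector_states mu (nuk k) d) T)).
  by move=> k; rewrite nuS trace_zproj.
rewrite (@states0 _ _ _ _ l) ?trace0 // /nuk ffunE eqxx; case: (s) => /=; lia.
Qed.

(** The projectors for l = 1 and l = 2 commute, so each one can be expanded in
    the presence of the other. The index k stands for l - 1, whence the signs. *)
Lemma trace_zproj2 s1 s2 mu nu d (L : nat) :
  d + 1 + `|nu 0| + `|nu 1| < L%:Z ->
  trace (sector_states mu nu d) (fun v => zproj s1 0 (zproj s2 1 v)) =
  \sum_(k1 < L) \sum_(k2 < L) (-1) ^+ k1 * (-1) ^+ k2 *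
    #|` msets (d - (tri (nu 0 + sgn s1 * k1.+1%:Z))%:Z - (tri (nu 1 + sgn s2 * k2.+1%:Z))%:Z)|%:R.
Proof.
move=> hL; rewrite (@trace_zproj_sum _ _ _ _ _ _ L); last lia; last first.
- by move=> *; exact: zproj_states.
- by move=> s v; rewrite !zprojE !(@zmodeC _ qpow _ _ 1 0).
- exact: linop_zproj.
apply: eq_bigr => k1 _.
have E : (fun v => zproj s2 1 v) = (fun v => zproj s2 1 (id v)) by [].
rewrite [X in trace _ X]E (@trace_zproj_sum _ _ _ _ _ _ L) //; first last.
- by rewrite ffunE /= addr0; apply: le_lt_trans hL; rewrite [leRHS]addrAC lerDl normr_ge0.
rewrite mulr_sumr; apply: eq_bigr => k2 _.
by rewrite trace_id card_states !ffunE /= !addr0 mulrA.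
Qed.

End Dimension.

(** * Unconditional sums *)

Section USum.
Variable C : numClosedFieldType.
Implicit Types (I J : choiceType) (e : C).

(** Unconditional summability, that is convergence of the finite partial sums
    along inclusion, in a form convenient for estimates. *)
Definition usum I (f : I -> C) (s : C) : Prop := forall e, 0 < e ->
  exists F0 : {fset I}, forall F, (F0 `<=` F)%fset -> `|s - \sum_(i <- F) f i| < e.

Lemma usum_cvg I (f : I -> C) s : usum f s -> partial_sum f @ totally --> s.
Proof.
move=> h; have FF := @totally_filter I; apply/cvgrPdist_lt => e /h [F0 hF]; exists F0 => //= F /hF.
by rewrite /partial_sum -(big_seq_fsetE _ F xpredT f).
Qed.

Lemma usum_sum I (f : I -> C) s : usum f s -> summability.sum f = s.
Proof.
move=> /usum_cvg h; apply: (@cvg_lim _ _ _ _ (totally_filter (I := I)) _ _ h).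
exact: norm_hausdorff.
Qed.

Lemma usum_unique I (f : I -> C) s s' : usum f s -> usum f s' -> s = s'.
Proof. by move=> /usum_sum <- /usum_sum <-. Qed.

Lemma eq_usum I (f g : I -> C) s : f =1 g -> usum f s -> usum g s.
Proof.
move=> fg h e /h[F0 hF]; exists F0 => F /hF.
by rewrite (eq_bigr g).
Qed.

Lemma usumD I (f g : I -> C) s t : usum f s -> usum g t -> usum (fun i => f i + g i) (s + t).
Proof.
move=> hf hg e e0; have e2 : 0 < e / 2 by rewrite divr_gt0.
have [F1 h1] := hf _ e2; have [F2 h2] := hg _ e2.
exists (F1 `|` F2)%fset => F; rewrite fsubUset => /andP[F1F F2F].
rewrite big_split /= opprD addrACA; apply: le_lt_trans (ler_normD _ _) _.
by rewrite [e](splitr e); apply: ltrD; [exact: h1|exact: h2].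
Qed.

Lemma usumZ I (c : C) (f : I -> C) s : usum f s -> usum (fun i => c * f i) (c * s).
Proof.
move=> hf e e0; have c0 : 0 < `|c| + 1 by rewrite ltr_wpDl.
have [F0 h] := hf _ (divr_gt0 e0 c0); exists F0 => F /h hF.
rewrite -mulr_sumr -mulrBr normrM.
rewrite ltr_pdivlMr // mulrC in hF; apply: le_lt_trans hF.
by rewrite ler_wpM2r // lerDl.
Qed.

Lemma usum0 I : usum (fun _ : I => 0 : C) 0.
Proof. by move=> e e0; exists fset0 => F _; rewrite big1 // subr0 normr0. Qed.

(** Grouping the terms by the value of p, all of whose fibers are finite: the
    preimage of a finite set of values is finite, and it contains F0 if the set
    contains the image of F0. *)
Lemma usum_fiber I J (p : I -> J) (f : I -> C) (g : J -> C) s :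
  (forall j, exists2 F : {fset I}, (forall i, (i \in F) = (p i == j)) &
                g j = \sum_(i <- F) f i) ->
  usum f s -> usum g s.
Proof.
move=> hp hf e /hf[F0 hF0]; exists [fset p i | i in F0]%fset => G GF.
pose D (j : J) : {fset I} := sval (cid2 (hp j)).
have DE j i : (i \in D j) = (p i == j) by rewrite /D; case: (cid2 _).
have gD j : g j = \sum_(i <- D j) f i by rewrite /D; case: (cid2 _).
pose F : {fset I} := (\bigcup_(j <- G) D j)%fset.
have FE i : (i \in F) = (p i \in G).
  apply/bigfcupP/idP => [[j /= + ]|pG]; first by rewrite andbT => jG; rewrite DE => /eqP ->.
  by exists (p i); rewrite ?DE // andbT.
have -> : \sum_(j <- G) g j = \sum_(i <- F) f i.
  transitivity (\sum_(i <- F) \sum_(j <- G) if p i == j then f i else 0).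
    rewrite exchange_big /= big_seq [RHS]big_seq; apply: eq_bigr => j jG.
    rewrite gD -big_mkcond; apply: eq_fbigl_cond => i.
    by rewrite !inE /= FE DE; case: eqP => [->|]; rewrite ?jG ?andbT ?andbF.
  rewrite big_seq [RHS]big_seq; apply: eq_bigr => i; rewrite FE => pG.
  rewrite (big_fsetD1 _ pG) /= eqxx big1_fset ?addr0 // => j.
  by rewrite !inE eq_sym => /andP[/negbTE ->].
apply: hF0; apply/fsubsetP => i iF0; rewrite FE.
by apply: (fsubsetP GF); apply/imfsetP; exists i.
Qed.

(** The sums over large rectangles are close both to u and to s t. *)
Lemma usum_prod I J (f : I -> C) (g : J -> C) s t u : usum f s -> usum g t ->
  usum (fun x : I * J => f x.1 * g x.2) u -> u = s * t.
Proof.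
move=> hf hg hu; apply/eqP; rewrite -subr_eq0 -normr_eq0; apply/negPn/negP => n0.
have e0 : 0 < `|u - s * t| by rewrite lt0r n0 normr_ge0.
set e := `|u - s * t| in e0 n0; have a0 : 0 < e / 2 by rewrite divr_gt0.
set a := e / 2 in a0; pose b := `|s| + `|t| + 1.
have b0 : 0 < b by rewrite ltr_wpDl // addr_ge0.
have ab0 : 0 < a + b by rewrite addr_gt0.
have d0 : 0 < a / (a + b) by rewrite divr_gt0.
set d := a / (a + b) in d0.
have d1 : d <= 1 by rewrite ler_pdivrMr // mul1r lerDl ltW.
have db : d * b <= a by rewrite /d mulrAC ler_pdivrMr // ler_wpM2l ?ltW // ltrDr.
have [F1 h1] := hf _ d0; have [F2 h2] := hg _ d0; have [K hK] := hu _ a0.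
pose G1 := (F1 `|` [fset x.1 | x in K])%fset; pose G2 := (F2 `|` [fset x.2 | x in K])%fset.
have {}h1 := h1 G1 (fsubsetUl _ _); have {}h2 := h2 G2 (fsubsetUl _ _).
pose r := [seq (i, j) | i <- enum_fset G1, j <- enum_fset G2].
have ur : uniq r by apply: allpairs_uniq => //= -[? ?] [? ?].
have KB : (K `<=` seq_fset tt r)%fset.
  apply/fsubsetP => -[i j] ij; rewrite seq_fsetE; apply/allpairsP; exists (i, j); split => //=.
    by rewrite !inE; apply/orP; right; apply/imfsetP; exists (i, j).
  by rewrite !inE; apply/orP; right; apply/imfsetP; exists (i, j).
have := hK _ KB; rewrite (perm_big _ (seq_fset_perm tt r)) undup_id // big_allpairs /=.
have -> : \sum_(i <- G1) \sum_(j <- G2) f i * g j = (\sum_(i <- G1) f i) * (\sum_(j <- G2) g j).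
  by rewrite mulr_suml; apply: eq_bigr => i _; rewrite mulr_sumr.
move: (\sum_(i <- G1) f i) (\sum_(j <- G2) g j) h1 h2 => x y h1 h2 h3.
suff : e < a + a by rewrite -splitr ltxx.
have -> : e = `|(u - x * y) - (s * (t - y) + (s - x) * y)|.
  by rewrite /e; congr `|_|; ring.
apply: le_lt_trans (ler_normB _ _) _; apply: ltr_leD => //.
apply: le_trans (ler_normD _ _) _; rewrite !normrM.
have y1 : `|y| <= `|t| + 1.
  rewrite -[y](subKr t); apply: le_trans (ler_normB _ _) _.
  by rewrite lerD2l; apply: le_trans d1; exact: ltW.
apply: le_trans db; rewrite /b -addrA mulrDr [d * `|s|]mulrC; apply: lerD.
  by rewrite ler_wpM2l // ltW.
by apply: ler_pM => //; exact: ltW.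
Qed.

End USum.

(** * Absolute summability *)

(** Monotonicity in the index set, for nonnegative terms. *)
Lemma ler_fsum (K : numDomainType) (I : choiceType) (A B : {fset I}) (f : I -> K) :
  (forall i, 0 <= f i) -> (A `<=` B)%fset -> \sum_(i <- A) f i <= \sum_(i <- B) f i.
Proof.
move=> f0 /fsubsetP AB; rewrite [leRHS](bigID (mem A)) /=.
have -> : \sum_(i <- B | i \in A) f i = \sum_(i <- A) f i.
  apply: eq_fbigl_cond => i; rewrite !inE /= andbT.
  by case: (boolP (i \in A)) => [/AB ->|]; rewrite ?andbF.
by rewrite lerDl sumr_ge0.
Qed.

Section Complete.
Variable R : realType.
Local Notation C := (Cplx R).

Definition rsum (I : choiceType) (f : I -> R) (s : R) : Prop := forall e, 0 < e ->
  exists F0 : {fset I}, forall F, (F0 `<=` F)%fset -> `|s - \sum_(i <- F) f i| < e.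

(** The sum is the supremum of the finite partial sums. *)
Lemma rsum_nneg (I : choiceType) (f : I -> R) B : (forall i, 0 <= f i) ->
  (forall F : {fset I}, \sum_(i <- F) f i <= B) -> exists s, rsum f s.
Proof.
move=> f0 fB; pose E := [set x : R | exists F : {fset I}, x = \sum_(i <- F) f i].
have hE : has_sup E.
  split; first by exists (\sum_(i <- fset0) f i); exists fset0.
  by exists B => x [F ->].
exists (sup E) => e e0; have [x [F0 ->] hx] := sup_adherent e0 hE.
exists F0 => F FF.
have h1 : \sum_(i <- F) f i <= sup E by apply: sup_upper_bound => //; exists F.
have h2 := ler_fsum f0 FF.
by rewrite ger0_norm; lra.
Qed.

(** Write f as the difference of the nonnegative families |f| + f and |f|. *)
Lemma rsum_abs (I : choiceType) (f : I -> R) B :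
  (forall F : {fset I}, \sum_(i <- F) `|f i| <= B) -> exists s, rsum f s.
Proof.
move=> fB; have [s hs] := rsum_nneg (fun i => normr_ge0 (f i)) fB.
have [t ht] : exists t, rsum (fun i => `|f i| + f i) t.
  apply: (@rsum_nneg _ _ (B + B)) => [i|F].
    by have := ler_norm (- f i); rewrite normrN; lra.
  rewrite big_split /=; apply: lerD => //; apply: le_trans (fB F).
  by apply: ler_sum => i _; exact: ler_norm.
exists (t - s) => e e0; have e2 : 0 < e / 2 by rewrite divr_gt0.
have [F1 h1] := hs _ e2; have [F2 h2] := ht _ e2.
exists (F1 `|` F2)%fset => F; rewrite fsubUset => /andP[/h1 k1 /h2 k2].
move: k1 k2; rewrite big_split /=.
move: (\sum_(i <- F) `|f i|) (\sum_(i <- F) f i) => x y.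
rewrite !ltr_norml; lra.
Qed.

Lemma norm_real (x : R) : `|x%:C%C| = (`|x|)%:C%C :> R[i].
Proof. by rewrite normc_def /= expr0n addr0 sqrtr_sqr. Qed.

Lemma norm_i : `|'i%C| = 1 :> R[i].
Proof. by rewrite normc_def /= expr0n add0r expr1n sqrtr1. Qed.

(** The real and imaginary parts are absolutely summable. *)
Lemma abs_usum (I : choiceType) (f : I -> C) (B : C) :
  (forall F : {fset I}, \sum_(i <- F) `|f i| <= B) -> exists s, usum f s.
Proof.
move=> fB; have ReB (g : C -> R) : (forall z, (`|g z|)%:C%C <= `|z : C|) ->
    exists s, rsum (fun i => g (f i)) s.
  move=> hg; apply: (@rsum_abs _ _ (complex.Re B)) => F.
  have : (\sum_(i <- F) `|g (f i)|)%:C%C <= B.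
    by apply: le_trans (fB F); rewrite rmorph_sum; apply: ler_sum => i _; exact: hg.
  by rewrite lecE => /andP[].
have [x hx] := ReB (@complex.Re R) (@normc_ge_Re R).
have [y hy] : exists s, rsum (fun i => complex.Im (f i)) s.
  apply: ReB => z; have := normc_ge_Re (z * 'i%C); rewrite ReiNIm normrN normrM.
  by rewrite norm_i mulr1.
exists (Complex x y) => e e0.
have eE : e = (complex.Re e)%:C%C by rewrite RRe_real // gtr0_real.
have e2 : 0 < complex.Re e / 2 by rewrite divr_gt0 //; move: e0; rewrite ltcE => /andP[].
have [F1 h1] := hx _ e2; have [F2 h2] := hy _ e2.
exists (F1 `|` F2)%fset => F; rewrite fsubUset => /andP[/h1 k1 /h2 k2].
set w := _ - _.
have wRe : complex.Re w = x - \sum_(i <- F) complex.Re (f i).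
  rewrite /w raddfB /=; congr (_ - _).
  by rewrite (raddf_sum (@complex.Re R)).
have wIm : complex.Im w = y - \sum_(i <- F) complex.Im (f i).
  rewrite /w raddfB /=; congr (_ - _).
  by rewrite (raddf_sum (@complex.Im R)).
rewrite [w](complexE w) eE (splitr (complex.Re e)) rmorphD; apply: le_lt_trans (ler_normD _ _) _.
by rewrite normrM norm_i mul1r !norm_real wRe wIm; apply: ltrD; rewrite ltcR.
Qed.

End Complete.

(** * The generating function of multisets *)

Section EulerProduct.
Implicit Types (A : {mset (species * nat)}%mset) (L : seq (species * nat)).

(** The multisets of modes in a finite list L are counted by a finite product;
    the product over all modes is obtained by exhaustion. *)
Definition within L A : bool := all [in L] A.

Lemma withinP L A : reflect (forall y, (0 < A y)%N -> y \in L) (within L A).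
Proof.
apply: (iffP allP) => h y.
  by rewrite -in_mset; exact: h.
by rewrite in_mset; exact: h.
Qed.

Lemma within_nil A : within [::] A = (A == mset0).
Proof.
apply/withinP/eqP => [h|->] => [|y]; last by rewrite mset0E.
apply/msetP => y; rewrite mset0E; apply/eqP; rewrite -leqn0 leqNgt.
by apply/negP => /h.
Qed.

Lemma within_cons0 x L A : A x = 0%N -> within (x :: L) A = within L A.
Proof.
move=> x0; apply/withinP/withinP => h y yA; last by rewrite inE h ?orbT.
by have := h y yA; rewrite inE => /orP[/eqP yx|//]; rewrite yx x0 in yA.
Qed.

Lemma within_del x L A : within (x :: L) (A `\ x)%mset = within (x :: L) A.
Proof.
apply/withinP/withinP => h y yA.
  have [->|yx] := eqVneq y x; first exact: mem_head.
  by apply: h; rewrite msetB1E (negbTE yx) subn0.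
by apply: h; move: yA; rewrite msetB1E; lia.
Qed.

Notation deg := (wdeg predT).

Lemma deg_del x A : (0 < A x)%N -> deg A = (x.2.+1 + deg (A `\ x)%mset)%N.
Proof. by move=> /(wdeg_del predT) ->; rewrite mul1n. Qed.

Lemma deg0 : deg mset0 = 0%N.
Proof. by rewrite /wdeg big_mset0. Qed.

Section Bound.
Variables (K : numFieldType) (r : K).
Hypothesis r01 : 0 <= r < 1.

Lemma r_exp_lt1 n : r ^+ n.+1 < 1.
Proof. by case/andP: r01 => r0 r1; rewrite exprn_ilt1. Qed.

Lemma r_exp_ge0 n : 0 <= r ^+ n.
Proof. by case/andP: r01 => r0 _; exact: exprn_ge0. Qed.

(** Induction on L, and for a new mode x on a bound for its multiplicity:
    multisets that contain x are those obtained by adding x to a multiset, which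
    gives B + r^w B / (1 - r^w) = B / (1 - r^w). *)
Lemma sum_within_le L (F : {fset {mset (species * nat)}%mset}) :
  \sum_(A <- F | within L A) r ^+ deg A <= \prod_(x <- L) (1 - r ^+ x.2.+1)^-1.
Proof.
have pos (L' : seq (species * nat)) : 0 <= \prod_(x <- L') (1 - r ^+ x.2.+1)^-1.
  by apply: prodr_ge0 => x _; rewrite invr_ge0 subr_ge0 ltW // r_exp_lt1.
elim: L F => [|x L IH] F.
  rewrite big_nil (eq_bigl (fun A => A == mset0)) => [|A]; last exact: within_nil.
  have [m0|m0] := boolP (mset0 \in F).
    rewrite big_mkcond (big_fsetD1 mset0) //= eqxx deg0 expr0 big1_fset ?addr0 // => A.
    by rewrite !inE => /andP[/negbTE ->].
  by rewrite big1_fset // => A AF /eqP AE; rewrite AE (negbTE m0) in AF.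
rewrite big_cons; set B := \prod_(_ <- L) _; set w := x.2.+1.
have w1 : 0 < 1 - r ^+ w by rewrite subr_gt0 r_exp_lt1.
have [n hn] : exists n, forall A, A \in F -> (A x <= n)%N.
  exists (\sum_(A <- F) A x)%N => A AF; rewrite (big_fsetD1 A) //=; exact: leq_addr.
elim: n F hn => [|n IHn] F hn.
  apply: le_trans (_ : B <= _); last first.
    by apply: ler_peMl; [exact: pos|rewrite invf_ge1 // gerBl r_exp_ge0].
  apply: le_trans (IH F); rewrite big_seq_cond [leRHS]big_seq_cond.
  rewrite (eq_bigl (fun A => (A \in F) && within L A)) // => A.
  have [AF|//] := boolP (A \in F); rewrite /= within_cons0 //.
  by have := hn _ AF; rewrite leqn0 => /eqP.
rewrite (bigID (fun A : {mset _}%mset => A x == 0%N)) /=.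
have -> : (1 - r ^+ w)^-1 * B = B + r ^+ w * ((1 - r ^+ w)^-1 * B).
  by field; rewrite gt_eqF.
apply: lerD.
  apply: le_trans (IH F); rewrite [leRHS](bigID (fun A : {mset _}%mset => A x == 0%N)) /=.
  apply: le_trans (_ : \sum_(A <- F | within L A && (A x == 0%N)) r ^+ deg A <= _).
    rewrite le_eqVlt; apply/orP; left; apply/eqP; apply: eq_bigl => A.
    by case: eqP => [/(within_cons0 L) ->|]; rewrite ?andbF.
  by rewrite lerDl sumr_ge0 // => *; exact: r_exp_ge0.
pose D := [fset A in F | A x != 0%N]%fset.
pose F' := [fset (A `\ x)%mset | A in D]%fset.
have inj : {in D &, injective (fun A => (A `\ x)%mset)}.
  move=> A A'; rewrite !inE /= -!lt0n => /andP[_ h] /andP[_ h'] E.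
  by rewrite -(msetB1K (a := x) (A := A)) ?E ?msetB1K // in_mset.
have hF' : \sum_(A <- F | within (x :: L) A && (A x != 0%N)) r ^+ deg A =
   r ^+ w * \sum_(A <- F' | within (x :: L) A) r ^+ deg A.
  rewrite [in RHS]big_mkcond /F' big_imfset //= mulr_sumr big_fset /= big_mkcondl /=.
  rewrite big_seq_cond [RHS]big_seq_cond; apply: eq_bigr => A /andP[_ Ax].
  by rewrite within_del; case: ifP => _; rewrite ?mulr0 // -exprD -deg_del ?lt0n.
rewrite hF' ler_wpM2l ?r_exp_ge0 // IHn // => A /imfsetP[A' /=].
by rewrite !inE => /andP[A'F A'x] ->; rewrite msetB1E eqxx; have := hn _ A'F; lia.
Qed.

End Bound.

Definition modes N : seq (species * nat) :=
  [seq (s, m) | s <- enum {: species}, m <- iota 0 N].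

Lemma modes_uniq N : uniq (modes N).
Proof. by apply: allpairs_uniq => [||[? ?] [? ?]]; rewrite ?enum_uniq ?iota_uniq. Qed.

Lemma mem_modes N x : (x \in modes N) = (x.2 < N)%N.
Proof.
apply/allpairsP/idP => [[[s m] [_ /= + ->]]|xN]; first by rewrite mem_iota.
by exists x; rewrite mem_enum mem_iota; split => //; case: (x).
Qed.

Lemma prod_modes (K : comNzRingType) (F : nat -> K) N :
  \prod_(x <- modes N) F x.2 = (\prod_(m < N) F m) ^+ 6.
Proof.
have E : \prod_(m <- iota 0 N) F m = \prod_(m < N) F m.
  by rewrite -(big_mkord xpredT) /index_iota subn0.
by rewrite big_allpairs /= E big_enum /= prodr_const card_sum !card_ord.
Qed.

Lemma within_modes A : exists N, forall N', (N <= N')%N -> within (modes N') A.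
Proof.
exists (deg A) => N' hN; apply/withinP => y yA; rewrite mem_modes.
by apply: leq_trans hN; rewrite (deg_del yA) leq_addr.
Qed.

Lemma within_modes_all (F : {fset {mset (species * nat)}%mset}) : exists N,
  forall N' A, (N <= N')%N -> A \in F -> within (modes N') A.
Proof.
pose g A := sval (cid (within_modes A)).
have gP A N' : (g A <= N')%N -> within (modes N') A by rewrite /g; case: cid => ? /= h /h.
exists (\sum_(A <- F) g A)%N => N' A hN AF; apply: gP; apply: leq_trans hN.
by rewrite (big_fsetD1 A) //= leq_addr.
Qed.

Section Values.
Variables (R : realType) (q : Cplx R).
Hypothesis q1 : `|q| < 1.
Local Notation C := (Cplx R).

(** Since 1 / (1 - r^(m+1)) <= 1 + r^m / (1 - r) <= exp (r^m / (1 - r)), the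
    logarithm of the product is at most a geometric sum. *)
Lemma prod_bound : exists2 K : C, 0 < K & forall N,
  \prod_(m < N) (1 - `|q| ^+ m.+1)^-1 <= K.
Proof.
pose r := complex.Re `|q|.
have rE : `|q| = r%:C%C by rewrite RRe_real // normr_real.
have r0 : 0 <= r by have := normr_ge0 q; rewrite rE lecR.
have r1 : r < 1 by move: q1; rewrite rE ltcR.
have rd : 0 < 1 - r by rewrite subr_gt0.
have H N : 0 <= \prod_(m < N) (1 - r ^+ m.+1)^-1 <= expR ((1 - r ^+ N) / (1 - r) ^+ 2).
  elim: N => [|N /andP[h0 IH]].
    by rewrite big_ord0 subrr mul0r expR0 lexx ler01.
  have rN : 0 <= r ^+ N <= 1 by rewrite exprn_ge0 // exprn_ile1 // ltW.
  have rN1 : 0 < 1 - r ^+ N.+1 by rewrite subr_gt0 r_exp_lt1 // r0.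
  rewrite big_ord_recr /= mulr_ge0 ?invr_ge0 ?(ltW rN1) //=.
  have -> : (1 - r ^+ N.+1) / (1 - r) ^+ 2 = (1 - r ^+ N) / (1 - r) ^+ 2 + r ^+ N / (1 - r).
    by rewrite exprS; field; rewrite gt_eqF.
  rewrite expRD; apply: ler_pM => //; first by rewrite invr_ge0 ltW.
  apply: le_trans (expR_ge1Dx _).
  have rr : r ^+ N.+1 <= r by rewrite exprS ler_piMr //; case/andP: rN.
  have -> : 1 + r ^+ N / (1 - r) = (1 - r + r ^+ N) / (1 - r) by field; rewrite gt_eqF.
  rewrite -div1r ler_pdivrMr // mulrAC ler_pdivlMr // mul1r.
  case/andP: rN; rewrite exprS; move: (r ^+ N) => x x0 x1.
  rewrite -subr_ge0 (_ : _ - _ = x * ((1 - r) ^+ 2 + r * (1 - x))); last ring.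
  by rewrite mulr_ge0 // addr_ge0 ?sqr_ge0 // mulr_ge0 // subr_ge0.
exists (expR ((1 - r) ^- 2))%:C%C; first by rewrite ltcR expR_gt0.
move=> N; rewrite rE.
have -> : \prod_(m < N) (1 - r%:C%C ^+ m.+1)^-1 = (\prod_(m < N) (1 - r ^+ m.+1)^-1)%:C%C :> R[i].
  by rewrite rmorph_prod; apply: eq_bigr => m _; rewrite fmorphV rmorphB rmorph1 rmorphXn.
rewrite lecR; have /andP[_ h] := H N; apply: le_trans h _.
rewrite ler_expR; apply: ler_piMl; last by rewrite gerBl exprn_ge0.
by rewrite invr_ge0 exprn_ge0 // ltW.
Qed.

Lemma abs_q : 0 <= `|q| < 1.
Proof. by rewrite normr_ge0. Qed.

Lemma q_exp_neq1 n : 1 - q ^+ n.+1 != 0.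
Proof.
rewrite subr_eq0 eq_sym; apply/eqP => /(congr1 Num.norm); rewrite normrX normr1 => h.
by have := r_exp_lt1 abs_q n; rewrite h ltxx.
Qed.

Lemma within_abs : exists B : C, forall L (F : {fset {mset (species * nat)}%mset}),
  \sum_(A <- F) `|if within L A then q ^+ deg A else 0| <= B.
Proof.
have [K K0 hK] := prod_bound; exists (K ^+ 6) => L F.
have [N hN] := within_modes_all F.
apply: (@le_trans _ _ (\sum_(A <- F | within (modes N) A) `|q| ^+ deg A)).
  rewrite [leRHS]big_mkcond big_seq [leRHS]big_seq; apply: ler_sum => A AF.
  rewrite (hN N A) //; case: ifP => _; rewrite ?normrX // normr0; apply: exprn_ge0.
  exact: normr_ge0.
apply: le_trans (sum_within_le abs_q _ _) _.
rewrite (prod_modes (fun m => (1 - `|q| ^+ m.+1)^-1)) lerXn2r // ?nnegrE ?(ltW K0) //.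
by apply: prodr_ge0 => m _; rewrite invr_ge0 subr_ge0 ltW // r_exp_lt1 // abs_q.
Qed.

(** Let s be the sum for x :: L. Multisets without x contribute the product over
    L and those with x contribute q^(x.2+1) s; solve for s. *)
Lemma usum_within L : uniq L ->
  usum (fun A => if within L A then q ^+ deg A else 0) (\prod_(x <- L) (1 - q ^+ x.2.+1)^-1).
Proof.
elim: L => [_|x L IH /andP[xL uL]].
  rewrite big_nil => e e0; exists [fset mset0]%fset => F /fsubsetP h.
  rewrite (big_fsetD1 mset0) /=; last by apply: h; rewrite inE.
  rewrite within_nil eqxx deg0 expr0 big1_fset ?addr0 ?subrr ?normr0 // => A.
  by rewrite !inE within_nil => /andP[/negbTE ->].
have [B hB] := within_abs; have [s hs] := abs_usum (hB (x :: L)).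
have {}IH := IH uL.
have hg : usum (fun A => if within (x :: L) A && (A x != 0%N) then q ^+ deg A else 0) (q ^+ x.2.+1 * s).
  apply: (usum_fiber (p := fun A => (x +` A)%mset) _ (usumZ (q ^+ x.2.+1) hs)) => A.
  exists (if A x != 0%N then [fset (A `\ x)%mset]%fset else fset0).
    move=> A'; case: ifPn => Ax.
      rewrite inE; apply/eqP/eqP => [->|<-]; last by rewrite msetD1K.
      by rewrite msetB1K // in_mset lt0n.
    rewrite inE; apply/esym/negP => /eqP AE; move: Ax; rewrite -AE mset1DE eqxx.
    by rewrite addn_eq0.
  case: (boolP (A x != 0%N)) => Ax; last by rewrite andbF big_seq_fset0.
  rewrite big_seq_fset1 andbT within_del; case: ifP => _; rewrite ?mulr0 //.
  by rewrite -exprD -deg_del // lt0n.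
have hs' := usumD IH hg.
have E : s = \prod_(y <- L) (1 - q ^+ y.2.+1)^-1 + q ^+ x.2.+1 * s.
  apply: usum_unique hs _; apply: eq_usum hs' => A.
  have [A0|A0] := eqVneq (A x) 0%N; first by rewrite within_cons0 // andbF addr0.
  rewrite andbT; have -> : within L A = false.
    by apply/negP => /withinP /(_ x); rewrite lt0n A0 (negbTE xL) => /(_ isT).
  by rewrite add0r.
rewrite big_cons (_ : _ * _ = s) //.
have n0 := q_exp_neq1 x.2.
apply: (mulfI n0); rewrite mulrA mulfV // mul1r mulrBl mul1r.
by rewrite {1}E addrK.
Qed.

(** The six species contribute equally. *)
Lemma usum_within_modes N :
  usum (fun A => if within (modes N) A then q ^+ deg A else 0)
       (\prod_(m < N) (1 - q ^+ m.+1) ^+ 6)^-1.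
Proof.
have := usum_within (modes_uniq N).
rewrite (prod_modes (fun m => (1 - q ^+ m.+1)^-1)) -prodrXl -prodfV.
by rewrite [in X in usum _ X](eq_bigr (fun m : 'I_N => ((1 - q ^+ m.+1) ^+ 6)^-1)) // => m _; rewrite exprVn.
Qed.

(** The generating function S of all multisets is the limit of the inverses G N
    of the partial Euler products, by summability. It is not zero because |G N|
    is bounded below: its inverse is at most the product of the (1 + |q|^m)^6,
    and 1 + |q|^m <= 1 / (1 - |q|^m). *)
Lemma euler : exists S : C, [/\ S != 0, usum (fun A => q ^+ deg A) S,
   exists B, forall F : {fset {mset (species * nat)}%mset},
     \sum_(A <- F) `|q ^+ deg A| <= B &
   \prod_(m < N) (1 - q ^+ m.+1) ^+ 6 @[N --> \oo] --> S^-1].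
Proof.
have [B hB] := within_abs.
have hB' (F : {fset {mset (species * nat)}%mset}) : \sum_(A <- F) `|q ^+ deg A| <= B.
  have [N hN] := within_modes_all F; apply: le_trans (hB (modes N) F).
  by rewrite big_seq [leRHS]big_seq; apply: ler_sum => A AF; rewrite (hN N).
have [S hS] := abs_usum hB'.
pose G N : C := (\prod_(m < N) (1 - q ^+ m.+1) ^+ 6)^-1.
have cG e : 0 < e -> exists N0, forall N, (N0 <= N)%N -> `|S - G N| < e.
  move=> e0; have e2 : 0 < e / 2 by rewrite divr_gt0.
  have [F0 h0] := hS _ e2; have [N0 hN0] := within_modes_all F0.
  exists N0 => N N0N; have [F1 h1] := usum_within_modes N e2.
  have {}h1 := h1 (F0 `|` F1)%fset (fsubsetUr _ _).
  have : (F0 `<=` [fset A in (F0 `|` F1)%fset | within (modes N) A])%fset.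
    by apply/fsubsetP => A AF; rewrite !inE AF /= (hN0 N).
  move=> /h0; rewrite big_fset /= big_mkcond => {}h0.
  rewrite [e]splitr; apply: le_lt_trans (ltrD h0 h1).
  by rewrite [X in _ <= _ + X]distrC; apply: le_trans (ler_normD _ _); rewrite addrA subrK.
have [K K0 hK] := prod_bound.
have GK N : (K ^+ 6)^-1 <= `|G N|.
  rewrite /G normrV ?unitfE; last first.
    by apply/prodf_neq0 => m _; rewrite expf_neq0 // q_exp_neq1.
  rewrite lef_pV2 ?posrE ?exprn_gt0 //; last first.
    by rewrite normr_gt0; apply/prodf_neq0 => m _; rewrite expf_neq0 // q_exp_neq1.
  rewrite prodrXl normrX lerXn2r ?nnegrE ?(ltW K0) // normr_prod.
  apply: le_trans (hK N); apply: ler_prod => m _; rewrite normr_ge0 /=.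
  have rm := r_exp_lt1 abs_q m; rewrite -div1r ler_pdivlMr ?subr_gt0 //.
  apply: (@le_trans _ _ ((1 + `|q| ^+ m.+1) * (1 - `|q| ^+ m.+1))).
    rewrite ler_wpM2r ?subr_ge0 ?(ltW rm) //; apply: le_trans (ler_normB _ _) _.
    by rewrite normr1 normrX.
  by rewrite mulrC -subr_sqr expr1n gerBl exprn_ge0 // exprn_ge0.
have S0 : S != 0.
  apply/eqP => S0; have K6 : 0 < (K ^+ 6)^-1 by rewrite invr_gt0 exprn_gt0.
  have [N hN] := cG _ K6; have := hN N (leqnn N).
  by rewrite S0 sub0r normrN => /(le_lt_trans (GK N)); rewrite ltxx.
exists S; split => //; first by exists B.
have -> : (fun N => \prod_(m < N) (1 - q ^+ m.+1) ^+ 6) = (fun N => (G N)^-1).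
  by apply/funext => N; rewrite /G invrK.
apply: cvgV => //; apply/cvgrPdist_lt => e /cG[N0 hN]; exists N0 => //= N; exact: hN.
Qed.

End Values.
End EulerProduct.

(** * Diagonalization of d and the h_j *)

Section Derivation.
Variables (C : numClosedFieldType) (qpow : C -> C).
Local Notation fock := (fock C).
Local Notation ket := (@ket C).
Local Notation qint := (qint qpow).
Local Notation qsym := (qsym qpow).
Local Notation osc := (@osc C qpow).
Local Notation a_ := (@a_ C qpow).
Local Notation c_ := (@c_ C qpow).
Local Notation A_ := (@A_ C qpow).
Local Notation Astar := (@Astar C qpow).
Local Notation amat := (@amat C).
Hypothesis qint_neq0 : forall m : nat, qint m.+1%:R != 0.
Hypothesis qsym_neq0 : forall m : nat, qsym m.+1%:Z != 0.
Hypothesis qpow0 : qpow 0 = 1.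
Implicit Types (u v : fock) (b : state C) (i j k l : 'I_4) (n : int).

Lemma sum4 (V : zmodType) (F : 'I_4 -> V) :
  \sum_i F i = F 0 + F 1 + F (inord 2) + F ord_max.
Proof.
rewrite !big_ord_recl big_ord0 addr0 !addrA; congr (F _ + F _ + F _ + F _);
  by apply: val_inj; rewrite //= inordK.
Qed.

Lemma ord4P (P : 'I_4 -> Prop) : P 0 -> P 1 -> P (inord 2) -> P ord_max -> forall i, P i.
Proof.
move=> p0 p1 p2 p3 [[|[|[|[|i]]]] hi] //.
- by rewrite (_ : Ordinal hi = 0) //; apply: val_inj.
- by rewrite (_ : Ordinal hi = 1) //; apply: val_inj.
- by rewrite (_ : Ordinal hi = inord 2) //; apply: val_inj; rewrite /= inordK.
- by rewrite (_ : Ordinal hi = ord_max) //; apply: val_inj.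
Qed.

(** The coefficients of the A^i in the a^j, without the factor
    (q^n + q^(-n)) / 2 of A^4. *)
Definition bmat : 'M[C]_4 :=
  \matrix_(i, j) nth 0 (nth [::]
    [:: [:: 1;  1;  0;  0];
        [:: 0; -1; -1;  0];
        [:: 0;  0;  1;  1];
        [:: 1; -1;  1; -1]] i) j.

Definition ainv : 'M[C]_4 :=
  \matrix_(i, j) nth 0 (nth [::]
    [:: [:: 2^-1; 2^-1;    0;    4^-1];
        [:: 2^-1; 0;       -2^-1; 0];
        [:: 0;    -2^-1; -2^-1; 4^-1];
        [:: 4^-1; 0;       4^-1;  0]] i) j.

Lemma amatK : amat *m ainv = 1%:M.
Proof.
apply/matrixP => i j; rewrite !mxE sum4 !mxE.
elim/ord4P: i; elim/ord4P: j; rewrite /= ?inordK //= -?val_eqE /= ?inordK //=; by field.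
Qed.

Lemma invmx_amat : invmx amat = ainv.
Proof.
have [u _] := mulmx1_unit amatK.
by rewrite -[RHS](mulKmx u) amatK mulmx1.
Qed.

(** The signs are those of the commutation relations of the a^j; this is why d
    is diagonal on states. *)
Lemma bmat_form : bmat^T *m ainv *m bmat = \matrix_(i, j) (if i == j then (-1) ^+ i else 0).
Proof.
apply/matrixP => i j; rewrite !mxE sum4 !mxE !sum4 !mxE.
elim/ord4P: i; elim/ord4P: j; rewrite /= ?inordK //= -?val_eqE /= ?inordK //=
  ?expr0 ?expr1 ?sqrrN ?expr1n; by field.
Qed.

Lemma quad_form (X : 'I_4 -> 'I_4 -> fock) :
  \sum_i \sum_l ainv i l *: (\sum_j bmat i j *: \sum_k bmat l k *: X j k)
  = \sum_(j < 4) (-1) ^+ j *: X j j.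
Proof.
transitivity (\sum_j \sum_k (bmat^T *m ainv *m bmat) j k *: X j k).
  transitivity (\sum_i \sum_l \sum_j \sum_k (ainv i l * (bmat i j * bmat l k)) *: X j k).
    apply: eq_bigr => i _; apply: eq_bigr => l _; rewrite scaler_sumr; apply: eq_bigr => j _.
    by rewrite !scaler_sumr; apply: eq_bigr => k _; rewrite !scalerA mulrA.
  transitivity (\sum_j \sum_k \sum_l \sum_i (ainv i l * (bmat i j * bmat l k)) *: X j k).
    rewrite exchange_big /= (eq_bigr _ (fun l _ => exchange_big _ _ _ _ _ _)) /=.
    rewrite exchange_big /=; apply: eq_bigr => j _.
    rewrite (eq_bigr _ (fun l _ => exchange_big _ _ _ _ _ _)) /= exchange_big /=.
    by [].
  apply: eq_bigr => j _; apply: eq_bigr => k _; rewrite mxE scaler_suml.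
  apply: eq_bigr => l _; rewrite [(_ *m _) j l]mxE mulr_suml scaler_suml; apply: eq_bigr => i _.
  have -> : bmat^T j i = bmat i j by rewrite !mxE.
  by congr (_ *: _); rewrite mulrA [ainv _ _ * _]mulrC.
apply: eq_bigr => j _; rewrite bmat_form (bigD1 j) //= big1 => [|k kj]; last first.
  by rewrite !mxE eq_sym (negbTE kj) scale0r.
by rewrite !mxE eqxx addr0.
Qed.

Lemma linop_a l n : linop (a_ l n). Proof. exact: linop_osc. Qed.

Definition Ahat i n v : fock := \sum_j bmat i j *: a_ j n v.

Lemma linop_Ahat i n : linop (Ahat i n).
Proof. by apply: linop_bigsum => j _; apply: linop_scale; exact: linop_a. Qed.

(** The factor of A^4 omitted in [bmat]. *)
Definition Anorm i n : C := if (i < 3)%N then 1 else qsym n / 2.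

Lemma bmat_sum i (x : 'I_4 -> fock) : \sum_j bmat i j *: x j =
  if (i < 3)%N then (-1) ^+ i *: (x i + x (inord i.+1)) else \sum_(l < 4) (-1) ^+ l *: x l.
Proof.
have i1 : inord 1 = 1 :> 'I_4 by apply: val_inj; rewrite /= inordK.
have i3 : inord 3 = ord_max :> 'I_4 by apply: val_inj; rewrite /= inordK.
rewrite !sum4 !mxE; elim/ord4P: i; rewrite /= ?inordK //= ?i1 ?i3;
  move: (x 0) (x 1) (x (inord 2)) (x ord_max) => x0 x1 x2 x3.
- by rewrite expr0 !scale1r !scale0r !addr0.
- by rewrite expr1 !scale0r !scaleN1r addr0 add0r opprD.
- by rewrite sqrrN expr1n !scale0r !scale1r !add0r.
- by rewrite expr0 expr1 sqrrN expr1n exprS sqrrN expr1n mulr1.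
Qed.

Lemma A_Ahat i n v : A_ i n v = Anorm i n *: Ahat i n v.
Proof.
by rewrite /Defs.A_ /Anorm /Ahat (bmat_sum i (fun j => a_ j n v)); case: ifP => _; rewrite ?scale1r.
Qed.

Lemma linop_A i n : linop (A_ i n).
Proof. by move=> a u v; rewrite !A_Ahat; exact: (linop_scale _ (linop_Ahat i n)). Qed.

Definition Ahat_star i n v : fock := \sum_l ainv i l *: Ahat l n v.

Lemma linop_Ahat_star i n : linop (Ahat_star i n).
Proof. by apply: linop_bigsum => l _; apply: linop_scale; exact: linop_Ahat. Qed.

Lemma sum_lt3 (V : zmodType) (F : 'I_4 -> V) :
  \sum_(i < 4 | (i < 3)%N) F i = F 0 + F 1 + F (inord 2).
Proof. by rewrite big_mkcond sum4 /= inordK //= addr0. Qed.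

Lemma sum_last (V : zmodType) (F : 'I_4 -> V) :
  \sum_i F i = \sum_(i < 4 | (i < 3)%N) F i + F ord_max.
Proof. by rewrite sum_lt3 sum4. Qed.

Lemma Astar_Ahat i m v : Astar i m.+1%:Z v = (if (i < 3)%N then 1 else 4) *: Ahat_star i m.+1%:Z v.
Proof.
have q0 := qsym_neq0 m.
have E3 j : \sum_(l < 4 | (l < 3)%N) ainv j l *: A_ l m.+1%:Z v
    = \sum_(l < 4 | (l < 3)%N) ainv j l *: Ahat l m.+1%:Z v.
  by apply: eq_bigr => l l3; rewrite A_Ahat /Anorm l3 scale1r.
rewrite /Ahat_star sum_last -E3 /Defs.Astar /= invmx_amat; case: ifPn => i3.
  (* The factor 2 / (q^n + q^(-n)) in A^{*i} cancels the one of A^4. *)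
  rewrite scale1r A_Ahat scalerA (_ : _ * Anorm _ _ = ainv i ord_max) //.
  rewrite /Anorm /=; move: q0; move: (qsym _) (ainv _ _) => x y x0; by field.
have -> : i = ord_max by apply: val_inj; have := ltn_ord i; rewrite /=; lia.
(* In A^{*4} the factor of A^4 is not compensated, but its coefficient is 0. *)
have z : ainv ord_max ord_max = 0 by rewrite mxE.
by rewrite sum_last z !scale0r.
Qed.

(** The factors of A^4, of A^{*4} and of the summand of d cancel. *)
Lemma cartan m v :
  \sum_(i < 4 | (i < 3)%N) A_ i (- m.+1%:Z) (Astar i m.+1%:Z v)
  + (2 * qsym m.+1%:Z)^-1 *: A_ ord_max (- m.+1%:Z) (Astar ord_max m.+1%:Z v)
  = \sum_(j < 4) (-1) ^+ j *: a_ j (- m.+1%:Z) (a_ j m.+1%:Z v).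
Proof.
have q0 := qsym_neq0 m.
rewrite -(quad_form (fun j k => a_ j (- m.+1%:Z) (a_ k m.+1%:Z v))).
transitivity (\sum_i Ahat i (- m.+1%:Z) (Ahat_star i m.+1%:Z v)).
  have H3 i : (i < 3)%N -> A_ i (- m.+1%:Z) (Astar i m.+1%:Z v) = Ahat i (- m.+1%:Z) (Ahat_star i m.+1%:Z v).
    by move=> hi; rewrite A_Ahat Astar_Ahat /Anorm hi !scale1r.
  have H4 : (2 * qsym m.+1%:Z)^-1 *: A_ ord_max (- m.+1%:Z) (Astar ord_max m.+1%:Z v)
      = Ahat ord_max (- m.+1%:Z) (Ahat_star ord_max m.+1%:Z v).
    rewrite A_Ahat Astar_Ahat (linopZ _ _ (linop_Ahat _ _)) !scalerA.
    have -> : (2 * qsym m.+1%:Z)^-1 * Anorm ord_max (- m.+1%:Z) * 4 = 1.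
      have -> : Anorm ord_max (- m.+1%:Z) = qsym m.+1%:Z / 2.
        by rewrite /Anorm /Defs.qsym mulrNz opprK addrC.
      by field.
    by rewrite scale1r.
  by rewrite sum_lt3 [RHS]sum4 H4 (H3 0) // (H3 1) // (H3 (inord 2)) // inordK.
apply: eq_bigr => i _; rewrite /Ahat_star (linop_sum _ _ _ (linop_Ahat _ _)).
apply: eq_bigr => l _; rewrite (linopZ _ _ (linop_Ahat _ _)); congr (_ *: _).
apply: eq_bigr => j _; rewrite /Ahat (linop_sum _ _ _ (linop_a _ _)); congr (_ *: _).
by apply: eq_bigr => k _; rewrite (linopZ _ _ (linop_a _ _)).
Qed.

Lemma A0_Ahat i v : A_ i 0 v = Ahat i 0 v.
Proof.
rewrite A_Ahat /Anorm; case: ifP => _; first by rewrite scale1r.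
by rewrite /Defs.qsym oppr0 qpow0 -mulr2n divff ?scale1r // pnatr_eq0.
Qed.

Definition cart0 v : fock := \sum_(i < 4) A_ i 0 (Astar i 0 v).

Lemma cart0E v : cart0 v = \sum_(j < 4) (-1) ^+ j *: a_ j 0 (a_ j 0 v).
Proof.
rewrite -(quad_form (fun j k => a_ j 0 (a_ k 0 v))).
apply: eq_bigr => i _; rewrite /Defs.Astar eqxx invmx_amat A0_Ahat (linop_sum _ _ _ (linop_Ahat _ _)).
apply: eq_bigr => l _; rewrite (linopZ _ _ (linop_Ahat _ _)) A0_Ahat; congr (_ *: _).
apply: eq_bigr => j _; rewrite /Ahat (linop_sum _ _ _ (linop_a _ _)); congr (_ *: _).
by apply: eq_bigr => k _; rewrite (linopZ _ _ (linop_a _ _)).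
Qed.

Definition d_eigenvalue b : C := - (tdeg b)%:R
  - 2^-1 * (\sum_(j < 4) (-1) ^+ j * mom b j ^+ 2
            + \sum_(l < 2) (cmom b l * (cmom b l + 1))%:~R).

Definition h_eigenvalue j b : C := \sum_k bmat j k * mom b k.

Definition level (k : nat) b : nat := \sum_(s : species) occ b (s, k).

Lemma osc_num s (k : nat) b : osc s (- k.+1%:Z) (osc s k.+1%:Z (ket b)) =
  ((occ b (s, k))%:R * osc_norm qpow s k.+1) *: ket b.
Proof.
rewrite osc_pos_ket -[- k.+1%:Z]/(Negz k) (linopZ _ _ (linop_osc _ _ _)) osc_neg_ket.
have [->|k0] := posnP (occ b (s, k)); first by rewrite !mul0r !scale0r.
by rewrite deloccK.
Qed.

Definition dterm (m : nat) v : fock := (m%:R ^+ 2 / qint m%:R ^+ 2) *: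
       (\sum_(i < 4 | (i < 3)%N) A_ i (- m%:Z) (Astar i m%:Z v)
        + (2 * qsym m%:Z)^-1 *: A_ ord_max (- m%:Z) (Astar ord_max m%:Z v)
        + \sum_(l < 2) c_ l (- m%:Z) (c_ l m%:Z v)).

Lemma dterm_ket (k : nat) b : dterm k.+1 (ket b) = (k.+1 * level k b)%:R *: ket b.
Proof.
rewrite /dterm cartan /a_ /c_.
have n0 : k.+1%:R != 0 :> C by rewrite pnatr_eq0.
have q0 := qint_neq0 k.
pose N : C := qint k.+1%:R ^+ 2 / k.+1%:R.
have -> : \sum_(j < 4) (-1) ^+ j *: osc (inl j) (- k.+1%:Z) (osc (inl j) k.+1%:Z (ket b))
   = (\sum_(j < 4) (occ b (inl j, k))%:R * N) *: ket b.
  rewrite scaler_suml; apply: eq_bigr => j _; rewrite osc_num scalerA /osc_norm; congr (_ *: _).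
  have s2 : (-1) ^+ j * (-1) ^+ j = 1 :> C by rewrite -exprMn mulrNN mulr1 expr1n.
  by rewrite mulrCA -mulrA [X in _ * X]mulrA s2 mul1r.
have -> : \sum_(l < 2) osc (inr l) (- k.+1%:Z) (osc (inr l) k.+1%:Z (ket b))
   = (\sum_(l < 2) (occ b (inr l, k))%:R * N) *: ket b.
  by rewrite scaler_suml; apply: eq_bigr => l _; rewrite osc_num /osc_norm mul1r.
rewrite -scalerDl scalerA -!mulr_suml -mulrDl; congr (_ *: _).
have -> : \sum_(j < 4) (occ b (inl j, k))%:R + \sum_(l < 2) (occ b (inr l, k))%:R
   = (level k b)%:R :> C.
  by rewrite /level big_sumType natrD !natr_sum.
rewrite natrM /N; move: q0 n0; move: (level k b)%:R (k.+1%:R : C) (qint _) => x y z z0 y0.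
by field; rewrite z0 y0.
Qed.

Lemma linop_Astar i m : linop (Astar i m.+1%:Z).
Proof. by move=> a u v; rewrite !Astar_Ahat; exact: (linop_scale _ (linop_Ahat_star i _)). Qed.

Lemma linop_dterm (k : nat) : linop (dterm k.+1).
Proof.
apply: linop_scale; apply: linop_add; last first.
  by apply: linop_bigsum => l _; apply: linop_comp; exact: linop_osc.
apply: linop_add; first apply: linop_bigsum => i _.
  by apply: linop_comp; [exact: linop_A|exact: linop_Astar].
by apply: linop_scale; apply: linop_comp; [exact: linop_A|exact: linop_Astar].
Qed.

Lemma level_sum b N : (tdeg b <= N)%N -> (\sum_(k < N) k.+1 * level k b = tdeg b)%N.
Proof.
move=> bN; rewrite /tdeg /wdeg sum_mset /=.
rewrite (@big_fset_incl _ _ _ _ _ (seq_fset tt (modes N))); first last.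
- by move=> x _; rewrite memNfinsupp => /eqP ->.
- apply/fsubsetP => x; rewrite mem_finsupp seq_fsetE mem_modes -lt0n => /deg_del E.
  by apply: leq_trans bN; rewrite /tdeg E leq_addr.
rewrite (perm_big _ (seq_fset_perm tt _)) undup_id ?modes_uniq // big_allpairs /=.
have -> : iota 0 N = index_iota 0 N by rewrite /index_iota subn0.
rewrite big_enum /= exchange_big /= big_mkord; apply: eq_bigr => k _.
by rewrite /level big_distrr; apply: eq_bigr => s _; rewrite mulnC.
Qed.

(** [m.-1.+1] is m for the indices of the sum; writing it so makes the family
    linear at m = 0 as well. *)
Lemma dterm_fin b : exists r : seq nat, forall m, [set m | (0 < m)%N] m ->
  m \notin r -> dterm m.-1.+1 (ket b) = 0.
Proof.
exists (iota 0 (tdeg b).+1) => -[//|k] _; rewrite mem_iota add0n ltnS -ltnNge => h.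
rewrite dterm_ket (_ : level k b = 0%N) ?muln0 ?scale0r //.
apply/eqP; rewrite sum_nat_eq0; apply/forallP => s /=; rewrite -leqn0 leqNgt.
by apply/negP => /deg_del E; move: h; rewrite /tdeg E ltnNge leq_addr.
Qed.

Definition dsum v : fock := \sum_(m \in [set m : nat | (0 < m)%N]) dterm m v.

Lemma fsum_pos (V : zmodType) (F : nat -> V) :
  \sum_(m \in [set m : nat | (0 < m)%N]) F m = \sum_(m \in [set m : nat | (0 < m)%N]) F m.-1.+1.
Proof. by apply: eq_fsbigr => -[|k] //; rewrite inE. Qed.

Lemma dsumE v : dsum v = \sum_(m \in [set m : nat | (0 < m)%N]) dterm m.-1.+1 v.
Proof. exact: fsum_pos. Qed.

Lemma linop_dsum : linop dsum.
Proof.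
move=> a u v; rewrite !dsumE.
exact: (linop_fsum (fun m => linop_dterm m.-1) dterm_fin).
Qed.

Lemma dsum_ket b : dsum (ket b) = (tdeg b)%:R *: ket b.
Proof.
rewrite dsumE (@fsbig_list _ _ _ (iota 1 (tdeg b))); first last.
- move=> [//|k] _; rewrite mem_iota add1n ltnS /= -ltnNge => h.
  rewrite dterm_ket (_ : level k b = 0%N) ?muln0 ?scale0r //.
  apply/eqP; rewrite sum_nat_eq0; apply/forallP => s /=; rewrite -leqn0 leqNgt.
  by apply/negP => /deg_del E; move: h; rewrite /tdeg E ltnNge leq_addr.
- by move=> m; rewrite mem_iota => /andP[].
- exact: iota_uniq.
rewrite -[1%N]addn0 iotaDl big_map.
have -> : iota 0 (tdeg b) = index_iota 0 (tdeg b) by rewrite /index_iota subn0.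
rewrite big_mkord (eq_bigr (fun k : 'I_(tdeg b) => (k.+1 * level k b)%:R *: ket b)) => [|k _]; last first.
  by rewrite add1n dterm_ket.
by rewrite -scaler_suml -natr_sum level_sum.
Qed.

Lemma d_opE v : d_op qpow v = lin (fun b => d_eigenvalue b *: ket b) v.
Proof.
pose Z w : fock := \sum_(j < 4) (-1) ^+ j *: a_ j 0 (a_ j 0 w) + \sum_(l < 2) c_ l 0 (c_ l 0 w + w).
have dE w : d_op qpow w = - dsum w - 2^-1 *: Z w.
  have -> : d_op qpow w = - dsum w - 2^-1 *: (cart0 w + \sum_(l < 2) c_ l 0 (c_ l 0 w + w)) by [].
  by rewrite cart0E.
have Z_lin : linop Z.
  apply: linop_add; apply: linop_bigsum => j _.
    by apply: linop_scale; apply: linop_comp; exact: linop_osc.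
  apply: linop_comp; first exact: linop_osc.
  by apply: linop_add; [exact: linop_osc|exact: linop_id].
have Z_ket b : Z (ket b) = (\sum_(j < 4) (-1) ^+ j * mom b j ^+ 2
            + \sum_(l < 2) (cmom b l * (cmom b l + 1))%:~R) *: ket b.
  rewrite scalerDl !scaler_suml; apply: eq_add2; apply: eq_bigr => j _.
    by rewrite /a_ !osc_zero_ket (linopZ _ _ (linop_osc _ _ _)) osc_zero_ket !scalerA -mulrA expr2.
  rewrite /c_ osc_zero_ket -[X in _ *: X + X]scale1r scalerA mulr1 -scalerDl.
  rewrite (linopZ _ _ (linop_osc _ _ _)) osc_zero_ket scalerA /=.
  by rewrite intrM intrD mulrC.
rewrite dE; move: v; apply: eq_linop.
- by apply: linop_add; apply: linop_opp; [exact: linop_dsum|exact: linop_scale].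
- exact: lin_linop.
- by move=> b; rewrite dsum_ket Z_ket lin_ket scalerA -scaleNr -scalerBl.
Qed.

Lemma h_opE j v : h_ qpow j v = lin (fun b => h_eigenvalue j b *: ket b) v.
Proof.
move: v; apply: eq_linop; [exact: linop_A|exact: lin_linop|].
move=> b; rewrite lin_ket /h_ A0_Ahat /Ahat /h_eigenvalue scaler_suml; apply: eq_bigr => k _.
by rewrite /a_ osc_zero_ket scalerA.
Qed.

(** Compare coefficients of each state. *)
Lemma diag_eigen (f : state C -> C) (c : C) v :
  lin (fun b => f b *: ket b) v = c *: v <-> supp (fun b => f b = c) v.
Proof.
have fE b : mcoeff b (lin (fun b => f b *: ket b) v) = f b * mcoeff b v.
  rewrite /lin raddf_sum /=; have [bv|bv] := boolP (b \in msupp v).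
    rewrite (big_fsetD1 b) //= !mcoeffZ mcoeff_ket eqxx mulr1 mulrC.
    rewrite big1_fset ?addr0 // => b'.
    by rewrite !inE => /andP[/negbTE bb _] _; rewrite !mcoeffZ mcoeff_ket bb !mulr0.
  rewrite (mcoeff_outdom bv) mulr0 big1_fset // => b' bv' _.
  rewrite !mcoeffZ mcoeff_ket; case: eqP => [E|_]; last by rewrite !mulr0.
  by rewrite E (negbTE bv) in bv'.
split=> [e|h].
  split=> b; rewrite -mcoeff_neq0 => b0; have := congr1 (mcoeff b) e.
  by rewrite fE mcoeffZ => /(mulIf b0).
apply/malgP => b; rewrite fE mcoeffZ; have [bv|/mcoeff_outdom ->] := boolP (b \in msupp v).
  by rewrite (suppP h bv).
by rewrite !mulr0.
Qed.

End Derivation.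

(** * Complex powers of q and geometric bounds *)

Section ComplexPower.
Variable R : realType.
Local Notation C := (Cplx R).

Lemma cexpD (x y : C) : cexp (x + y) = cexp x * cexp y.
Proof.
case: x y => [a b] [c d]; rewrite /cexp /=; apply/eqP; rewrite eq_complex /=.
by rewrite expRD cosD sinD; apply/andP; split; apply/eqP; ring.
Qed.

Lemma cexp0 : cexp (0 : C) = 1.
Proof. by rewrite /cexp /= expR0 cos0 sin0 mulr1 mulr0. Qed.

Variables (q lq : C).
Hypothesis hq : 0 < `|q| < 1.
Hypothesis hlq : cexp lq = q.
Local Notation qpow := (qexp lq).

Lemma qpowD x y : qpow (x + y) = qpow x * qpow y.
Proof. by rewrite /qexp mulrDl cexpD. Qed.

Lemma qpow0 : qpow 0 = 1.
Proof. by rewrite /qexp mul0r cexp0. Qed.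

Lemma qpow_nat (n : nat) : qpow n%:R = q ^+ n.
Proof.
elim: n => [|n IH]; first by rewrite qpow0 expr0.
by rewrite -natr1 qpowD IH exprSr; congr (_ * _); rewrite /qexp mul1r.
Qed.

Lemma qpow_neq0 x : qpow x != 0.
Proof.
apply/eqP => x0; have := qpowD x (- x); rewrite subrr qpow0 x0 mul0r.
by move/eqP; rewrite oner_eq0.
Qed.

Lemma qpowN x : qpow (- x) = (qpow x)^-1.
Proof. by apply: (mulfI (qpow_neq0 x)); rewrite -qpowD subrr qpow0 divff ?qpow_neq0. Qed.

Lemma q_lt1 : `|q| < 1. Proof. by case/andP: hq. Qed.
Lemma q_neq0 : q != 0. Proof. by rewrite -normr_gt0; case/andP: hq. Qed.

Lemma qn_norm (n : nat) : `|q ^+ n.+1| != 1.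
Proof. by rewrite normrX lt_eqF // r_exp_lt1 // normr_ge0 q_lt1. Qed.

Lemma qint_neq0 (m : nat) : qint qpow m.+1%:R != 0.
Proof.
have h (n : nat) : qpow n.+1%:R - qpow (- n.+1%:R) != 0.
  rewrite qpowN qpow_nat subr_eq0; apply/eqP => e.
  have := qn_norm (n + n.+1); rewrite -addSn exprD {1}e mulVf ?normr1 ?eqxx //.
  by rewrite expf_neq0 // q_neq0.
by rewrite /qint mulf_neq0 // invr_eq0; exact: (h 0%N).
Qed.

Lemma qsym_neq0 (m : nat) : qsym qpow m.+1%:Z != 0.
Proof.
rewrite /qsym -pmulrn qpowN qpow_nat addr_eq0; apply/eqP => e.
have := qn_norm (m + m.+1); rewrite -addSn exprD {1}e mulNr mulVf ?normrN1 ?eqxx //.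
by rewrite expf_neq0 // q_neq0.
Qed.

Lemma cexp_ipi (n : int) : cexp ((Complex 0 pi : C) * n%:~R) = (-1) ^ n.
Proof.
have hn (m : nat) : cexp ((Complex 0 pi : C) * m%:R) = (-1) ^+ m.
  elim: m => [|m IH]; first by rewrite mulr0 cexp0.
  rewrite -natr1 mulrDr mulr1 cexpD IH exprSr; congr (_ * _).
  rewrite /cexp expR0 cospi sinpi !mul1r; apply/eqP; rewrite eq_complex /=.
  by rewrite !eqxx oppr0 eqxx.
case: n => m; first exact: hn.
have := cexpD ((Complex 0 pi : C) * m.+1%:R) ((Complex 0 pi : C) * (Negz m)%:~R).
rewrite -mulrDr NegzE mulrNz subrr mulr0 cexp0 hn => e.
have n0 : (-1) ^+ m.+1 != 0 :> C by rewrite expf_neq0 // oppr_eq0 oner_eq0.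
by rewrite -exprnN; apply: (mulfI n0); rewrite -e divff.
Qed.

End ComplexPower.

(** A finite set of pairs lies in a rectangle. *)
Lemma bound_prod (K : numDomainType) (I J : choiceType) (f : I -> K) (g : J -> K) (B1 B2 : K) :
  (forall i, 0 <= f i) -> (forall j, 0 <= g j) ->
  (forall F : {fset I}, \sum_(i <- F) f i <= B1) ->
  (forall F : {fset J}, \sum_(j <- F) g j <= B2) ->
  forall F : {fset I * J}, \sum_(x <- F) f x.1 * g x.2 <= B1 * B2.
Proof.
move=> f0 g0 fB gB F.
pose G1 := [fset x.1 | x in F]%fset; pose G2 := [fset x.2 | x in F]%fset.
pose r := [seq (i, j) | i <- enum_fset G1, j <- enum_fset G2].
have ur : uniq r by apply: allpairs_uniq => //= -[? ?] [? ?].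
have FB : (F `<=` seq_fset tt r)%fset.
  apply/fsubsetP => -[i j] ij; rewrite seq_fsetE; apply/allpairsP; exists (i, j); split => //=.
    by apply/imfsetP; exists (i, j).
  by apply/imfsetP; exists (i, j).
apply: le_trans (ler_fsum _ FB) _; first by move=> x; exact: mulr_ge0.
rewrite (perm_big _ (seq_fset_perm tt r)) undup_id // big_allpairs /=.
have -> : \sum_(i <- G1) \sum_(j <- G2) f i * g j = (\sum_(i <- G1) f i) * (\sum_(j <- G2) g j).
  by rewrite mulr_suml; apply: eq_bigr => i _; rewrite mulr_sumr.
by apply: ler_pM => //; apply: sumr_ge0.
Qed.

Section TriBound.
Variables (K : numFieldType) (r : K).
Hypothesis r01 : 0 < r < 1.

Lemma geom_bound (F : {fset nat}) : \sum_(l <- F) r ^+ l <= (1 - r)^-1.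
Proof.
case/andP: r01 => r0 r1; have d0 : 0 < 1 - r by rewrite subr_gt0.
pose N := (\sum_(l <- F) l).+1.
have FN : (F `<=` seq_fset tt (iota 0 N))%fset.
  apply/fsubsetP => l lF; rewrite seq_fsetE mem_iota /= add0n ltnS.
  by rewrite (big_fsetD1 l) //= leq_addr.
apply: le_trans (ler_fsum _ FN) _; first by move=> l; rewrite exprn_ge0 // ltW.
rewrite (perm_big _ (seq_fset_perm tt _)) undup_id ?iota_uniq //.
have -> : iota 0 N = index_iota 0 N by rewrite /index_iota subn0.
rewrite big_mkord -div1r ler_pdivlMr // mulrC.
have -> : (1 - r) * (\sum_(i < N) r ^+ i) = 1 - r ^+ N.
  by rewrite -[1 - r]opprB mulNr -subrX1 opprB.
by rewrite gerBl exprn_ge0 // ltW.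
Qed.

Lemma tri_bound (n : int) (s : bool) (F : {fset nat}) :
  \sum_(l <- F) r ^+ tri (n + sgn s * l.+1%:Z) <= r ^- absz n * (1 - r)^-1.
Proof.
case/andP: r01 => r0 r1; have rn : 0 < r ^- absz n by rewrite invr_gt0 exprn_gt0.
apply: le_trans (_ : r ^- absz n * \sum_(l <- F) r ^+ l <= _); last first.
  by rewrite ler_pM2l //; exact: geom_bound.
rewrite mulr_sumr; apply: ler_sum => l _.
rewrite [leRHS]mulrC ler_pdivlMr ?exprn_gt0 // -exprD ler_wiXn2l ?(ltW r0) ?(ltW r1) //.
by have := tri_ge (n + sgn s * l.+1%:Z); case: s => /=; lia.
Qed.

End TriBound.

(** * Weight spaces of the submodules *)

Section WeightSpaces.
Variables (C : numClosedFieldType) (qpow : C -> C).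
Local Notation fock := (fock C).
Local Notation ket := (@ket C).
Local Notation qint := (qint qpow).
Local Notation qsym := (qsym qpow).
Local Notation zproj := (@zproj C qpow).
Local Notation sector_states := (@sector_states C).
Hypothesis qint_neq0 : forall m : nat, qint m.+1%:R != 0.
Hypothesis qsym_neq0 : forall m : nat, qsym m.+1%:Z != 0.
Hypothesis qpow0 : qpow 0 = 1.
Implicit Types (v : fock) (b : state C) (beta : C) (i j k e : int) (s : bool).

(** The four submodules in a uniform way: eta xi for a negative sign and xi eta
    for a positive one. *)
Definition submod_proj s1 s2 v : fock := zproj s1 0 (zproj s2 1 v).

Lemma submodE beta s1 s2 : submod qpow beta s1 s2 = [set submod_proj s1 s2 v | v in calF beta].
Proof.
have -> : submod_proj s1 s2 = (fun v =>
    zmode qpow (~~ s1) 0 (zmode qpow s1 0 (zmode qpow (~~ s2) 1 (zmode qpow s2 1 v)))).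
  by apply/funext => v; rewrite /submod_proj !zprojE.
by rewrite zmode.unlock; case: s1; case: s2.
Qed.

Lemma linop_submod_proj s1 s2 : linop (submod_proj s1 s2).
Proof. by apply: linop_comp; exact: linop_zproj. Qed.

Lemma submod_proj_idem s1 s2 v : submod_proj s1 s2 (submod_proj s1 s2 v) = submod_proj s1 s2 v.
Proof.
rewrite /submod_proj (@zprojC _ qpow s2 s1 1 0) // (zproj_idem qint_neq0 s2).
by rewrite (zproj_idem qint_neq0 s1).
Qed.

Lemma submod_proj_states s1 s2 mu nu e v : insupp (sector_states mu nu e) v ->
  insupp (sector_states mu nu e) (submod_proj s1 s2 v).
Proof. by move=> h; do 2! apply: zproj_states. Qed.

Lemma calF_supp beta v : calF beta v <->
  supp (fun b => exists i j k, mom b = mom_of beta i j k /\ cmom b = cmom_of i j k) v.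
Proof. by split=> [h|h] //; exact: suppP h. Qed.

Lemma submod_proj_calF s1 s2 beta v : calF beta v -> calF beta (submod_proj s1 s2 v).
Proof.
rewrite !calF_supp; apply: supp_linop; first exact: linop_submod_proj.
move=> b [i [j [k [h1 h2]]]].
have hb : sector (mom b) (cmom b) ((tdeg b)%:Z + (tri (cmom b 0))%:Z + (tri (cmom b 1))%:Z) b by [].
apply: suppW (submod_proj_states s1 s2 (insupp_ket (proj2 (in_states _ _ _ _) hb))) => b' /in_states[k1 k2 _].
by exists i, j, k; rewrite k1 k2.
Qed.

Lemma submodP beta s1 s2 v :
  submod qpow beta s1 s2 v <-> calF beta v /\ submod_proj s1 s2 v = v.
Proof.
rewrite submodE; split=> [[w hw <-]|[hv e]]; last by exists v.
by split; [exact: submod_proj_calF|exact: submod_proj_idem].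
Qed.

(** The energy of the momentum (i, j, k), up to the contribution of the charges
    i - j and k. *)
Definition energy0 beta i j k : C := 2^-1 * (2 * beta + 1) + (k + i * j - k * j)%:~R.

(** The squares of the momenta with alternating signs add up to 2 beta plus an
    integer. *)
Lemma d_eigenvalue_sector beta i j k e b : sector (mom_of beta i j k) (cmom_of i j k) e b ->
  d_eigenvalue b = - (energy0 beta i j k + e%:~R).
Proof.
move=> [h1 h2 <-]; rewrite /d_eigenvalue h1 h2 sum4 !big_ord_recl big_ord0 !ffunE /= !inordK //.
have two0 : 2 != 0 :> C by rewrite pnatr_eq0.
have triC n : (tri n)%:~R = 2^-1 * (n * (n + 1))%:~R :> C.
  by rewrite -triE intrM mulrA mulVf // mul1r.
rewrite /energy0.
rewrite -[(tdeg b)%:R]/((tdeg b)%:~R) !intrD !triC !(intrD, intrM, rmorphN, intrB) /=.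
by field.
Qed.

Lemma h_eigenvalue_sector beta i j k b l : mom b = mom_of beta i j k ->
  h_eigenvalue l b = xweight beta i j k 0 l.
Proof.
move=> h; rewrite /h_eigenvalue h sum4 !mxE !ffunE /= !inordK //.
elim/ord4P: l; rewrite /= ?inordK //= ?(intrD, intrM, rmorphN, intrB) /=; ring.
Qed.

Lemma xweight_inj beta i j k i' j' k' :
  xweight beta i j k = xweight beta i' j' k' -> [/\ i = i', j = j' & k = k'].
Proof.
move=> /matrixP h; have := h 0 0; have := h 0 1; have := h 0 ord_max; rewrite !mxE /=.
move=> /addrI /intr_inj h3 /intr_inj h1 /intr_inj h0; split; lia.
Qed.

(** Both d and the h_j are diagonal on states, so a weight vector consists of
    states of this weight. *)
Lemma weight_supp beta s1 s2 delta mu v :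
  weight_space qpow (submod qpow beta s1 s2) delta mu v <->
  supp (fun b => exists i j k e, [/\ sector (mom_of beta i j k) (cmom_of i j k) e b,
     delta = - (energy0 beta i j k + e%:~R) & mu = xweight beta i j k]) v
  /\ submod_proj s1 s2 v = v.
Proof.
split=> [[/submodP[hv ppv] dv hv']|[hv ppv]].
  split=> //; split=> b bv; have [i [j [k [h1 h2]]]] := hv b bv.
  exists i, j, k, ((tdeg b)%:Z + (tri (cmom_of i j k 0))%:Z + (tri (cmom_of i j k 1))%:Z).
  have sb : sector (mom_of beta i j k) (cmom_of i j k)
     ((tdeg b)%:Z + (tri (cmom_of i j k 0))%:Z + (tri (cmom_of i j k 1))%:Z) b by [].
  split=> //.
    rewrite -(d_eigenvalue_sector sb); apply/esym.
    by move: dv; rewrite d_opE // => /diag_eigen /suppP; apply.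
  apply/rowP => l; rewrite -(h_eigenvalue_sector l h1); apply/esym.
  by have := hv' l; rewrite h_opE // => /diag_eigen /suppP; apply.
split; first apply/submodP; first split=> // b bv.
- by have [i [j [k [e [[h1 h2 _] _ _]]]]] := suppP hv bv; exists i, j, k.
- rewrite d_opE //; apply/diag_eigen; apply: suppW hv => b [i [j [k [e [h1 -> _]]]]].
  exact: d_eigenvalue_sector h1.
- move=> l; rewrite h_opE //; apply/diag_eigen; apply: suppW hv => b [i [j [k [e [[h1 _ _] _ ->]]]]].
  exact: h_eigenvalue_sector.
Qed.

Lemma weightP beta s1 s2 i j k e v :
  weight_space qpow (submod qpow beta s1 s2) (- (energy0 beta i j k + e%:~R))
    (xweight beta i j k) v <->
  insupp (sector_states (mom_of beta i j k) (cmom_of i j k) e) v /\ submod_proj s1 s2 v = v.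
Proof.
rewrite weight_supp susubmod_proj_states; split=> -[hv ppv]; split=> //; apply: suppW hv => b.
  move=> [i' [j' [k' [e' [sb /oppr_inj he /xweight_inj[ii jj kk]]]]]].
  by move: sb he; rewrite -ii -jj -kk => sb /addrI/intr_inj ->.
by move=> sb; exists i, j, k, e.
Qed.

Lemma weight_nil beta s1 s2 delta mu v :
  (forall i j k e, ~ (delta = - (energy0 beta i j k + e%:~R) /\ mu = xweight beta i j k)) ->
  weight_space qpow (submod qpow beta s1 s2) delta mu v <-> v = 0.
Proof.
move=> no; rewrite weight_supp; split=> [[hv _]|->].
  by apply: supp_nil hv => b [i [j [k [e [_ h1 h2]]]]]; exact: (no i j k e).
by split; [exact: supp0|rewrite (linop0 (linop_submod_proj _ _))].
Qed.

Lemma fd_trace_nil (W : set fock) T : (forall v, W v <-> v = 0) -> fd_trace W T 0.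
Proof.
move=> hW; exists 0%N, (fun=> 0), 1%:M; split; last by rewrite mxtrace1.
- split=> [[]//|v /hW ->]; exists 0; split; first by rewrite big_ord0.
  by move=> y _; rewrite [y]thinmx0.
- by case.
Qed.

(** The weight space is the image of the projector on the sector. *)
Lemma fd_trace_weight beta s1 s2 i j k e (T : fock -> fock) (u : C) :
  (forall v, insupp (sector_states (mom_of beta i j k) (cmom_of i j k) e) v -> T v = u *: v) ->
  fd_trace (weight_space qpow (submod qpow beta s1 s2) (- (energy0 beta i j k + e%:~R))
    (xweight beta i j k)) T
    (u * trace (sector_states (mom_of beta i j k) (cmom_of i j k) e) (submod_proj s1 s2)).
Proof.
move=> hT; have [||m [f [hB ->]]] := @idem_basis C
    (sector_states (mom_of beta i j k) (cmom_of i j k) e) (submod_proj s1 s2) (linop_submod_proj s1 s2).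
- by move=> b bS; apply: submod_proj_states; exact: insupp_ket.
- exact: submod_proj_idem.
have {}hB := hB _ (weightP beta s1 s2 i j k e).
exists m, f, (u%:M); split=> //; last by rewrite mxtrace_scalar mulr_natr.
move=> x; have /weightP[hx _] := proj1 hB x.
rewrite (hT _ hx) (bigD1 x) //= mxE eqxx mulr1n big1 ?addr0 // => y yx.
by rewrite mxE (negbTE yx) mulr0n scale0r.
Qed.

(** The projector preserves sectors, so it maps each state to a weight vector. *)
Lemma weight_decomp beta s1 s2 v : submod qpow beta s1 s2 v ->
  exists s : seq fock, v = \sum_(w <- s) w /\
    forall w, w \in s -> exists delta mu, weight_space qpow (submod qpow beta s1 s2) delta mu w.
Proof.
move=> /submodP[hv ppv]; exists [seq mcoeff b v *: submod_proj s1 s2 (ket b) | b <- msupp v].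
split.
  rewrite big_map -{1}ppv (linop_lin (linop_submod_proj s1 s2)); exact: erefl.
move=> w /mapP[b bv ->]; have [i [j [k [h1 h2]]]] := hv b bv.
pose e := (tdeg b)%:Z + (tri (cmom_of i j k 0))%:Z + (tri (cmom_of i j k 1))%:Z.
exists (- (energy0 beta i j k + e%:~R)), (xweight beta i j k); apply/weightP.
rewrite (linopZ _ _ (linop_submod_proj _ _)) submod_proj_idem; split=> //.
apply: suppZ; apply: submod_proj_states.
by apply: insupp_ket; apply/in_states.
Qed.

End WeightSpaces.

(** * The characters *)

Section FiberSum.
Variables (t1 t2 : nat -> nat).
Local Notation triple := ((nat * nat) * {mset (species * nat)}%mset)%type.

(** The energy of the index (l_1, l_2, A), up to a constant, when t1 and t2 give
    the energies of the charges. *)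
Definition grade (x : triple) : nat := (t1 x.1.1 + t2 x.1.2 + wdeg predT x.2)%N.

(** The energies of the charges bound l_1 and l_2, and for given l_1 and l_2 the
    multisets A of the right weight are counted by [msets]. *)
Lemma grade_fiber (d : int) (L : nat) :
  (forall l, (t1 l)%:Z <= d -> (l < L)%N) -> (forall l, (t2 l)%:Z <= d -> (l < L)%N) ->
  exists2 F : {fset triple}, (forall x, (x \in F) = ((grade x)%:Z == d)) &
    forall (K : nzRingType) (G : nat -> nat -> K), \sum_(x <- F) G x.1.1 x.1.2 =
      \sum_(k1 < L) \sum_(k2 < L) G k1 k2 * #|` msets (d - (t1 k1)%:Z - (t2 k2)%:Z)|%:R.
Proof.
move=> L1 L2; pose P := [seq (k1, k2) | k1 <- iota 0 L, k2 <- iota 0 L].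
pose M (l : nat * nat) := enum_fset (msets (d - (t1 l.1)%:Z - (t2 l.2)%:Z)).
pose r : seq triple := [seq (l, A) | l <- P, A <- M l].
have ur : uniq r.
  apply: allpairs_uniq_dep => [|l _|]; last by move=> [l A] [l' A'] /= _ _ [-> ->].
    by apply: allpairs_uniq; rewrite ?iota_uniq // => -[? ?] [? ?].
  exact: fset_uniq.
exists (seq_fset tt r) => [[[l1 l2] A]|K G].
  rewrite seq_fsetE /grade /=; apply/allpairsPdep/eqP.
    move=> [[k1 k2] [B [_]]]; rewrite in_msets /= => /eqP hB [-> -> ->].
    by move: hB; lia.
  move=> h; exists (l1, l2), A; split=> //; last by rewrite in_msets /=; apply/eqP; lia.
  by apply/allpairsP; exists (l1, l2); rewrite !mem_iota /= !add0n; split=> //;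
    [apply: L1|apply: L2]; lia.
rewrite (perm_big _ (seq_fset_perm tt r)) undup_id // big_allpairs_dep /=.
rewrite [LHS]big_allpairs /=.
have -> : iota 0 L = index_iota 0 L by rewrite /index_iota subn0.
rewrite big_mkord; apply: eq_bigr => k1 _; rewrite big_mkord; apply: eq_bigr => k2 _.
by rewrite big_const_seq count_predT iter_addr_0 mulr_natr.
Qed.

End FiberSum.

Section Characters.
Variable R : realType.
Local Notation C := (Cplx R).
Variables (q lq beta : C) (s1 s2 : bool).
Hypothesis hq : 0 < `|q| < 1.
Hypothesis hlq : cexp lq = q.
Local Notation qpow := (qexp lq).
Local Notation triple := ((nat * nat) * {mset (species * nat)}%mset)%type.
Implicit Types (i j k e : int).

Definition ghost_deg1 i j (l : nat) : nat := tri (i - j + sgn s1 * l.+1%:Z).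
Definition ghost_deg2 k (l : nat) : nat := tri (k + sgn s2 * l.+1%:Z).

(** The part of the character at the momentum (i, j, k) that comes from the
    charges; the excited modes give the factor q^(wdeg predT A). *)
Definition ghost_term (u : C) i j k (l : nat * nat) : C :=
  u * ((-1) ^+ l.1 * (-1) ^+ l.2) * qpow (energy0 beta i j k) * q ^+ (ghost_deg1 i j l.1 + ghost_deg2 k l.2).

Definition full_term u i j k (x : triple) : C :=
  ghost_term u i j k x.1 * q ^+ wdeg predT x.2.

Lemma full_termE u i j k x : full_term u i j k x =
  u * ((-1) ^+ x.1.1 * (-1) ^+ x.1.2) * qpow (energy0 beta i j k)
    * q ^+ grade (ghost_deg1 i j) (ghost_deg2 k) x.
Proof. by rewrite /full_term /ghost_term -[LHS]mulrA -(exprD q). Qed.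

(** The terms of energy e have the same power of q, and their signs add up to
    the trace of the projector. *)
Lemma ghost_fiber u i j k e : exists2 F : {fset triple},
  (forall x, (x \in F) = ((grade (ghost_deg1 i j) (ghost_deg2 k) x)%:Z == e)) &
  \sum_(x <- F) full_term u i j k x =
    qpow (energy0 beta i j k + e%:~R) *
    (u * trace (sector_states (mom_of beta i j k) (cmom_of i j k) e) (submod_proj qpow s1 s2)).
Proof.
(* By [tri_ge], this bounds l_1 and l_2 at energy e. *)
pose L := (absz e + absz (i - j)%R + absz k).+2.
have [||F FE FS] := @grade_fiber (ghost_deg1 i j) (ghost_deg2 k) e L.
- move=> l; have := tri_ge (i - j + sgn s1 * l.+1%:Z); rewrite /ghost_deg1 /L.
  by case: s1 => /=; lia.
- move=> l; have := tri_ge (k + sgn s2 * l.+1%:Z); rewrite /ghost_deg2 /L.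
  by case: s2 => /=; lia.
exists F => //.
rewrite (@trace_zproj2 _ _ (qint_neq0 hq hlq) s1 s2 _ _ e L); last first.
  by rewrite !ffunE /= /L; lia.
rewrite !ffunE /=.
rewrite -(FS C (fun m1 m2 : nat => (-1) ^+ m1 * (-1) ^+ m2)) !mulr_sumr.
rewrite big_seq [RHS]big_seq; apply: eq_bigr => x; rewrite FE => /eqP <-.
rewrite full_termE qpowD -pmulrn (qpow_nat hlq).
by move: (qpow _) (q ^+ _) ((-1) ^+ _ * _) => a b c; ring.
Qed.

Lemma ghost_term_norm u i j k l : `|ghost_term u i j k l| =
  `|u * qpow (energy0 beta i j k)| * (`|q| ^+ ghost_deg1 i j l.1 * `|q| ^+ ghost_deg2 k l.2).
Proof.
by rewrite /ghost_term (exprD q) !normrM !normrX normrN1 !expr1n !mulr1.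
Qed.

Lemma ghost_bound u i j k : exists B : C, forall F : {fset nat * nat},
  \sum_(l <- F) `|ghost_term u i j k l| <= B.
Proof.
exists (`|u * qpow (energy0 beta i j k)| * ((`|q| ^- absz (i - j)%R * (1 - `|q|)^-1)
   * (`|q| ^- absz k * (1 - `|q|)^-1))) => F.
rewrite (eq_bigr (fun l => `|u * qpow (energy0 beta i j k)| *
   (`|q| ^+ ghost_deg1 i j l.1 * `|q| ^+ ghost_deg2 k l.2))); last by move=> l _; exact: ghost_term_norm.
rewrite -mulr_sumr ler_wpM2l //.
apply: (@bound_prod _ _ _ (fun l => `|q| ^+ ghost_deg1 i j l) (fun l => `|q| ^+ ghost_deg2 k l)).
- by move=> l; rewrite exprn_ge0.
- by move=> l; rewrite exprn_ge0.
- exact: tri_bound.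
- exact: tri_bound.
Qed.

(** Absolute summability holds for each factor and hence for the product. *)
Lemma usum_terms u i j k (S B : C) :
  usum (fun A : {mset (species * nat)}%mset => q ^+ wdeg predT A) S ->
  (forall F : {fset {mset (species*nat)}%mset}, \sum_(A <- F) `|q ^+ wdeg predT A| <= B) ->
  exists2 s, usum (ghost_term u i j k) s & usum (full_term u i j k) (s * S).
Proof.
move=> hS hB; have [B' hB'] := ghost_bound u i j k.
have [s hs] := abs_usum hB'; exists s => //.
have [s' hs'] : exists s', usum (full_term u i j k) s'.
  apply: (@abs_usum _ _ _ (B' * B)) => F.
  rewrite (eq_bigr (fun x => `|ghost_term u i j k x.1| * `|q ^+ wdeg predT x.2|)); last first.
    by move=> x _; rewrite /full_term normrM.
  exact: (@bound_prod _ _ _ (fun l => `|ghost_term u i j k l|)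
            (fun A : {mset (species*nat)}%mset => `|q ^+ wdeg predT A|)).
by rewrite -(usum_prod hs hS hs').
Qed.

(** Twice the energies of the charges i - j + s_1 l_1 and k + s_2 l_2 are
    n (n + 1), which expands into the exponents of the formula. *)
Lemma ghost_exponent i j k (l : nat * nat) :
  let l1 : int := l.1.+1%:Z in let l2 : int := l.2.+1%:Z in
  qpow (energy0 beta i j k) * q ^+ (ghost_deg1 i j l.1 + ghost_deg2 k l.2) =
  qpow (2^-1 * (2 * beta + 1))
  * qpow (2^-1 * (l1 ^+ 2 + l2 ^+ 2 + sgn s1 * l1 + sgn s2 * l2)%:~R)
  * qpow (2^-1 * (i ^+ 2 + j ^+ 2 + k ^+ 2 - 2 * k * j
                             + (1 + 2 * sgn s1 * l1) * i
                             - (1 + 2 * sgn s1 * l1) * j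
                             + (3 + 2 * sgn s2 * l2) * k)%:~R).
Proof.
move=> l1 l2; rewrite -(qpow_nat hlq) -!qpowD; congr qpow.
rewrite /energy0 -!addrA; congr (_ + _).
apply: (mulfI (_ : 2 != 0 :> C)); first by rewrite pnatr_eq0.
rewrite !mulrDr !mulrA mulfV ?pnatr_eq0 // !mul1r.
rewrite [(ghost_deg1 _ _ _ + _)%:R]pmulrn (_ : 2 = (2 : int)%:~R :> C) // -!intrM -!intrD; congr (_ %:~R).
rewrite PoszD !mulrDr !triE -/l1 -/l2.
by case: s1; case: s2 => /=; ring.
Qed.

Section Formula.
Variable u : int -> int -> int -> C.

Lemma euler_lim (S : C) :
  \prod_(m < N) (1 - q ^+ m.+1) ^+ 6 @[N --> \oo] --> S^-1 ->
  lim (\prod_(1 <= n < N.+1) (1 - qpow n%:R) ^+ 6 @[N --> \oo]) = S^-1.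
Proof.
move=> h; rewrite (_ : (fun N => _) = (fun N => \prod_(m < N) (1 - q ^+ m.+1) ^+ 6)).
  by apply: cvg_lim => //; exact: norm_hausdorff.
apply/funext => N; rewrite big_add1 /= big_mkord.
by apply: eq_bigr => m _; rewrite (qpow_nat hlq).
Qed.

Lemma formula_xweight i j k (S s : C) :
  \prod_(m < N) (1 - q ^+ m.+1) ^+ 6 @[N --> \oo] --> S^-1 ->
  usum (ghost_term (u i j k) i j k) s ->
  formula qpow beta s1 s2 u (xweight beta i j k) = s * S.
Proof.
move=> hS hs; rewrite /formula (euler_lim hS) invrK.
have c0 : qpow (2^-1 * (2 * beta + 1)) != 0 by exact: qpow_neq0.
set c := qpow _ in c0 *; rewrite (@usum_sum _ _ _ (c^-1 * s)); first by field.
apply: eq_usum (usumZ c^-1 hs) => l; apply: (canLR (mulKf c0)).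
rewrite (_ : [set t | _] = [set (i, j, k)]); last first.
  apply/seteqP; split=> [[[i' j'] k'] /= /xweight_inj[-> -> ->] //|t -> //].
rewrite fsbig_set1 /= /ghost_term -[LHS]mulrA ghost_exponent -/c.
rewrite -PoszD -exprnP addSn addnS !exprS mulN1r mulN1r opprK exprD.
move: (qpow _) (qpow _) (_ ^+ _) (_ ^+ _) => a b d e; ring.
Qed.

Lemma formula_nil mu : (forall i j k, mu <> xweight beta i j k) ->
  formula qpow beta s1 s2 u mu = 0.
Proof.
move=> no; rewrite /formula (@usum_sum _ _ _ 0) ?mulr0 //.
apply: eq_usum (@usum0 _ _) => l /=.
rewrite (_ : [set t | _] = set0) ?fsbig_set0 ?mulr0 //.
by rewrite -subset0 => t /= h; apply: no (esym h).
Qed.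

Variable T : fock C -> fock C.
Hypothesis T_scalar : forall i j k e v,
  insupp (sector_states (mom_of beta i j k) (cmom_of i j k) e) v -> T v = u i j k *: v.

(** The sum of full_term converges absolutely; grouped by the eigenvalue of d it
    is the sum of the traces, and computed as a product it is the value of the
    formula. *)
Lemma character_of_scalar :
  is_character qpow (submod qpow beta s1 s2) T (formula qpow beta s1 s2 u).
Proof.
have qn := qint_neq0 hq hlq; have qs := qsym_neq0 hq hlq; have q0 := qpow0 lq.
split; first by move=> v; exact: weight_decomp.
have /choice[t /all_and3[t_tr t_nil t_fib]] : forall x : C * 'rV[C]_4, exists t : C,
  [/\ fd_trace (weight_space qpow (submod qpow beta s1 s2) x.1 x.2) T t,
    (forall i j k, x.2 <> xweight beta i j k) -> t = 0 &
    forall i j k, x.2 = xweight beta i j k ->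
      exists2 F : {fset triple},
        (forall y, (y \in F) =
           (- (energy0 beta i j k + (grade (ghost_deg1 i j) (ghost_deg2 k) y)%:R) == x.1)) &
        qpow (- x.1) * t = \sum_(y <- F) full_term (u i j k) i j k y].
  move=> [delta mu] /=.
  have [[i [j [k [e [-> ->]]]]]|no] := pselect (exists i j k e,
      delta = - (energy0 beta i j k + e%:~R) /\ mu = xweight beta i j k).
    eexists; split; first exact: fd_trace_weight (@T_scalar i j k e).
      by move=> /(_ i j k).
    move=> i' j' k' /xweight_inj[<- <- <-].
    have [F FE FS] := ghost_fiber (u i j k) i j k e.
    exists F => [y|]; last by rewrite FS opprK.
    by rewrite FE eqr_opp (inj_eq (addrI _)) pmulrn eqr_int.
  exists 0; split=> //; first apply: fd_trace_nil => v.
    by apply: weight_nil => // i j k e h; apply: no; exists i, j, k, e.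
  move=> i j k muE; exists fset0 => [y|]; last by rewrite big_seq_fset0 mulr0.
  rewrite inE; apply/esym/negbTE/eqP => h; apply: no.
  by exists i, j, k, (grade (ghost_deg1 i j) (ghost_deg2 k) y)%:Z; rewrite -h.
exists (fun delta mu => t (delta, mu)); split=> [delta mu|mu].
  exact: t_tr (delta, mu).
apply: usum_cvg.
have [[i [j [k ->]]]|no] := pselect (exists i j k, mu = xweight beta i j k).
  have [S [S0 hS [B hB] hlim]] := euler (q_lt1 hq).
  have [s hs hsS] := usum_terms (u i j k) i j k hS hB.
  rewrite (formula_xweight hlim hs); apply: usum_fiber hsS => delta.
  exact: (t_fib (delta, xweight beta i j k) i j k erefl).
rewrite formula_nil; last by move=> i j k h; apply: no; exists i, j, k.
apply: eq_usum (@usum0 _ _) => delta /=.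
by rewrite t_nil ?mulr0 // => i j k h; apply: no; exists i, j, k.
Qed.

End Formula.

End Characters.

Section Sign.
Variable R : realType.
Local Notation C := (Cplx R).

(** On a sector, a^2_0 + a^4_0 + 2 beta is the integer - (1 + i - j + k), whose
    sign does not matter for the parity. *)
Lemma fermion_sign_sector (beta : C) i j k e v :
  insupp (sector_states (mom_of beta i j k) (cmom_of i j k) e) v ->
  fermion_sign beta v = (-1) ^ (1 + i - j + k) *: v.
Proof.
move=> hv.
apply: (eq_linop_supp (lin_linop _) (linop_scale _ (@linop_id _)) _ hv) => b.
move=> /in_states[h1 _ _]; rewrite /fermion_sign lin_ket; congr (_ *: _).
rewrite /zero_mode h1 !ffunE /= !inordK //=.
rewrite (_ : _ + 2 * beta = (- (1 + i - j + k))%:~R); last first.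
  by rewrite !(intrD, intrB, rmorphN) /=; ring.
by rewrite cexp_ipi -exprz_inv invrN invr1.
Qed.
End Sign.

Theorem proposition7 (R : realType) (q lq : Cplx R)
    (hq : 0 < `|q| < 1) (hlq : cexp lq = q)
    (beta : Cplx R) (s1 s2 : bool) :
  is_character (qexp lq) (submod (qexp lq) beta s1 s2) id
    (formula (qexp lq) beta s1 s2 (fun i j k => 1))
  /\
  is_character (qexp lq) (submod (qexp lq) beta s1 s2) (fermion_sign beta)
    (formula (qexp lq) beta s1 s2 (fun i j k => (-1) ^ (1 + i - j + k))).
Proof.
split; apply: (@character_of_scalar R q lq beta s1 s2 hq hlq) => i j k e v hv.
  by rewrite scale1r.
exact: fermion_sign_sector hv.
Qed.
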